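(* Let $E$ be a complex Banach space and let $T\in N_k(E)$ be a current of bidimension $(0,k)$ with $\overline\partial T=0$, such that $\mathrm{supp}\,T$ is bounded and at positive distance from $0$. Then there exists a quasi-local metric current $U$ of bidimension $(0,k+1)$ such that $\overline\partial U=T$.
   Context: Metric currents (Ambrosio–Kirchheim) on $E$: with $\mathscr E^k(E)=\mathrm{Lip}_b(E)\times[\mathrm{Lip}(E)]^k$ (complex-valued), a $k$-dimensional metric current is a multilinear $T:\mathscr E^k(E)\to\mathbb C$, continuous under pointwise convergence with uniformly bounded Lipschitz constants, local ($T(f,\pi)=0$ if some $\pi_j$ is constant near $\mathrm{supp} f$), of finite mass (finite Radon $\mu$ with $|T(f,\pi)|\le\prod_j\mathrm{Lip}(\pi_j)\int|f|d\mu$). Boundary $dT(f,\pi)=T(1,f,\pi)$; $N_k(E)$: currents with boundary of finite mass. Quasi-local currents: $\mathscr E_{\mathrm{q\text{-}loc}}(E)$ = Lipschitz functions with bounded support; $\mathrm{Lip}_{\mathrm{q\text{-}loc}}(E)$ = continuous functions Lipschitz on every ball $B(0,R)$; $\mathscr E^k_{\mathrm{q\text{-}loc}}(E)=\mathscr E_{\mathrm{q\text{-}loc}}(E)\times[\mathrm{Lip}_{\mathrm{q\text{-}loc}}(E)]^k$. Convergence in $\mathscr E^k_{\mathrm{q\text{-}loc}}$: pointwise convergence, first entries supported in a common ball with uniformly bounded Lipschitz constants, other entries with Lipschitz constants on each fixed ball uniformly bounded. A quasi-local $k$-dimensional metric current is a multilinear $T:\mathscr E^k_{\mathrm{q\text{-}loc}}(E)\to\mathbb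 C$, continuous for this convergence, local, and such that for each $R>0$ there is a finite Radon measure $\mu_R$ with $|T(f,\pi)|\le\prod_j\mathrm{Lip}(\pi_j|_{B(0,R)})\int_{B(0,R)}|f|d\mu_R$ whenever $\mathrm{supp} f\subset B(0,R)$; its boundary is $dT(f,\pi)=T(\sigma,f,\pi)$ with $\sigma\in\mathscr E_{\mathrm{q\text{-}loc}}(E)$ equal to $1$ near $\mathrm{supp} f$. For (quasi-local or Ambrosio–Kirchheim) currents, bidimension $(p,q)$, $p+q=k$, means vanishing on $(f,\pi)$ whenever $p+1$ of the $\pi_j$, or $q+1$ of the $\overline{\pi_j}$, are holomorphic on an open set containing $\mathrm{supp} f$. For $T$ of bidimension $(p,q)$ whose boundary admits a (unique) decomposition into currents of fixed bidimension, that decomposition is $(dT)_{p,q-1}+(dT)_{p-1,q}$, and $\overline\partial T:=(dT)_{p,q-1}$, $\partial T:=(dT)_{p-1,q}$; in particular for bidimension $(0,k)$ one has $\overline\partial T=dT$. *)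

(* Defs.v *)
From HB Require Import structures.
From mathcomp Require Import all_boot all_order all_algebra.
From mathcomp Require Import complex.
From mathcomp Require Import all_classical all_reals all_analysis.
Set Implicit Arguments. Unset Strict Implicit. Unset Printing Implicit Defensive.
Import Order.TTheory GRing.Theory Num.Theory.
Import numFieldNormedType.Exports.
Local Open Scope classical_set_scope.
Local Open Scope ring_scope.

(** The field of complex numbers over a real type [R], as a
    numClosedFieldType (so that it is canonically a normed field and
    normed modules over it make sense). *)
Definition Cplx (R : realType) : numClosedFieldType := R[i].

Section MetricCurrents.
Variable R : realType.
Local Notation C := (Cplx R).
Variable E : normedModType C.

Definition rC (r : R) : C := Complex r 0.
Definition cabs (z : C) : R := complex.Re `|z|.
Definition cconj (z : C) : C := Num.conj z.

Definition fsupp (f : E -> C) : set E := closure [set x | f x != 0].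

Definition ent (s : seq (E -> C)) (j : nat) : E -> C := nth (fun _ => 0) s j.

Definition Bor : Type := g_sigma_algebraType (@open E).

Definition finite_radon (mu : {measure set Bor -> \bar R}) : Prop :=
  (mu setT < +oo)%E /\
  forall A : set Bor, measurable A ->
    mu A = ereal_sup (mu @` [set K : set Bor | compact (K : set E) /\ K `<=` A]).

Definition lipf (f : E -> C) : Prop := exists L : C, L.-lipschitz f.

Definition lipb (f : E -> C) : Prop :=
  lipf f /\ exists M : R, forall x, cabs (f x) <= M.

Definition holo_near (g : E -> C) (A : set E) : Prop :=
  exists V : set E, open V /\ A `<=` V /\ forall x, V x -> differentiable g x.

Definition bidim_vanishing (p q : nat) (f : E -> C) (s : seq (E -> C)) : Prop :=
  (p.+1 <= count (fun g => `[< holo_near g (fsupp f) >]) s)%N \/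
  (q.+1 <= count (fun g => `[< holo_near (fun x => cconj (g x)) (fsupp f) >]) s)%N.

Definition some_const_near (f : E -> C) (s : seq (E -> C)) : Prop :=
  exists j, (j < size s)%N /\ exists (V : set E) (c : C),
    open V /\ fsupp f `<=` V /\ forall x, V x -> ent s j x = c.

Definition AK_form (k : nat) (f : E -> C) (s : seq (E -> C)) : Prop :=
  lipb f /\ size s = k /\ forall j, (j < k)%N -> lipf (ent s j).

Definition AK_multilinear (k : nat) (T : (E -> C) -> seq (E -> C) -> C) : Prop :=
  (forall (a : C) f g s, AK_form k f s -> AK_form k g s ->
     T (fun x => a * f x + g x) s = a * T f s + T g s) /\
  (forall (a : C) f s j p q, (j < k)%N ->
     AK_form k f (set_nth (fun _ => 0) s j p) ->
     AK_form k f (set_nth (fun _ => 0) s j q) ->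
     T f (set_nth (fun _ => 0) s j (fun x => a * p x + q x)) =
       a * T f (set_nth (fun _ => 0) s j p) + T f (set_nth (fun _ => 0) s j q)).

Definition AK_continuous (k : nat) (T : (E -> C) -> seq (E -> C) -> C) : Prop :=
  forall f s (ps : nat -> seq (E -> C)),
    AK_form k f s -> (forall n, AK_form k f (ps n)) ->
    (forall j x, (j < k)%N -> ent (ps n) j x @[n --> \oo] --> ent s j x) ->
    (exists L : C, forall n j, (j < k)%N -> L.-lipschitz (ent (ps n) j)) ->
    T f (ps n) @[n --> \oo] --> T f s.

Definition AK_local (k : nat) (T : (E -> C) -> seq (E -> C) -> C) : Prop :=
  forall f s, AK_form k f s -> some_const_near f s -> T f s = 0.

Definition AK_mass_bound (k : nat) (T : (E -> C) -> seq (E -> C) -> C)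
    (mu : {measure set Bor -> \bar R}) : Prop :=
  finite_radon mu /\
  forall f s, AK_form k f s ->
  forall L : nat -> C, (forall j, (j < k)%N -> (L j).-lipschitz (ent s j)) ->
    ((cabs (T f s))%:E <=
      (\prod_(j < k) cabs (L j))%:E * \int[mu]_(x in setT) (cabs (f x))%:E)%E.

Definition AK_current (k : nat) (T : (E -> C) -> seq (E -> C) -> C) : Prop :=
  [/\ AK_multilinear k T, AK_continuous k T, AK_local k T &
      exists mu, AK_mass_bound k T mu].

Definition bdry (T : (E -> C) -> seq (E -> C) -> C) :
    (E -> C) -> seq (E -> C) -> C :=
  fun f s => T (fun _ => 1) (f :: s).

Definition normal_current (k : nat) (T : (E -> C) -> seq (E -> C) -> C) : Prop :=
  AK_current k T /\ ((0 < k)%N -> exists mu, AK_mass_bound k.-1 (bdry T) mu).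

Definition AK_bidim (p q k : nat) (T : (E -> C) -> seq (E -> C) -> C) : Prop :=
  forall f s, AK_form k f s -> bidim_vanishing p q f s -> T f s = 0.

(** for T of bidimension (0,k), dbar T = dT; dbar T = 0 *)
Definition dbar_zero_0k (k : nat) (T : (E -> C) -> seq (E -> C) -> C) : Prop :=
  (0 < k)%N -> forall f s, AK_form k.-1 f s -> bdry T f s = 0.

Definition mass_measure (k : nat) (T : (E -> C) -> seq (E -> C) -> C)
    (mu : {measure set Bor -> \bar R}) : Prop :=
  AK_mass_bound k T mu /\
  forall nu, AK_mass_bound k T nu -> forall A : set Bor, measurable A -> (mu A <= nu A)%E.

Definition msupp (mu : {measure set Bor -> \bar R}) : set E :=
  [set x | forall r : R, 0 < r -> (0 < mu (ball x (rC r)))%E].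

Definition supp_bounded_away_from_0 (k : nat) (T : (E -> C) -> seq (E -> C) -> C) : Prop :=
  exists mu, mass_measure k T mu /\
    (exists r : R, msupp mu `<=` ball (0 : E) (rC r)) /\
    (exists d : R, 0 < d /\ forall x, msupp mu x -> rC d <= `|x|).

Definition qloc_fun (f : E -> C) : Prop :=
  lipf f /\ exists r : R, fsupp f `<=` ball (0 : E) (rC r).

Definition qloc_lip (g : E -> C) : Prop :=
  continuous g /\ forall r : R, exists L : C, L.-lipschitz_(ball (0 : E) (rC r)) g.

Definition qloc_form (k : nat) (f : E -> C) (s : seq (E -> C)) : Prop :=
  qloc_fun f /\ size s = k /\ forall j, (j < k)%N -> qloc_lip (ent s j).

Definition qloc_multilinear (k : nat) (T : (E -> C) -> seq (E -> C) -> C) : Prop :=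
  (forall (a : C) f g s, qloc_form k f s -> qloc_form k g s ->
     T (fun x => a * f x + g x) s = a * T f s + T g s) /\
  (forall (a : C) f s j p q, (j < k)%N ->
     qloc_form k f (set_nth (fun _ => 0) s j p) ->
     qloc_form k f (set_nth (fun _ => 0) s j q) ->
     T f (set_nth (fun _ => 0) s j (fun x => a * p x + q x)) =
       a * T f (set_nth (fun _ => 0) s j p) + T f (set_nth (fun _ => 0) s j q)).

Definition qloc_continuous (k : nat) (T : (E -> C) -> seq (E -> C) -> C) : Prop :=
  forall f s (fs : nat -> E -> C) (ps : nat -> seq (E -> C)),
    qloc_form k f s -> (forall n, qloc_form k (fs n) (ps n)) ->
    (forall x, fs n x @[n --> \oo] --> f x) ->
    (forall j x, (j < k)%N -> ent (ps n) j x @[n --> \oo] --> ent s j x) ->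
    (exists r : R, forall n, fsupp (fs n) `<=` ball (0 : E) (rC r)) ->
    (exists L : C, forall n, L.-lipschitz (fs n)) ->
    (forall r : R, exists L : C, forall n j, (j < k)%N ->
        L.-lipschitz_(ball (0 : E) (rC r)) (ent (ps n) j)) ->
    T (fs n) (ps n) @[n --> \oo] --> T f s.

Definition qloc_local (k : nat) (T : (E -> C) -> seq (E -> C) -> C) : Prop :=
  forall f s, qloc_form k f s -> some_const_near f s -> T f s = 0.

Definition qloc_mass (k : nat) (T : (E -> C) -> seq (E -> C) -> C) : Prop :=
  forall r : R, 0 < r -> exists mu : {measure set Bor -> \bar R},
    finite_radon mu /\
    forall f s, qloc_form k f s -> fsupp f `<=` ball (0 : E) (rC r) ->
    forall L : nat -> C,
      (forall j, (j < k)%N -> (L j).-lipschitz_(ball (0 : E) (rC r)) (ent s j)) ->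
      ((cabs (T f s))%:E <=
        (\prod_(j < k) cabs (L j))%:E *
          \int[mu]_(x in (ball (0%R : E) (rC r) : set Bor)) (cabs (f x))%:E)%E.

Definition qloc_current (k : nat) (T : (E -> C) -> seq (E -> C) -> C) : Prop :=
  [/\ qloc_multilinear k T, qloc_continuous k T, qloc_local k T & qloc_mass k T].

Definition qloc_bidim (p q k : nat) (T : (E -> C) -> seq (E -> C) -> C) : Prop :=
  forall f s, qloc_form k f s -> bidim_vanishing p q f s -> T f s = 0.

(** dbar U = T, for U quasi-local of bidimension (0,k+1) (so dbar U = dU)
    and T an AK k-current: dU(f,pi) = U(sigma, f, pi) = T(f,pi) for every
    quasi-local test form (f,pi) with pi globally Lipschitz (where T is
    defined), and every sigma in E_qloc equal to 1 near supp f. *)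
Definition dbar_qloc_eq (k : nat) (U T : (E -> C) -> seq (E -> C) -> C) : Prop :=
  forall f s, qloc_fun f -> AK_form k f s ->
  forall sigma, qloc_fun sigma ->
    (exists V : set E, open V /\ fsupp f `<=` V /\ forall x, V x -> sigma x = 1) ->
    U sigma (f :: s) = T f s.

End MetricCurrents.

(* Main.v *)
Require Import Defs.
From HB Require Import structures.
From mathcomp Require Import all_boot all_order all_algebra.
From mathcomp Require Import complex ring lra zify.
From mathcomp Require Import all_classical all_reals all_analysis measurable_realfun.
Set Implicit Arguments. Unset Strict Implicit. Unset Printing Implicit Defensive.
Import Order.TTheory GRing.Theory Num.Theory.
Import numFieldNormedType.Exports.
Local Open Scope classical_set_scope.
Local Open Scope ring_scope.

(** A closed current [T] of bidimension (0,k) is an alternating functional of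
    the k+1 functions of a test form: by the Leibniz rule and [dT = 0] any of
    them may be moved into the slot carrying the measure, so that mass bound
    and vanishing on holomorphic functions hold with respect to every slot.
    Then [U] is a Cauchy transform of the homotopy [l |-> (x |-> l x)] of [T]
    to infinity: for [l = 1 + r e^{2 pi i t}], formally
      U(f,pi) = - \int\int [K_r - K_t / (2 pi i r)] dr dt,
    where [K_r], [K_t] are the derivatives at [l' = l], in the directions [r]
    and [t], of
      K(l,l') = \sum_j T(.., pi_{j-1}(l' x), f(l x) (pi_j(l' x) - pi_j(l x)), pi_{j+1}(l x), ..).
    The combination of derivatives is d/d(conj l) up to a factor, hence kills
    holomorphic [pi_j]; since [supp T] is bounded away from [0], the curve
    [l x] leaves the support of [f] for large [l]; and for [f = 1] the sum over
    [j] telescopes to the derivative of [l |-> T(pi(l x))], whose Cauchy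
    transform is its value at [l = 1].
    As [T] is only defined on Lipschitz functions and need not be measurable in
    [l], derivatives and integral are replaced by difference quotients with
    step [1/n] and Riemann sums with mesh [1/(n m)], and the limit [m -> oo],
    [n -> oo] by an ultralimit; the integrals that do exist are those of the
    mass bound. The continuity of [U] follows from its own Leibniz rule. *)

(** * Real-valued norms and Lipschitz functions *)

Lemma eq_imp_le (disp : Order.disp_t) (T : porderType disp) (x y : T) : x = y -> (x <= y)%O.
Proof. by move=> ->. Qed.

Section Norms.
Variables (R : realType).
Local Notation C := (Cplx R).

Lemma rC_le (a b : R) : (rC a <= rC b) = (a <= b).
Proof. exact: lecR. Qed.

Lemma rC_lt (a b : R) : (rC a < rC b) = (a < b).
Proof. exact: ltcR. Qed.

Lemma rCD (a b : R) : rC (a + b) = rC a + rC b.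
Proof. exact: (rmorphD (@real_complex R)). Qed.

Lemma rCN (a : R) : rC (- a) = - rC a.
Proof. exact: (rmorphN (@real_complex R)). Qed.

Lemma rCM (a b : R) : rC (a * b) = rC a * rC b.
Proof. exact: (rmorphM (@real_complex R)). Qed.

Lemma rCV (a : R) : rC a^-1 = (rC a)^-1.
Proof. exact: (fmorphV (@real_complex R)). Qed.

Lemma rC0 : rC 0 = 0 :> C. Proof. by []. Qed.
Lemma rC1 : rC 1 = 1 :> C. Proof. by []. Qed.

Lemma rC_Re (z : C) : 0 <= z -> z = rC (complex.Re z).
Proof. by case: z => a b; rewrite lecE /= => /andP[/eqP -> _]. Qed.

Lemma rC_inj : injective (@rC R).
Proof. by move=> a b []. Qed.

Definition nrm (V : normedModType C) (x : V) : R := complex.Re `|x|.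

Lemma nrmE (V : normedModType C) (x : V) : `|x| = rC (nrm x).
Proof. by apply: rC_Re; exact: normr_ge0. Qed.

Lemma cabsE (z : C) : `|z| = rC (cabs z).
Proof. by apply: rC_Re; exact: normr_ge0. Qed.

Section nrm.
Variable V : normedModType C.
Implicit Types x y : V.

Lemma nrm_ge0 x : 0 <= nrm x.
Proof. by rewrite -rC_le -nrmE rC0 normr_ge0. Qed.

Lemma nrmD x y : nrm (x + y) <= nrm x + nrm y.
Proof. by rewrite -rC_le rCD -!nrmE ler_normD. Qed.

Lemma nrmN x : nrm (- x) = nrm x.
Proof. by rewrite /nrm normrN. Qed.

Lemma nrm0 : nrm (0 : V) = 0.
Proof. by rewrite /nrm normr0. Qed.

Lemma nrm_distC x y : nrm (x - y) = nrm (y - x).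
Proof. by rewrite /nrm distrC. Qed.

Lemma nrmZ (a : C) x : nrm (a *: x) = cabs a * nrm x.
Proof. by apply: rC_inj; rewrite rCM -!nrmE -cabsE normrZ. Qed.

Lemma nrm_eq0 x : (nrm x == 0) = (x == 0).
Proof. by rewrite -[RHS]normr_eq0 [in RHS]nrmE -(inj_eq (@rC_inj)). Qed.

Lemma ball_nrm x (r : R) y : ball x (rC r) y <-> nrm (x - y) < r.
Proof. by rewrite -ball_normE /ball_ /= nrmE rC_lt. Qed.

Lemma ball0_nrm (r : R) y : ball (0 : V) (rC r) y <-> nrm y < r.
Proof. by rewrite ball_nrm sub0r nrmN. Qed.

Lemma nrm_dist x y : `|nrm x - nrm y| <= nrm (x - y).
Proof.
rewrite ler_norml; apply/andP; split.
  by have := nrmD (y - x) x; rewrite subrK nrm_distC; lra.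
by have := nrmD (x - y) y; rewrite subrK; lra.
Qed.

End nrm.

Lemma cabs_ge0 (z : C) : 0 <= cabs z. Proof. exact: (@nrm_ge0 C z). Qed.
Lemma cabsD (z w : C) : cabs (z + w) <= cabs z + cabs w.
Proof. exact: (@nrmD C). Qed.
Lemma cabsN (z : C) : cabs (- z) = cabs z. Proof. exact: (@nrmN C). Qed.
Lemma cabs_distC (z w : C) : cabs (z - w) = cabs (w - z). Proof. exact: (@nrm_distC C). Qed.
Lemma cabs0 : cabs (0 : C) = 0. Proof. exact: (@nrm0 C). Qed.
Lemma cabsM (z w : C) : cabs (z * w) = cabs z * cabs w.
Proof. exact: (@nrmZ C). Qed.
Lemma cabs_eq0 (z : C) : (cabs z == 0) = (z == 0).
Proof. exact: (@nrm_eq0 C). Qed.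
Lemma cabs1 : cabs (1 : C) = 1.
Proof. by apply: rC_inj; rewrite -cabsE normr1. Qed.
Lemma cabs_rC (r : R) : cabs (rC r) = `|r|.
Proof. by apply: rC_inj; rewrite -cabsE normc_def /= expr0n /= addr0 sqrtr_sqr. Qed.
Lemma cabsV (z : C) : cabs z^-1 = (cabs z)^-1.
Proof. by apply: rC_inj; rewrite rCV -!cabsE normfV. Qed.
Lemma cabs_nat (n : nat) : cabs (n%:R : C) = n%:R.
Proof. by apply: rC_inj; rewrite -cabsE normr_nat; exact/esym/(rmorph_nat (@real_complex R)). Qed.
Lemma cabs_Re (z : C) : `|complex.Re z| <= cabs z.
Proof. by rewrite -rC_le -cabsE; exact: normc_ge_Re. Qed.
Lemma cabs_Im (z : C) : `|complex.Im z| <= cabs z.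
Proof.
rewrite -rC_le -cabsE normc_def lecR -sqrtr_sqr ler_wsqrtr// lerDr.
exact: sqr_ge0.
Qed.
Lemma cabs_ReIm (z : C) : cabs z <= `|complex.Re z| + `|complex.Im z|.
Proof.
have -> : z = rC (complex.Re z) + Complex 0 1 * rC (complex.Im z).
  by case: z => a b; rewrite /rC; simpc.
rewrite (le_trans (cabsD _ _))// cabsM !cabs_rC.
have -> : cabs (Complex 0 1 : C) = 1.
  by apply: rC_inj; rewrite -cabsE normc_def /= expr0n expr1n add0r sqrtr1.
by case: z => a b; rewrite /rC; simpc.
Qed.
Lemma cabs_sum (I : Type) (s : seq I) (P : pred I) (F : I -> C) :
  cabs (\sum_(i <- s | P i) F i) <= \sum_(i <- s | P i) cabs (F i).
Proof.
elim/big_rec2: _ => [|i y1 y2 _ h]; first by rewrite cabs0.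
by rewrite (le_trans (cabsD _ _))// lerD2l.
Qed.

End Norms.

Section Lipschitz.
Variables (R : realType) (E : normedModType (Cplx R)).
Local Notation C := (Cplx R).
Implicit Types (f g : E -> C) (L M : R) (a : C).

Definition Lip L f := forall x y, cabs (f x - f y) <= L * nrm (x - y).
Definition bnd M f := forall x, cabs (f x) <= M.

Lemma lipschitz_on_nrm (A : set E) (L : C) f :
  L.-lipschitz_A f ->
  forall x y, A x -> A y -> cabs (f x - f y) <= cabs L * nrm (x - y).
Proof.
move=> h x y Ax Ay.
have /= := h (x, y) (conj Ax Ay).
rewrite -rC_le rCM -!cabsE -nrmE => hL.
by have := le_trans hL (real_ler_norm (ger0_real (le_trans (normr_ge0 _) hL)));
  rewrite normrM normr_id.
Qed.

Lemma nrm_lipschitz_on (A : set E) L f :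
  (forall x y, A x -> A y -> cabs (f x - f y) <= L * nrm (x - y)) ->
  (rC L).-lipschitz_A f.
Proof.
move=> h [x y] [Ax Ay] /=.
by rewrite cabsE nrmE -rCM rC_le; exact: h.
Qed.

Lemma lipschitz_Lip (L : C) f : L.-lipschitz f -> Lip (cabs L) f.
Proof. by move=> h x y; apply: (lipschitz_on_nrm h). Qed.

Lemma Lip_lipschitz L f : Lip L f -> (rC L).-lipschitz f.
Proof. by move=> h; apply: nrm_lipschitz_on => x y _ _; exact: h. Qed.

Lemma lipfP f : lipf f <-> exists2 L, 0 <= L & Lip L f.
Proof.
split=> [[L /lipschitz_Lip h]|[L _ /Lip_lipschitz h]]; last by exists (rC L).
by exists (cabs L) => //; exact: cabs_ge0.
Qed.

Lemma lipbP f : lipb f <-> exists L M, [/\ 0 <= L, 0 <= M, Lip L f & bnd M f].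
Proof.
split=> [[/lipfP[L L0 h] [M hM]]|[L [M [L0 M0 h hM]]]].
  exists L, M; split => //; exact: le_trans (cabs_ge0 _) (hM 0).
by split; [apply/lipfP; exists L|exists M].
Qed.

Lemma Lip_cst a : Lip 0 (fun=> a).
Proof. by move=> x y; rewrite subrr cabs0 mul0r. Qed.

Lemma Lip_le L L' f : L <= L' -> Lip L f -> Lip L' f.
Proof. by move=> LL h x y; rewrite (le_trans (h x y))// ler_wpM2r// nrm_ge0. Qed.

Lemma LipD L L' f g : Lip L f -> Lip L' g -> Lip (L + L') (fun x => f x + g x).
Proof.
move=> hf hg x y; rewrite mulrDl opprD addrACA.
by rewrite (le_trans (cabsD _ _))// lerD.
Qed.

Lemma LipZ L a f : Lip L f -> Lip (cabs a * L) (fun x => a * f x).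
Proof.
move=> hf x y; rewrite -mulrBr cabsM -mulrA ler_wpM2l//; exact: cabs_ge0.
Qed.

Lemma LipM L M L' M' f g : Lip L f -> bnd M f -> Lip L' g -> bnd M' g ->
  Lip (M * L' + M' * L) (fun x => f x * g x).
Proof.
move=> hf bf hg bg x y.
rewrite (_ : _ - _ = f x * (g x - g y) + g y * (f x - f y)); last by ring.
rewrite (le_trans (cabsD _ _))// !cabsM mulrDl -!mulrA.
by apply: lerD; apply: ler_pM; rewrite ?cabs_ge0.
Qed.

Lemma bndM M M' f g : bnd M f -> bnd M' g -> bnd (M * M') (fun x => f x * g x).
Proof. by move=> hf hg x; rewrite cabsM ler_pM ?cabs_ge0. Qed.

Lemma bndD M M' f g : bnd M f -> bnd M' g -> bnd (M + M') (fun x => f x + g x).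
Proof. by move=> hf hg x; rewrite (le_trans (cabsD _ _))// lerD. Qed.

Definition pull a f : E -> C := fun x => f (a *: x).

Lemma Lip_pull L a f : Lip L f -> Lip (cabs a * L) (pull a f).
Proof.
by move=> hf x y; rewrite (le_trans (hf _ _))// -scalerBr nrmZ mulrCA mulrA.
Qed.

Lemma lipb_cst a : lipb (fun _ : E => a).
Proof.
apply/lipbP; exists 0, (cabs a); split => //; [exact: cabs_ge0|exact: Lip_cst].
Qed.

Lemma lipbD f g : lipb f -> lipb g -> lipb (fun x => f x + g x).
Proof.
move=> /lipbP[L [M [L0 M0 hf bf]]] /lipbP[L' [M' [L0' M0' hg bg]]].
apply/lipbP; exists (L + L'), (M + M'); split; rewrite ?addr_ge0//.
  exact: LipD.
exact: bndD.
Qed.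

Lemma lipbM f g : lipb f -> lipb g -> lipb (fun x => f x * g x).
Proof.
move=> /lipbP[L [M [L0 M0 hf bf]]] /lipbP[L' [M' [L0' M0' hg bg]]].
apply/lipbP; exists (M * L' + M' * L), (M * M').
split; rewrite ?addr_ge0 ?mulr_ge0//; first exact: LipM.
exact: bndM.
Qed.

Lemma lipbZ a f : lipb f -> lipb (fun x => a * f x).
Proof. by move=> hf; apply: lipbM => //; exact: lipb_cst. Qed.

Lemma lipbN f : lipb f -> lipb (fun x => - f x).
Proof.
move=> hf; rewrite (_ : (fun _ => _) = fun x => (-1) * f x); first exact: lipbZ.
by apply/funext => x; rewrite mulN1r.
Qed.

Lemma lipbB f g : lipb f -> lipb g -> lipb (fun x => f x - g x).
Proof. by move=> hf hg; apply: lipbD => //; exact: lipbN. Qed.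

Lemma lipb_pull a f : lipb f -> lipb (pull a f).
Proof.
move=> /lipbP[L [M [L0 M0 hf bf]]].
apply/lipbP; exists (cabs a * L), M; split => //; last by move=> x; exact: bf.
  by rewrite mulr_ge0// cabs_ge0.
exact: Lip_pull.
Qed.

Lemma lipb_lipf f : lipb f -> lipf f. Proof. by case. Qed.

Lemma Lip_rC (v : E -> R) L : (forall x y, `|v x - v y| <= L * nrm (x - y)) ->
  Lip L (fun x => rC (v x)).
Proof. by move=> h x y; rewrite -rCN -rCD cabs_rC. Qed.

Lemma open_nrm (V : set E) x : open V -> V x ->
  exists2 r : R, 0 < r & forall y, nrm (x - y) < r -> V y.
Proof.
rewrite openE => oV /oV /nbhs_ballP[e /= e0 he].
have ee : e = rC (complex.Re e) by apply: rC_Re; exact: ltW.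
exists (complex.Re e); first by rewrite -rC_lt -ee.
by move=> y xy; apply: he; rewrite ee; apply/ball_nrm.
Qed.

Lemma nbhs_nrm (V : set E) x (r : R) : 0 < r ->
  (forall y, nrm (x - y) < r -> V y) -> nbhs x V.
Proof.
move=> r0 h; apply/nbhs_ballP; exists (rC r) => /=.
  by rewrite -[0]/(rC 0) rC_lt.
by move=> y /ball_nrm; exact: h.
Qed.

Lemma nrm_open (V : set E) :
  (forall x, V x -> exists2 r : R, 0 < r & forall y, nrm (x - y) < r -> V y) ->
  open V.
Proof.
by move=> h; rewrite openE => x /h[r r0 hr]; exact: (nbhs_nrm r0).
Qed.

Lemma real_lip_continuous (v : E -> R) L :
  (forall x y, `|v x - v y| <= L * nrm (x - y)) -> continuous v.
Proof.
move=> h x; apply/cvgrPdist_lt => e e0.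
have L1 : 0 < `|L| + 1 by rewrite ltr_wpDl.
apply: (@nbhs_nrm _ _ (e / (`|L| + 1))); first by rewrite divr_gt0.
move=> y; rewrite ltr_pdivlMr// => hy.
apply: le_lt_trans (h x y) _; apply: le_lt_trans hy.
rewrite mulrC ler_wpM2l ?nrm_ge0// (le_trans (ler_norm _))// lerDl//.
Qed.

Lemma Lip_continuous L f : Lip L f -> continuous f.
Proof.
move=> h x; apply/cvgrPdist_lt => e e0.
have ee : e = rC (complex.Re e) by apply: rC_Re; exact: ltW.
have e0' : 0 < complex.Re e by rewrite -rC_lt -ee.
have L1 : 0 < `|L| + 1 by rewrite ltr_wpDl.
apply: (@nbhs_nrm _ _ (complex.Re e / (`|L| + 1))); first by rewrite divr_gt0.
move=> y; rewrite ltr_pdivlMr// => hy.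
rewrite ee cabsE rC_lt.
apply: le_lt_trans (h x y) _; apply: le_lt_trans hy.
rewrite mulrC ler_wpM2l ?nrm_ge0// (le_trans (ler_norm _))// lerDl//.
Qed.

Lemma cabs_continuous f : lipf f -> continuous (fun x => cabs (f x)).
Proof.
move=> /lipfP[L L0 h]; apply: (@real_lip_continuous _ L) => x y.
exact: le_trans (@nrm_dist _ C (f x) (f y)) (h x y).
Qed.

Lemma fsupp_closed f : closed (fsupp f). Proof. exact: closed_closure. Qed.

Lemma fsuppP f x : ~ fsupp f x -> f x = 0.
Proof.
move=> h; apply/eqP; apply/negP => /negP fx; apply: h.
exact: subset_closure.
Qed.

Lemma fsupp_sub f (F : set E) : closed F -> (forall x, f x != 0 -> F x) ->
  fsupp f `<=` F.
Proof. by move=> cF h; rewrite /fsupp closureE => x; apply; split. Qed.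

Lemma fsupp_mulr f g : fsupp (fun x => f x * g x) `<=` fsupp f.
Proof.
apply: fsupp_sub; first exact: fsupp_closed.
move=> x fg; apply: subset_closure => /=; apply: contraNneq fg => ->.
by rewrite mul0r.
Qed.

Lemma fsupp_mull f g : fsupp (fun x => f x * g x) `<=` fsupp g.
Proof.
by rewrite (_ : (fun x => _) = fun x => g x * f x);
  [exact: fsupp_mulr|apply/funext => x; rewrite mulrC].
Qed.

Lemma scale_continuous a : continuous (fun x : E => a *: x).
Proof. exact: scaler_continuous. Qed.

Lemma fsupp_pull a f : fsupp (pull a f) `<=` (fun x => a *: x) @^-1` fsupp f.
Proof.
apply: fsupp_sub.
  apply: (closed_comp _ (@fsupp_closed f)) => x _; exact: scale_continuous.
by move=> x fx; apply: subset_closure.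
Qed.

Lemma open_nrm_lt (r : R) : open [set x : E | nrm x < r].
Proof.
apply: nrm_open => x /= xr; exists (r - nrm x); first by rewrite subr_gt0.
by move=> y h; have := nrm_dist x y; rewrite ler_norml => /andP[]; lra.
Qed.

Lemma open_nrm_gt (r : R) : open [set x : E | r < nrm x].
Proof.
apply: nrm_open => x /= xr; exists (nrm x - r); first by rewrite subr_gt0.
by move=> y h; have := nrm_dist x y; rewrite ler_norml => /andP[]; lra.
Qed.

Lemma closed_nrm_le (r : R) : closed [set x : E | nrm x <= r].
Proof.
rewrite (_ : [set x | _] = ~` [set x | r < nrm x]).
  exact/open_closedC/open_nrm_gt.
by apply/seteqP; split => x /=; rewrite leNgt => /negP.
Qed.

Lemma closed_nrm_ge (r : R) : closed [set x : E | r <= nrm x].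
Proof.
rewrite (_ : [set x | _] = ~` [set x | nrm x < r]).
  exact/open_closedC/open_nrm_lt.
by apply/seteqP; split => x /=; rewrite leNgt => /negP.
Qed.

End Lipschitz.

(** * Integration and Radon measures *)

Section Bor.
Variables (R : realType) (E : normedModType (Cplx R)).
Local Notation C := (Cplx R).

Lemma open_Bor (U : set E) : open U -> measurable (U : set (Bor E)).
Proof. by move=> oU; exact: sub_sigma_algebra. Qed.

Lemma closed_Bor (U : set E) : closed U -> measurable (U : set (Bor E)).
Proof.
by move=> cU; rewrite -[U]setCK; apply: measurableC; apply: open_Bor; exact: closed_openC.
Qed.

Lemma continuous_Bor (v : E -> R) : continuous v ->
  measurable_fun [set: Bor E] (v : Bor E -> R).
Proof.
move=> cv; apply: (measurability _ (RGenOpens.measurableE R)).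
move=> _ [_ [a [b ->]] <-]; rewrite setTI; apply: open_Bor.
by apply: (open_comp _ (interval_open _ _)) => // x _; exact: cv.
Qed.

Definition cbnd (v : E -> R) := continuous v /\ exists M, forall x, `|v x| <= M.

Lemma cbnd_cst (r : R) : cbnd (fun=> r).
Proof. by split; [move=> x; exact: cvg_cst|exists `|r|]. Qed.

Lemma cbndD v w : cbnd v -> cbnd w -> cbnd (fun x => v x + w x).
Proof.
move=> [cv [M hM]] [cw [N hN]]; split; first by move=> x; apply: cvgD; [exact: cv|exact: cw].
by exists (M + N) => x; rewrite (le_trans (ler_normD _ _))// lerD.
Qed.

Lemma cbndM v w : cbnd v -> cbnd w -> cbnd (fun x => v x * w x).
Proof.
move=> [cv [M hM]] [cw [N hN]]; split; first by move=> x; apply: cvgM; [exact: cv|exact: cw].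
by exists (M * N) => x; rewrite normrM ler_pM.
Qed.

Lemma cbndZ r v : cbnd v -> cbnd (fun x => r * v x).
Proof. by move=> h; apply: cbndM => //; exact: cbnd_cst. Qed.

Lemma cbnd_cabs (f : E -> C) : lipb f -> cbnd (fun x => cabs (f x)).
Proof.
move=> [lf [M bM]]; split; first exact: cabs_continuous.
by exists M => x; rewrite ger0_norm ?cabs_ge0.
Qed.

Lemma cbnd_sum (n : nat) (v : 'I_n -> E -> R) : (forall i, cbnd (v i)) ->
  cbnd (fun x => \sum_(i < n) v i x).
Proof.
elim: n v => [|n ih] v h.
  rewrite (_ : (fun _ => _) = fun=> 0); first exact: cbnd_cst.
  by apply/funext => x; rewrite big_ord0.
rewrite (_ : (fun _ => _) = fun x => \sum_(i < n) v (widen_ord (leqnSn n) i) x + v ord_max x).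
  by apply: cbndD => //; apply: ih.
by apply/funext => x; rewrite big_ord_recr.
Qed.

Section mint.
Variables (mu : {measure set (Bor E) -> \bar R}) (muT : (mu setT < +oo)%E).

Definition mint (v : E -> R) : R := \int[mu]_(x in [set: Bor E]) (v : Bor E -> R) x.

Lemma cst_integrable (M : R) : mu.-integrable [set: Bor E] (EFin \o cst M).
Proof.
apply/integrableP; split; first exact/measurable_EFinP/measurable_cst.
by rewrite /= integral_cst// lte_mul_pinfty.
Qed.

Lemma cbnd_integrable v : cbnd v -> mu.-integrable [set: Bor E] (EFin \o (v : Bor E -> R)).
Proof.
move=> [cv [M hM]].
apply: (@le_integrable _ _ _ mu _ _ _ (EFin \o cst M)) => //.
- by apply/measurable_EFinP; exact: continuous_Bor.
- move=> x _ /=; rewrite lee_fin (le_trans (hM x))//; exact: ler_norm.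
- exact: cst_integrable.
Qed.

Lemma mint_le v w : cbnd v -> cbnd w -> (forall x, v x <= w x) -> mint v <= mint w.
Proof. by move=> cv cw h; apply: le_Rintegral => //; exact: cbnd_integrable. Qed.

Lemma mint_ge0 v : (forall x, 0 <= v x) -> 0 <= mint v.
Proof. by move=> h; apply: Rintegral_ge0. Qed.

Lemma mint_cabs_ge0 (f : E -> C) : 0 <= mint (fun x => cabs (f x)).
Proof. by apply: mint_ge0 => x; exact: cabs_ge0. Qed.

Lemma mintD v w : cbnd v -> cbnd w -> mint (fun x => v x + w x) = mint v + mint w.
Proof. by move=> cv cw; apply: RintegralD => //; exact: cbnd_integrable. Qed.

Lemma mintZ r v : cbnd v -> mint (fun x => r * v x) = r * mint v.
Proof. by move=> cv; apply: RintegralZl => //; exact: cbnd_integrable. Qed.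

Lemma mint0 : mint (fun=> 0) = 0.
Proof. by rewrite /mint Rintegral_cst// mul0r. Qed.

Lemma mint_sum (n : nat) (v : 'I_n -> E -> R) : (forall i, cbnd (v i)) ->
  mint (fun x => \sum_(i < n) v i x) = \sum_(i < n) mint (v i).
Proof.
elim: n v => [|n ih] v h.
  rewrite big_ord0 -[RHS]mint0; congr mint.
  by apply/funext => x; rewrite big_ord0.
rewrite big_ord_recr/= -ih// -mintD//; last exact: cbnd_sum.
by congr mint; apply/funext => x; rewrite big_ord_recr.
Qed.

Lemma mintE v : cbnd v ->
  (\int[mu]_(x in [set: Bor E]) ((v : Bor E -> R) x)%:E)%E = (mint v)%:E.
Proof.
move=> cv; rewrite /mint /Rintegral fineK//.
exact: (integrable_fin_num _ (cbnd_integrable cv)).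
Qed.

Lemma mint_ae0 v (X : set (Bor E)) : cbnd v -> measurable X -> mu (~` X) = 0%E ->
  (forall x, X x -> v x = 0) -> mint v = 0.
Proof.
move=> cv mX mu0 h; rewrite /mint /Rintegral.
rewrite (negligible_integral (measurableC mX))//; last exact: cbnd_integrable.
rewrite setTD setCK integral0_eq// => x /h /= ->; by [].
Qed.

Lemma mint_cvg (v_ : nat -> E -> R) v (M : R) : (forall n, cbnd (v_ n)) -> cbnd v ->
  (forall n x, `|v_ n x| <= M) -> (forall x, v_ n x @[n --> \oo] --> v x) ->
  mint (v_ n) @[n --> \oo] --> mint v.
Proof.
move=> cv_ cv hM hv.
have : (\int[mu]_(x in [set: Bor E]) ((v_ n : Bor E -> R) x)%:E)%E @[n --> \oo]
    --> (mint v)%:E.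
  rewrite -mintE//.
  apply: (@dominated_cvg _ _ _ mu _ measurableT _ _ (EFin \o cst M)) => //.
  - by move=> n; apply/measurable_EFinP; apply: continuous_Bor; case: (cv_ n).
  - by move=> x _; apply: cvg_EFin; [exact: nearW|exact: hv].
  - exact: cst_integrable.
  - by move=> n x _; rewrite /= lee_fin.
by move=> /fine_cvgP[].
Qed.
End mint.
End Bor.

Section Radon.
Variables (R : realType) (E : normedModType (Cplx R)).
Local Notation C := (Cplx R).
Implicit Types mu nu : {measure set (Bor E) -> \bar R}.

Lemma compact_Bor (K : set E) : compact K -> measurable (K : set (Bor E)).
Proof.
by move=> cK; apply: closed_Bor; apply: (@compact_closed E).
Qed.

Lemma radon_null_open mu (O : set E) : finite_radon mu -> open O ->
  (forall x, O x -> exists2 r : R, 0 < r & mu (ball x (rC r)) = 0%E) ->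
  mu (O : set (Bor E)) = 0%E.
Proof.
move=> [_ rad] oO h.
apply/eqP; rewrite eq_le measure_ge0 andbT.
rewrite rad; last exact: open_Bor.
apply: ge_ereal_sup => _ [K [cK KO] <-].
have /choice[r hr] : forall x, exists r : R, O x -> 0 < r /\ mu (ball x (rC r)) = 0%E.
  move=> x; have [Ox|nOx] := pselect (O x); last by exists 0 => /nOx.
  by have [r r0 rx] := h _ Ox; exists r.
pose f x : set E := ball x (rC (r x)).
have of_ x : O x -> open (f x).
  by move=> /hr[r0 _]; apply: ball_open; rewrite -[0]/(rC 0) rC_lt.
move: (cK); rewrite compact_cover => /(_ E O f of_).
case.
  move=> x Kx; exists x; first exact: KO.
  have [r0 _] := hr _ (KO _ Kx).
  by apply: ballxx; rewrite -[0]/(rC 0) rC_lt.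
move=> D DO; rewrite /cover bigcup_fset => KD.
have [mU U0] : measurable (\big[setU/set0]_(i <- finmap.enum_fset D) f i : set (Bor E)) /\
    mu (\big[setU/set0]_(i <- finmap.enum_fset D) f i : set (Bor E)) = 0%E.
  have : forall i, i \in finmap.enum_fset D -> O i by move=> i /DO; rewrite inE.
  elim: (finmap.enum_fset D) => [_|a s ih hs].
    by rewrite big_nil; split; [exact: measurable0|rewrite measure0].
  have [|m1 m2] := ih; first by move=> i si; apply: hs; rewrite inE si orbT.
  have Oa : O a by apply: hs; rewrite inE eqxx.
  rewrite big_cons; split.
    by apply: measurableU => //; apply: open_Bor; exact: of_.
  apply/eqP; rewrite eq_le measure_ge0 andbT.
  apply: le_trans (measureU2 mu _ m1) _; first by apply: open_Bor; exact: of_.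
  apply: (@le_trans _ _ (0 + 0)%E); last by rewrite adde0.
  by apply: leeD; apply: eq_imp_le;
    [exact: (proj2 (hr _ Oa))|exact: m2].
rewrite -U0; apply: le_measure; rewrite ?inE//; exact: compact_Bor.
Qed.

Definition approximable nu (A : set (Bor E)) := measurable A /\
  forall e : R, 0 < e -> exists F G : set E, [/\ closed F, open G, F `<=` A, A `<=` G
    & (nu ((G `\` F) : set (Bor E)) < e%:E)%E].

Lemma open_exhaustion nu (G : set E) (F : nat -> set E) (e : \bar R) :
  (nu setT < +oo)%E -> open G -> (forall n, closed (F n)) ->
  (nu ((G `\` \bigcup_n F n) : set (Bor E)) < e)%E ->
  exists N, (nu ((G `\` \big[setU/set0]_(i < N) F i) : set (Bor E)) < e)%E.
Proof.
move=> fin oG cF lte.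
pose H N : set (Bor E) := G `\` \big[setU/set0]_(i < N) F i.
have mH N : measurable (H N).
  apply: measurableD; first exact: open_Bor.
  by apply: closed_Bor; apply: closed_bigsetU => i _; exact: cF.
have HE : \bigcap_N H N = (G `\` \bigcup_n F n).
  apply/seteqP; split => x.
    move=> h; split; first by case: (h 0%N I).
    move=> [n _ Fx]; have [_] := h n.+1 I; apply.
    by rewrite big_ord_recr/=; right.
  move=> [Gx nF] N _; split => //.
  by move=> hx; apply: nF; exact: bigsetU_bigcup hx.
have : (nu \o H) n @[n --> \oo] --> nu (\bigcap_N H N).
  apply: nonincreasing_cvg_mu => //.
  - apply: le_lt_trans fin; apply: le_measure; rewrite ?inE//.
  - exact: bigcapT_measurable.
  - move=> n m nm; apply/subsetPset => x [Gx h]; split => // hx; apply: h.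
    move: hx; rewrite -!bigcup_mkord => -[i /= ni Fi]; exists i => //=.
    exact: leq_trans ni nm.
rewrite HE => /(_ [set x | (x < e)%E]) /=.
case; first by apply: open_nbhs_nbhs; split => //; exact: open_ereal_lt_ereal.
by move=> N _ /(_ N (leqnn _)) /= hN; exists N.
Qed.

Lemma open_approximable nu (O : set E) : (nu setT < +oo)%E -> open O ->
  approximable nu O.
Proof.
move=> fin oO; split; first exact: open_Bor.
move=> e e0.
pose F (j : nat) : set E := [set y | forall x, nrm (y - x) < j.+1%:R^-1 -> O x].
have cF j : closed (F j).
  rewrite -[F j]setCK; apply: open_closedC; apply: nrm_open => y /=.
  move=> /existsNP[x /not_implyP[yx nO]].
  exists (j.+1%:R^-1 - nrm (y - x)); first by rewrite subr_gt0.
  move=> z yz Fz; apply: nO; apply: Fz.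
  have := nrmD (z - y) (y - x); rewrite addrA subrK (nrm_distC z y).
  by move=> hh; move: yz; rewrite ltrBrDr; exact: le_lt_trans hh.
have FO : O `\` \bigcup_n F n = set0.
  apply/seteqP; split => // y [Oy]; apply.
  have [r r0 hr] := open_nrm oO Oy.
  have [n hn] : exists n : nat, n.+1%:R^-1 < r.
    exists (Num.truncn r^-1).
    by rewrite invf_plt ?posrE// truncnS_gt.
  by exists n => // x yx; apply: hr; exact: lt_trans hn.
have [|N hN] := @open_exhaustion nu O F e%:E fin oO cF.
  by rewrite FO measure0 lte_fin.
exists (\big[setU/set0]_(i < N) F i), O; split => //.
  by apply: closed_bigsetU => i _; exact: cF.
move=> y hy; have [j _ Fy] := bigsetU_bigcup hy; apply: Fy; rewrite subrr nrm0 invr_gt0 ltr0n//.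
Qed.

Lemma approximableC nu A : approximable nu A -> approximable nu (~` A).
Proof.
move=> [mA h]; split; first exact: measurableC.
move=> e /h[F [G [cF oG FA AG lte]]]; exists (~` G), (~` F); split.
- exact: open_closedC.
- exact: closed_openC.
- exact: subsetC.
- exact: subsetC.
- by rewrite setDE setCK setIC -setDE.
Qed.

Lemma approximable_bigcup nu (A : nat -> set (Bor E)) : (nu setT < +oo)%E ->
  (forall n, approximable nu (A n)) -> approximable nu (\bigcup_n A n).
Proof.
move=> fin h; split; first by apply: bigcupT_measurable => n; case: (h n).
move=> e e0.
have /choice[FG hFG] : forall n, exists FG : set E * set E,
    [/\ closed FG.1, open FG.2, FG.1 `<=` A n, A n `<=` FG.2
    & (nu ((FG.2 `\` FG.1) : set (Bor E)) < (e / 2 / (2 ^ n.+1)%:R)%:E)%E].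
  move=> n; have [_ /(_ (e / 2 / (2 ^ n.+1)%:R))[]] := h n.
    by rewrite !divr_gt0// ltr0n expn_gt0.
  by move=> F [G FG]; exists (F, G).
pose F n := (FG n).1; pose G n := (FG n).2.
have oG : open (\bigcup_n G n) by apply: bigcup_open => n _; case: (hFG n).
have cF n : closed (F n) by case: (hFG n).
have mGF n : measurable ((G n `\` F n) : set (Bor E)).
  by apply: measurableD; [apply: open_Bor; case: (hFG n)|exact: closed_Bor].
have [|N hN] := @open_exhaustion nu (\bigcup_n G n) F e%:E fin oG cF.
  apply: (@le_lt_trans _ _ (e / 2)%:E); last by rewrite lte_fin; lra.
  apply: le_trans (measure_sigma_subadditive nu mGF _ _) _.
  - apply: measurableD; first exact: open_Bor.
    by apply: bigcupT_measurable => n; exact: closed_Bor.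
  - move=> x [[n _ Gx] nF]; exists n => //; split => // Fx; apply: nF; by exists n.
  - apply: (@le_trans _ _ (\sum_(0 <= i <oo) ((e / 2 / (2 ^ i.+1)%:R)%:E))%E).
      by apply: lee_nneseries => i _ //; apply/ltW; case: (hFG i).
    have /= := @epsilon_trick R (fun=> 0%E) (e / 2) xpredT (fun=> lexx _).
    rewrite [X in (_ <= X + _)%E]eseries0// add0e => h'; apply: le_trans (h' _); last by rewrite divr_ge0// ltW.
    by apply: lee_nneseries => i _; rewrite ?add0e// lee_fin !divr_ge0// ltW.
exists (\big[setU/set0]_(i < N) F i), (\bigcup_n G n); split => //.
- by apply: closed_bigsetU => i _; exact: cF.
- move=> y hy; have [j _ Fy] := bigsetU_bigcup hy; exists j => //; case: (hFG j) => _ _ h1 _ _; exact: h1.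
- by move=> y [j _ Ay]; exists j => //; case: (hFG j) => _ _ _ h1 _; exact: h1.
Qed.

Lemma measurable_approximable nu A : (nu setT < +oo)%E -> measurable A ->
  approximable nu A.
Proof.
move=> fin; apply: smallest_sub; last first.
  by move=> O oO; exact: open_approximable.
split.
- by apply: open_approximable => //; exact: open0.
- by move=> B; rewrite setTD; exact: approximableC.
- by move=> B hB; exact: approximable_bigcup.
Qed.

Lemma tight_finite_radon nu : (nu setT < +oo)%E ->
  (forall e : R, 0 < e -> exists2 K : set E, compact K
     & (nu ((~` K) : set (Bor E)) <= e%:E)%E) ->
  finite_radon nu.
Proof.
move=> fin tight; split => // A mA.
apply/eqP; rewrite eq_le; apply/andP; split; last first.
  apply: ge_ereal_sup => _ [K [cK KA] <-].
  by apply: le_measure; rewrite ?inE//; exact: compact_Bor.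
apply/lee_addgt0Pr => e e0.
have e20 : 0 < e / 2 by rewrite divr_gt0.
have [_ /(_ _ e20)[F [G [cF oG FA AG GF]]]] := measurable_approximable fin mA.
have [K cK hK] := tight _ e20.
have mF : measurable (F : set (Bor E)) by exact: closed_Bor.
have mK : measurable (K : set (Bor E)) by exact: compact_Bor.
have mG : measurable (G : set (Bor E)) by exact: open_Bor.
have mKF : measurable ((K `&` F) : set (Bor E)) by exact: measurableI.
have mGF : measurable ((G `\` F) : set (Bor E)) by exact: measurableD.
have mKC : measurable ((~` K) : set (Bor E)) by exact: measurableC.
apply: (@le_trans _ _ (nu ((K `&` F) `|` ((G `\` F) `|` ~` K)))).
  apply: le_measure; rewrite ?inE//.
    by apply: measurableU => //; exact: measurableU.
  move=> x Ax; have [Kx|nKx] := pselect (K x); last by right; right.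
  have [Fx|nFx] := pselect (F x); first by left.
  by right; left; split => //; exact: AG.
apply: le_trans (measureU2 nu mKF _) _; first exact: measurableU.
apply: leeD.
  apply: ereal_sup_ubound; exists (K `&` F) => //; split.
    exact: compact_closedI.
  by move=> x [_ /FA].
apply: le_trans (measureU2 nu mGF mKC) _.
by rewrite [e]splitr EFinD; apply: leeD => //; exact: ltW.
Qed.

Lemma finite_radon_tight mu (e : R) : finite_radon mu -> 0 < e ->
  exists2 K : set E, compact K & (mu (~` K : set (Bor E)) <= e%:E)%E.
Proof.
move=> [muT rad] e0; have muF : mu setT \is a fin_num by rewrite ge0_fin_numE.
have : (mu setT - e%:E < ereal_sup (mu @` [set K : set (Bor E) | compact (K : set E) /\ K `<=` setT]))%E.
  by rewrite -rad// lteBlDr// lteDl// lte_fin.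
move=> /ereal_sup_gt[_ [K [cK _] <-] hK]; exists K => //.
have mK : measurable (K : set (Bor E)) by exact: compact_Bor.
rewrite -setTD measureD// ?setTI.
have KF : mu (K : set (Bor E)) \is a fin_num.
  by rewrite ge0_fin_numE//; apply: le_lt_trans muT; apply: le_measure; rewrite ?inE.
by rewrite leeBlDr// addeC; move: hK; rewrite lteBlDr//; exact: ltW.
Qed.

Lemma finite_radon_mscale mu (c : {nonneg R}) : finite_radon mu -> finite_radon (mscale c mu).
Proof.
move=> rad; have muT := proj1 rad; apply: tight_finite_radon.
  by rewrite /= /mscale lte_mul_pinfty// fin_numE.
move=> e e0; have c1 : 0 < c%:num + 1 by rewrite ltr_wpDl.
have [K cK hK] := finite_radon_tight rad (divr_gt0 e0 c1); exists K => //.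
rewrite /= /mscale; apply: (@le_trans _ _ ((c%:num)%:E * (e / (c%:num + 1))%:E)%E).
  by apply: lee_wpmul2l => //; rewrite lee_fin.
rewrite -EFinM lee_fin mulrCA -[leRHS]mulr1 ler_wpM2l ?(ltW e0)//.
by rewrite ler_pdivrMr// mul1r lerDl.
Qed.

End Radon.

(** * Ultralimits *)

Section Ultralimit.
Variables (R : realType).
Local Notation C := (Cplx R).

Lemma ultra_fmap (T U : Type) (G : set_system T) (u : T -> U) :
  UltraFilter G -> UltraFilter (u @ G).
Proof.
move=> UG; apply: Build_UltraFilter => H PH GH.
apply/seteqP; split => // A HA.
have [//|h] := in_ultra_setVsetC (u @^-1` A) UG.
have HnA : H (~` A) by exact: GH.
have : H (A `&` ~` A) by exact: filterI.
by move=> /filter_ex[x []].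
Qed.

Lemma ultra_bounded_cvg (T : Type) (G : set_system T) (u : T -> R) (B : R) :
  UltraFilter G -> (\forall x \near G, `|u x| <= B) ->
  exists2 l, `|l| <= B & u x @[x --> G] --> l.
Proof.
move=> UG hB; have := @segment_compact R (- B) B; rewrite compact_ultra.
move=> /(_ (u @ G) (ultra_fmap u UG)) h.
have [|l [/= lB hl]] := h.
  near=> x; rewrite /= in_itv /= -ler_norml; near: x; exact: hB.
by exists l => //; move: lB; rewrite in_itv /= -ler_norml.
Unshelve. all: by end_near. Qed.

Definition evbounded (T : Type) (F : set_system T) (u : T -> C) :=
  exists B : R, \forall x \near F, cabs (u x) <= B.

Lemma complex_ultralimit (T : Type) (F : set_system T) : ProperFilter F ->
  exists Lam : (T -> C) -> C,
    (forall a u v, evbounded F u -> evbounded F v ->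
       Lam (fun x => a * u x + v x) = a * Lam u + Lam v) /\
    (forall u B, (\forall x \near F, cabs (u x) <= B) -> cabs (Lam u) <= 2 * B) /\
    (forall c, Lam (fun=> c) = c).
Proof.
move=> PF; have [G [UG FG]] := ultraFilterLemma PF.
have PG : ProperFilter G by exact: ultra_proper.
pose L (w : T -> R) := lim (w x @[x --> G]).
have LP w (B : R) : (\forall x \near G, `|w x| <= B) ->
    `|L w| <= B /\ w x @[x --> G] --> L w.
  move=> /(ultra_bounded_cvg UG)[l lB hl].
  by rewrite /L (cvg_lim _ hl).
have ReP u B : (\forall x \near F, cabs (u x) <= B) ->
    `|L (fun x => complex.Re (u x))| <= B /\
    complex.Re (u x) @[x --> G] --> L (fun x => complex.Re (u x)).
  move=> h; apply: LP; apply: FG; apply: filterS h => x.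
  exact/le_trans/cabs_Re.
have ImP u B : (\forall x \near F, cabs (u x) <= B) ->
    `|L (fun x => complex.Im (u x))| <= B /\
    complex.Im (u x) @[x --> G] --> L (fun x => complex.Im (u x)).
  move=> h; apply: LP; apply: FG; apply: filterS h => x.
  by apply/le_trans; exact: cabs_Im.
exists (fun u => Complex (L (fun x => complex.Re (u x))) (L (fun x => complex.Im (u x)))).
split=> [[a b] u v [B hB] [B' hB']|].
  have [_ ru] := ReP _ _ hB; have [_ iu] := ImP _ _ hB.
  have [_ rv] := ReP _ _ hB'; have [_ iv] := ImP _ _ hB'.
  apply/eqP; rewrite eq_complex; apply/andP; split; apply/eqP => /=.
    apply: cvg_lim => //.
    rewrite (_ : (fun x => _) = fun x => a * complex.Re (u x) - b * complex.Im (u x) + complex.Re (v x)); last first.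
      by apply/funext => x; case: (u x) (v x) => ? ? [].
    by apply: cvgD => //; apply: cvgB; apply: cvgMr.
  apply: cvg_lim => //.
  rewrite (_ : (fun x => _) = fun x => a * complex.Im (u x) + b * complex.Re (u x) + complex.Im (v x)); last first.
    by apply/funext => x; case: (u x) (v x) => ? ? [].
  by apply: cvgD => //; apply: cvgD; apply: cvgMr.
split=> [u B hB|[a b]]; last by rewrite /L; congr Complex; apply: cvg_lim => //; exact: cvg_cst.
have [r _] := ReP _ _ hB; have [i _] := ImP _ _ hB.
rewrite mulr2n mulrDl !mul1r.
apply: le_trans (cabs_ReIm _) _ => /=; exact: lerD.
Qed.

(* The inner limit is the one in [m] (mesh), the outer one in [n] (step). *)
Definition iterated_oo : set_system (nat * nat) :=
  fun S => \forall n \near \oo, \forall m \near \oo, S (n, m).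

Global Instance iterated_oo_filter : ProperFilter iterated_oo.
Proof.
split.
  move=> [N _ /(_ N (leqnn _)) [M _ /(_ M (leqnn _))]]; exact.
split.
- by apply: nearW => n; apply: nearW.
- by move=> P Q hP hQ; rewrite /iterated_oo; near=> n;
    apply: filterI; near: n; [exact: hP|exact: hQ].
- by move=> P Q PQ hP; rewrite /iterated_oo; near=> n;
    apply: (@filterS _ _ _ (fun m => P (n, m))) => [m|]; [exact: PQ|near: n; exact: hP].
Unshelve. all: by end_near. Qed.

End Ultralimit.

(** * Riemann sums in polar coordinates *)

Section Cylinder.
Variables (R : realType) (E : normedModType (Cplx R)).
Local Notation C := (Cplx R).
Variables (mu : {measure set (Bor E) -> \bar R}) (muT : (mu setT < +oo)%E) (P : nat).

Lemma leb_itv_fin (a b : R) : (lebesgue_measure (`]a, b]%classic : set R) < +oo)%E.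
Proof. by rewrite lebesgue_measure_itv/=; case: ifPn; rewrite ?ltry// -EFinB ltry. Qed.

Definition Rrestr (b : R) : {sigma_finite_measure set (measurableTypeR R) -> \bar R} :=
  @mfrestr _ (measurableTypeR R) R _ _ (measurable_itv `]0, b : R]) (leb_itv_fin 0 b).
Definition fmu : {sigma_finite_measure set (Bor E) -> \bar R} :=
  mfrestr (@measurableT _ (Bor E)) muT.

Definition polar_measure (A : set (measurableTypeR R * measurableTypeR R)) : \bar R :=
  (Rrestr P%:R \x Rrestr 1)%E A.

HB.instance Definition _ := Measure.copy polar_measure (Rrestr P%:R \x Rrestr 1)%E.

Lemma RrestrE b A : Rrestr b A = lebesgue_measure ((A `&` `]0, b]) : set (measurableTypeR R)).
Proof. by []. Qed.

Lemma fmuE A : fmu A = mu A.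
Proof. by rewrite /fmu/= /mfrestr /mrestr setIT. Qed.

Lemma polar_measureX (A B : set (measurableTypeR R)) : measurable A -> measurable B ->
  polar_measure (A `*` B) = (Rrestr P%:R A * Rrestr 1 B)%E.
Proof. by move=> mA mB; rewrite /polar_measure product_measure1E. Qed.

Lemma polar_measure_fin : fin_num_fun polar_measure.
Proof.
move=> A mA; rewrite ge0_fin_numE ?measure_ge0//.
apply: (@le_lt_trans _ _ (polar_measure (setT `*` setT))).
  by apply: le_measure; rewrite ?inE// setXTT.
rewrite polar_measureX// !RrestrE !setTI lte_mul_pinfty// ?ge0_fin_numE//;
  exact: leb_itv_fin.
Qed.

HB.instance Definition _ := Measure_isFinite.Build _ _ _ polar_measure polar_measure_fin.

Definition pm : {sigma_finite_measure set (measurableTypeR R * measurableTypeR R)%type -> \bar R} :=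
  polar_measure.
Definition prm : {measure set ((measurableTypeR R * measurableTypeR R) * Bor E)%type -> \bar R} :=
  (pm \x fmu)%E.

Lemma fmu_integral (v : Bor E -> \bar R) : (\int[fmu]_x v x = \int[mu]_x v x)%E.
Proof. by apply: eq_measure_integral => A mA _; exact: fmuE. Qed.

Lemma prm_integral_cell (A : set (measurableTypeR R * measurableTypeR R)%type) (v : E -> R) :
  measurable A -> cbnd v -> (forall x, 0 <= v x) ->
  (\int[prm]_p (\1_A p.1 * v p.2)%:E = pm A * (mint mu v)%:E)%E.
Proof.
move=> mA cv v0.
rewrite fubini_tonelli1; last 2 first.
- apply/measurable_EFinP; apply: measurable_funM.
    by apply: measurableT_comp => //; exact: measurable_indic.
  by apply: (measurableT_comp (continuous_Bor (proj1 cv))).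
- by move=> p; rewrite lee_fin mulr_ge0.
rewrite /fubini_F/=.
rewrite (eq_integral (fun p => (mint mu v)%:E * (\1_A p)%:E)%E); last first.
  move=> p _; rewrite fmu_integral.
  under eq_integral do rewrite EFinM.
  rewrite ge0_integralZl//; last 2 first.
  - by apply/measurable_EFinP; exact: (continuous_Bor (proj1 cv)).
  - by move=> x _; rewrite lee_fin.
  by rewrite mintE// muleC.
rewrite ge0_integralZl//; last by rewrite lee_fin; exact: mint_ge0.
  by rewrite integral_indic// setIT muleC.
by apply/measurable_EFinP; exact: measurable_indic.
Qed.
End Cylinder.

Section Riemann.
Variables (R : realType) (E : normedModType (Cplx R)).
Local Notation C := (Cplx R).
Variables (mu : {measure set (Bor E) -> \bar R}) (muT : (mu setT < +oo)%E) (P : nat).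

Local Notation MR := (measurableTypeR R).
Local Notation prm := (prm muT P).
Local Notation pm := (pm R P).

Definition icell (M a : nat) : set MR := `]a%:R / M%:R, a.+1%:R / M%:R]%classic.

Lemma icell_leb (b M a : nat) : (a < b * M)%N ->
  Rrestr b%:R (icell M a) = ((M%:R)^-1 : R)%:E.
Proof.
move=> ab; have M0 : 0 < M%:R :> R.
  by rewrite ltr0n; case: M ab => //; rewrite muln0.
rewrite RrestrE setIidl; last first.
  move=> x; rewrite /icell /= !in_itv /= => /andP[h1 h2]; apply/andP; split.
    by apply: le_lt_trans h1; rewrite divr_ge0// ltW.
  apply: le_trans h2 _; rewrite ler_pdivrMr// -natrM ler_nat//.
rewrite lebesgue_measure_itv /= lte_fin ltr_pM2r ?invr_gt0// ltr_nat ltnSn.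
by rewrite -EFinB -mulrBl -natr1 addrAC subrr add0r mul1r.
Qed.

Lemma icell_unique (M a a' : nat) r : icell M a r -> icell M a' r -> a = a'.
Proof.
case: (posnP M) => [->|M0].
  by rewrite /icell /= in_itv /= invr0 !mulr0 => /andP[h1 h2] _;
    have := lt_le_trans h1 h2; rewrite ltxx.
have M0' : 0 < M%:R :> R by rewrite ltr0n.
wlog : a a' / (a < a')%N => [hw h1 h2|aa'].
  case: (ltngtP a a') => //; first by move=> /hw; exact.
  by move=> /hw h; apply/esym; exact: h.
rewrite /icell /= !in_itv /= => /andP[_ h1] /andP[h2 _].
have : a.+1%:R / M%:R <= a'%:R / M%:R :> R by rewrite ler_pM2r ?invr_gt0// ler_nat.
by move=> h3; have := lt_le_trans h2 (le_trans h1 h3); rewrite ltxx.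
Qed.

Lemma icell_ex (b M : nat) (r : R) : (0 < M)%N -> 0 < r -> r <= b%:R ->
  exists2 a, (a < b * M)%N & icell M a r.
Proof.
move=> M0 r0 rb; have M0' : 0 < M%:R :> R by rewrite ltr0n.
have rM : 0 < r * M%:R by rewrite mulr_gt0.
have [c hc] : exists c : nat, (c%:R < r * M%:R <= c.+1%:R).
  have ex : exists n : nat, r * M%:R <= n%:R.
    by exists (Num.truncn (r * M%:R)).+1; apply/ltW; exact: truncnS_gt.
  case: (ex_minnP ex) => [[|n] hn hmin]; first by move: hn rM; rewrite leNgt => /negP.
  exists n; rewrite hn andbT ltNge; apply/negP => /hmin; rewrite ltnn//.
case/andP: hc => h1 h2; exists c.
  rewrite -(ltr_nat R) natrM; apply: lt_le_trans h1 _.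
  by rewrite ler_pM2r.
by rewrite /icell /= in_itv /= ltr_pdivrMr// ler_pdivlMr// h1 h2.
Qed.

Section phi.
Variables (phi : R -> R -> E -> R) (B : R).
Hypothesis cphi : forall r t, cbnd (phi r t).
Hypothesis phi0 : forall r t x, 0 <= phi r t x.
Hypothesis phiB : forall r t x, phi r t x <= B.

Definition node (M a : nat) : R := a.+1%:R / M%:R.

Definition riemann (M : nat) : R :=
  (M%:R)^-1 ^+ 2 * \sum_(a < P * M) \sum_(b < M) mint mu (phi (node M a) (node M b)).

Definition step (M : nat) (p : (MR * MR) * Bor E) : R :=
  \sum_(a < P * M) \sum_(b < M)
    \1_(icell M a `*` icell M b) p.1 * phi (node M a) (node M b) p.2.

Lemma measurable_cell M a b : measurable (icell M a `*` icell M b).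
Proof. by apply: measurableX; exact: measurable_itv. Qed.

Lemma measurable_cell_term M a b : measurable_fun setT
  (fun p : (MR * MR) * Bor E =>
    \1_(icell M a `*` icell M b) p.1 * phi (node M a) (node M b) p.2).
Proof.
apply: measurable_funM.
  by apply: measurableT_comp => //; apply: measurable_indic; exact: measurable_cell.
exact: (measurableT_comp (continuous_Bor (proj1 (cphi _ _)))).
Qed.

Lemma measurable_step M : measurable_fun setT (step M).
Proof.
apply: measurable_sum => a; apply: measurable_sum => b; exact: measurable_cell_term.
Qed.

Lemma step_integral M : (\int[prm]_p (step M p)%:E = (riemann M)%:E)%E.
Proof.
under eq_integral do rewrite /step -sumEFin.
have t0 M' a b (p : (MR * MR) * Bor E) :
    0 <= \1_(icell M' a `*` icell M' b) p.1 * phi (node M' a) (node M' b) p.2.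
  by rewrite mulr_ge0.
rewrite ge0_integral_sum//; last 2 first.
- move=> a; apply/measurable_EFinP; apply: measurable_sum => b.
  exact: measurable_cell_term.
- by move=> a p _; rewrite lee_fin sumr_ge0.
rewrite /riemann mulr_sumr -sumEFin; apply: eq_bigr => a _.
under eq_integral do rewrite -sumEFin.
rewrite ge0_integral_sum//; last 2 first.
- by move=> b; apply/measurable_EFinP; exact: measurable_cell_term.
- by move=> b p _; rewrite lee_fin.
rewrite mulr_sumr -sumEFin; apply: eq_bigr => b _.
rewrite prm_integral_cell//; last exact: measurable_cell.
rewrite /pm/= polar_measureX; [|exact: measurable_itv..].
by rewrite icell_leb// (@icell_leb 1) ?mul1n// expr2 -!EFinM.
Qed.

Definition cyl : set ((MR * MR) * Bor E) := (`]0, P%:R] `*` `]0, 1]) `*` setT.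

Lemma measurable_cyl : measurable cyl.
Proof. by apply: measurableX => //; apply: measurableX; exact: measurable_itv. Qed.

Lemma prm_cylC : prm (~` cyl) = 0%E.
Proof.
have -> : ~` cyl = (~` (`]0, P%:R] `*` `]0, 1])) `*` setT.
  by apply/seteqP; split => p /= h => [|[]]; [split => // h'; apply: h|move: h => []].
have m1 : measurable (`]0, P%:R : R] : set MR) by exact: measurable_itv.
have m2 : measurable (`]0, 1 : R] : set MR) by exact: measurable_itv.
have m12 : measurable ((`]0, P%:R : R] : set MR) `*` (`]0, 1 : R] : set MR)).
  exact: measurableX.
rewrite -[LHS]/((pm \x fmu muT)%E _) product_measure1E//; last exact: measurableC.
apply/eqP; rewrite mule_eq0; apply/orP; left; apply/eqP.
apply/eqP; rewrite eq_le measure_ge0 andbT.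
have -> : ~` (`]0, P%:R : R]%classic `*` `]0, 1 : R]%classic) =
   ((~` `]0, P%:R : R]%classic) `*` (setT : set MR)) `|` ((setT : set MR) `*` (~` `]0, 1 : R]%classic)).
  apply/seteqP; split => -[r t] /=.
    by move=> h; have [h1|] := pselect (r \in `]0, P%:R]); [right|left]; split => // h2; apply: h.
  by move=> [[h _]|[_ h]] [].
apply: (@le_trans _ _ (0 + 0)%E); last by rewrite adde0.
apply: le_trans (measureU2 _ _ _) _.
- by apply: measurableX => //; exact: measurableC.
- by apply: measurableX => //; exact: measurableC.
apply: leeD; apply: eq_imp_le.
  by rewrite /pm/= polar_measureX ?RrestrE ?setICl ?measure0 ?mul0e//; exact: measurableC.
by rewrite /pm/= polar_measureX ?RrestrE ?setICl ?measure0 ?mule0//; exact: measurableC.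
Qed.

Lemma step_at M (p : (MR * MR) * Bor E) : (0 < M)%N -> cyl p ->
  exists r t, [/\ p.1.1 <= r < p.1.1 + (M%:R)^-1, p.1.2 <= t < p.1.2 + (M%:R)^-1 &
     step M p = phi r t p.2].
Proof.
case: p => -[r t] x M0 [[/=]]; rewrite !in_itv /= => /andP[r0 rP] /andP[t0 t1] _.
have [a aP ra] := icell_ex M0 r0 rP.
have [|b bP tb] := @icell_ex 1 M _ M0 t0; first by [].
rewrite mul1n in bP.
have cellP c s : icell M c s -> s <= node M c < s + (M%:R)^-1.
  rewrite /icell /= in_itv /= => /andP[h1 h2]; rewrite h2 /=.
  by rewrite /node -natr1 mulrDl mul1r ltrD2r.
exists (node M a), (node M b); split; [exact: cellP|exact: cellP|].
rewrite /step (bigD1 (Ordinal aP))//= (bigD1 (Ordinal bP))//=.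
rewrite indicE mem_set// mul1r !big1 ?addr0//.
  move=> i ia; rewrite big1// => j _; rewrite indicE memNset ?mul0r// => -[h _].
  by move/eqP: ia; apply; apply: val_inj; exact: icell_unique h ra.
move=> j jb; rewrite indicE memNset ?mul0r// => -[_ h].
by move/eqP: jb; apply; apply: val_inj; exact: icell_unique h tb.
Qed.

Hypothesis phi_cont : forall (r t : R) x (r_ t_ : nat -> R), 0 < r ->
  r_ n @[n --> \oo] --> r -> t_ n @[n --> \oo] --> t ->
  phi (r_ n) (t_ n) x @[n --> \oo] --> phi r t x.

Lemma step_cvg p : cyl p -> step M p @[M --> \oo] --> phi p.1.1 p.1.2 p.2.
Proof.
move=> cp; rewrite -(cvg_shiftS (fun M => step M p)).
have /choice[rt hrt] : forall M, exists rt : R * R,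
   [/\ p.1.1 <= rt.1 < p.1.1 + (M.+1%:R)^-1, p.1.2 <= rt.2 < p.1.2 + (M.+1%:R)^-1 &
     step M.+1 p = phi rt.1 rt.2 p.2].
  by move=> M; have [r [t h]] := @step_at M.+1 p isT cp; exists (r, t).
rewrite (_ : (fun M => _) = fun M => phi (rt M).1 (rt M).2 p.2); last first.
  by apply/funext => M /=; case: (hrt M).
have sq (s : R) (s_ : nat -> R) : (forall M, s <= s_ M < s + (M.+1%:R)^-1) ->
    s_ n @[n --> \oo] --> s.
  move=> h; apply: (@squeeze_cvgr _ _ _ _ (fun=> s) (fun M => s + (M.+1%:R)^-1)).
  - by apply: nearW => M; have /andP[-> /ltW ->] := h M.
  - exact: cvg_cst.
  - by rewrite -[X in _ --> X]addr0; apply: cvgD; [exact: cvg_cst|exact: cvg_harmonic].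
apply: phi_cont.
- by case: p cp {hrt} => -[r t] x [[/=]]; rewrite in_itv /= => /andP[].
- by apply: sq => M; case: (hrt M).
- by apply: sq => M; case: (hrt M).
Qed.

Lemma measurable_phi : measurable_fun cyl (fun p : (MR * MR) * Bor E => phi p.1.1 p.1.2 p.2).
Proof.
apply: (@measurable_fun_cvg _ _ _ _ step).
- by move=> M; apply: measurable_funTS; exact: measurable_step.
- exact: step_cvg.
Qed.

Lemma prm_fin : (prm setT < +oo)%E.
Proof.
rewrite -setXTT -[X in (X < _)%E]/((pm \x fmu muT)%E _) product_measure1E// fmuE lte_mul_pinfty//.
exact: polar_measure_fin.
Qed.

Definition polar_int : R := fine (\int[prm]_(p in cyl) (phi p.1.1 p.1.2 p.2)%:E)%E.

Lemma cyl_cst_integrable : prm.-integrable cyl (EFin \o cst B).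
Proof.
apply/integrableP; split; first exact/measurable_EFinP/measurable_cst.
rewrite /= integral_cst//; last exact: measurable_cyl.
rewrite lte_mul_pinfty//.
apply: le_lt_trans prm_fin; apply: le_measure; rewrite ?inE//; exact: measurable_cyl.
Qed.

Lemma polar_integrable : prm.-integrable cyl
  (EFin \o (fun p : (MR * MR) * Bor E => phi p.1.1 p.1.2 p.2)).
Proof.
apply: (@le_integrable _ _ _ _ _ _ _ (EFin \o cst B)).
- exact: measurable_cyl.
- by apply/measurable_EFinP; exact: measurable_phi.
- by move=> p _ /=; rewrite lee_fin ger0_norm// (le_trans (phiB _ _ _))// ler_norm.
- exact: cyl_cst_integrable.
Qed.

Lemma polar_intE : (\int[prm]_(p in cyl) (phi p.1.1 p.1.2 p.2)%:E = polar_int%:E)%E.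
Proof.
rewrite /polar_int fineK//; apply: (integrable_fin_num _ polar_integrable).
exact: measurable_cyl.
Qed.

Lemma riemann_cvg : riemann M @[M --> \oo] --> polar_int.
Proof.
have h : (\int[prm]_(p in cyl) (step M.+1 p)%:E)%E @[M --> \oo] --> polar_int%:E.
  rewrite -polar_intE.
  apply: (@dominated_cvg _ _ _ prm _ measurable_cyl _ _ (EFin \o cst B)) => //.
  - by move=> n; apply/measurable_EFinP; apply: measurable_funTS; exact: measurable_step.
  - move=> p cp; apply: cvg_EFin; first exact: nearW.
    by have := step_cvg cp; rewrite -(cvg_shiftS (fun M => step M p)).
  - exact: cyl_cst_integrable.
  - move=> n p cp /=; rewrite lee_fin.
    have [r [t [_ _ ->]]] := @step_at n.+1 p isT cp.
    by rewrite ger0_norm.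
rewrite -(cvg_shiftS riemann).
suff -> : (fun n => riemann n.+1) = fun M => fine (\int[prm]_(p in cyl) (step M.+1 p)%:E)%E.
  by move/fine_cvgP: h => [].
apply/funext => M; rewrite -[LHS]/(fine (riemann M.+1)%:E) -step_integral; congr fine.
rewrite [LHS](ge0_negligible_integral (measurableC measurable_cyl))//.
- by rewrite setTD setCK.
- by apply/measurable_EFinP; exact: measurable_step.
- by move=> p _; rewrite lee_fin; apply: sumr_ge0 => a _; apply: sumr_ge0 => b _; rewrite mulr_ge0.
- exact: prm_cylC.
Qed.

End phi.
End Riemann.

Section Spiral.
Variable R : realType.
Local Notation C := (Cplx R).

Definition cis (t : R) : C := Complex (cos (pi *+ 2 * t)) (sin (pi *+ 2 * t)).

Lemma cisD s t : cis (s + t) = cis s * cis t.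
Proof.
rewrite /cis mulrDr cosD sinD; apply/eqP; rewrite eq_complex /=.
by apply/andP; split => //; apply/eqP; ring.
Qed.

Lemma cis1 : cis 1 = 1.
Proof. by rewrite /cis mulr1 cos2pi sin2pi. Qed.

Lemma cabs_cis t : cabs (cis t) = 1.
Proof. by apply: rC_inj; rewrite -cabsE normc_def /= cos2Dsin2 sqrtr1. Qed.

Lemma cis_neq1 (n : nat) : cis (n.+3%:R)^-1 != 1.
Proof.
apply/eqP => /(congr1 (@complex.Im R)) /= /eqP; rewrite gt_eqF//.
have p0 := pi_gt0 R.
have h : 0 < n.+3%:R^-1 :> R by rewrite invr_gt0 ltr0n.
have h2 : n.+3%:R^-1 < 2^-1 :> R by rewrite ltf_pV2 ?posrE// ltr_nat.
apply: sin_gt0_pi; rewrite -(mulr_natr pi 2); apply/andP; split.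
  by apply: mulr_gt0 => //; apply: mulr_gt0.
by rewrite -mulrA gtr_pMr//; move: h2; move: (n.+3%:R^-1 : R) => u; lra.
Qed.

Lemma rC_continuous : continuous (@rC R).
Proof.
move=> r; apply/cvgrPdist_lt => e e0.
have ee : e = rC (complex.Re e) by apply: rC_Re; exact: ltW.
have e0' : 0 < complex.Re e by rewrite -rC_lt -ee.
near=> s; rewrite ee -rCN -rCD cabsE cabs_rC rC_lt.
by near: s; exact: cvgr_dist_lt.
Unshelve. all: by end_near. Qed.

Lemma cis_continuous : continuous cis.
Proof.
have -> : cis = fun t => rC (cos (pi *+ 2 * t)) + Complex 0 1 * rC (sin (pi *+ 2 * t)).
  by apply/funext => t; rewrite /cis /rC; simpc.
move=> t; have ct : s @[s --> t] --> t by [].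
have c2 : (pi *+ 2 * s) @[s --> t] --> pi *+ 2 * t by apply: cvgMr.
have ccos : cos (pi *+ 2 * s) @[s --> t] --> cos (pi *+ 2 * t).
  exact: (cvg_comp _ _ c2 (@continuous_cos _ _)).
have csin : sin (pi *+ 2 * s) @[s --> t] --> sin (pi *+ 2 * t).
  exact: (cvg_comp _ _ c2 (@continuous_sin _ _)).
apply: cvgD; first exact: (cvg_comp _ _ ccos (@rC_continuous _)).
apply: cvgM; first exact: cvg_cst.
exact: (cvg_comp _ _ csin (@rC_continuous _)).
Qed.

Definition lam (r t : R) : C := 1 + rC r * cis t.

Lemma cabs_lam_le r t : cabs (lam r t) <= 1 + `|r|.
Proof. by rewrite (le_trans (cabsD _ _))// cabs1 cabsM cabs_cis mulr1 cabs_rC. Qed.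

Lemma cabs_lam_ge r t : `|r| - 1 <= cabs (lam r t).
Proof.
have := cabs_distC (rC r * cis t) 0; rewrite subr0 sub0r cabsN => _.
have := cabsD (lam r t) (- 1); rewrite /lam addrAC subrr add0r cabsM cabs_cis.
by rewrite mulr1 cabs_rC cabsN cabs1; lra.
Qed.

Lemma lam_cvg (T : Type) (F : set_system T) (FF : Filter F) (r_ t_ : T -> R) r t :
  r_ n @[n --> F] --> r -> t_ n @[n --> F] --> t ->
  lam (r_ n) (t_ n) @[n --> F] --> lam r t.
Proof.
move=> hr ht; apply: cvgD; first exact: cvg_cst.
apply: cvgM; first exact: (cvg_comp _ _ hr (@rC_continuous _)).
exact: (cvg_comp _ _ ht (@cis_continuous _)).
Qed.

Section spiral.
Variables (E : normedModType C).

Definition spiral (p : (R * R) * E) : E := lam p.1.1 p.1.2 *: p.2.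

Lemma spiral_continuous : continuous spiral.
Proof.
have c1 (U V : topologicalType) (z : U * V) : z'.1 @[z' --> z] --> z.1.
  by case: z => ? ?; exact: cvg_fst.
have c2 (U V : topologicalType) (z : U * V) : z'.2 @[z' --> z] --> z.2.
  by case: z => ? ?; exact: cvg_snd.
move=> p; apply: cvgZ; last exact: c2.
by apply: lam_cvg; [exact: (cvg_comp _ _ (c1 _ _ p) (c1 _ _ p.1))
  |exact: (cvg_comp _ _ (c1 _ _ p) (c2 _ _ p.1))].
Qed.

Local Notation MR := (measurableTypeR R).

Lemma spiral_near (O : set E) (r t : R) (x : E) : open O -> O (lam r t *: x) ->
  exists (e : R) (V : set E), [/\ 0 < e, open V, V x &
    forall r' t' y, `|r - r'| < e -> `|t - t'| < e -> V y -> O (lam r' t' *: y)].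
Proof.
move=> oO Op.
have : nbhs ((r, t), x) (spiral @^-1` O).
  by apply: spiral_continuous; exact: open_nbhs_nbhs.
case=> -[/= A V] [[[A1 A2] /= [hA1 hA2] hA] hV] hAV.
have /nbhs_ballP[e1 /= e10 he1] := hA1.
have /nbhs_ballP[e2 /= e20 he2] := hA2.
have [V' [oV V'x V'V]] : exists V', [/\ open V', V' x & V' `<=` V].
  by move: hV; rewrite nbhsE => -[V' [oV V'x] ?]; exists V'.
exists (Num.min e1 e2), V'; split => //; first by rewrite lt_min e10 e20.
move=> r' t' y; rewrite !lt_min => /andP[r1 _] /andP[_ t2] Vy.
apply: (hAV ((r', t'), y)); split => /=; last exact: V'V.
by apply: hA; split; [exact: he1|exact: he2].
Qed.

Definition rational_box (q : rat * rat * nat) : set (MR * MR) :=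
  [set z | `|ratr q.1.1 - z.1| < q.2.+1%:R^-1 /\ `|ratr q.1.2 - z.2| < q.2.+1%:R^-1].

Lemma measurable_rational_box q : measurable (rational_box q).
Proof.
have -> : rational_box q = (ball (ratr q.1.1 : R) (q.2.+1%:R^-1 : R)) `*` (ball (ratr q.1.2 : R) (q.2.+1%:R^-1 : R)) by [].
apply: measurableX; exact: measurable_ball.
Qed.

Lemma spiral_measurable : measurable_fun [set: (MR * MR) * Bor E] (spiral : _ -> Bor E).
Proof.
apply: (@measurability _ _ ((MR * MR) * Bor E)%type (Bor E) setT spiral (@open E) erefl).
move=> _ [U oU <-]; rewrite setTI.
pose V q : set E := [set x | exists2 V : set E, open V /\ V x &
  forall r t y, rational_box q (r, t) -> V y -> U (lam r t *: y)].
have oV q : open (V q).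
  rewrite openE => x /= [V' [oV' V'x] h]; apply: (@filterS _ _ _ V'); last exact: open_nbhs_nbhs.
  by move=> y V'y; exists V'.
rewrite (_ : _ @^-1` _ = \bigcup_q (rational_box q `*` V q)).
  apply: countable_bigcupT_measurable; first exact: countableP.
  by move=> q; apply: measurableX; [exact: measurable_rational_box|exact: open_Bor].
apply/seteqP; split => -[[r t] x] /=; last first.
  by move=> [q _ [/= b [V' [_ V'x] h]]]; exact: h b V'x.
move=> /(spiral_near oU)[e [V' [e0 oV' V'x h]]].
have [n hn] : exists n : nat, n.+1%:R^-1 < e / 2.
  exists (Num.truncn (e / 2)^-1).
  by rewrite invf_plt ?posrE ?divr_gt0// truncnS_gt.
have n0 : 0 < n.+1%:R^-1 :> R by rewrite invr_gt0.
have rat_near (s : R) : exists q : rat, `|ratr q - s| < n.+1%:R^-1.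
  have [|q] := @rat_in_itvoo R (s - n.+1%:R^-1) (s + n.+1%:R^-1).
    by rewrite ltrD2l gtrN.
  by rewrite in_itv /= => hq; exists q; rewrite ltr_distl.
have [q1 hq1] := rat_near r; have [q2 hq2] := rat_near t.
exists (q1, q2, n) => //; split => //=.
exists V' => // r' t' y [/= h1 h2] V'y; apply: h => //.
  rewrite -(subrK (ratr q1) r) -addrA (le_lt_trans (ler_normD _ _))//.
  by rewrite (distrC r) [e]splitr (lt_trans (ltrD hq1 h1))// ltrD.
rewrite -(subrK (ratr q2) t) -addrA (le_lt_trans (ler_normD _ _))//.
by rewrite (distrC t) [e]splitr (lt_trans (ltrD hq2 h2))// ltrD.
Qed.

Section spiral_measure.
Variables (mu : {measure set (Bor E) -> \bar R}) (muT : (mu setT < +oo)%E) (P : nat).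

Definition spiral_measure : {measure set (Bor E) -> \bar R} :=
  measure_function_pushforward__canonical__measure_function_Measure (prm muT P) spiral_measurable.

Lemma spiral_measureE A : spiral_measure A = prm muT P (spiral @^-1` A).
Proof. by []. Qed.

Lemma spiral_measure_fin : (spiral_measure setT < +oo)%E.
Proof. by rewrite spiral_measureE preimage_setT; exact: prm_fin. Qed.

Lemma spiral_measure_integral (v : E -> R) : cbnd v -> (forall x, 0 <= v x) ->
  mint spiral_measure v = polar_int muT P (fun r t x => v (lam r t *: x)).
Proof.
move=> cv v0; rewrite /mint /Rintegral /polar_int; congr fine.
have mv : measurable_fun [set: Bor E] (EFin \o (v : Bor E -> R)).
  by apply/measurable_EFinP; exact: continuous_Bor (proj1 cv).
rewrite (ge0_integral_pushforward spiral_measurable)//; last first.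
  by move=> x _ /=; rewrite lee_fin.
rewrite preimage_setT.
rewrite [LHS](ge0_negligible_integral (measurableC (measurable_cyl P)))//.
- by rewrite setTD setCK.
- by apply: measurableT_comp => //; exact: spiral_measurable.
- by move=> p _; rewrite /= lee_fin.
- exact: prm_cylC.
Qed.

Lemma spiral_measure_radon : finite_radon mu -> finite_radon spiral_measure.
Proof.
move=> rad; apply: tight_finite_radon; first exact: spiral_measure_fin.
move=> e e0.
have P0 : 0 < P%:R + 1 :> R by rewrite ltr_wpDl.
have [K cK hK] := finite_radon_tight rad (divr_gt0 e0 P0).
have cK' : compact (spiral @` ((`[0, P%:R] `*` `[0, 1]) `*` K)).
  apply: continuous_compact.
    by apply: continuous_subspaceT; exact: spiral_continuous.
  apply: compact_setX => //; apply: compact_setX; exact: segment_compact.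
exists (spiral @` ((`[0, P%:R] `*` `[0, 1]) `*` K)); first exact: cK'.
have mK : measurable (K : set (Bor E)) by exact: compact_Bor.
rewrite spiral_measureE.
have mTK : measurable ((setT : set (MR * MR)) `*` (~` K : set (Bor E))).
  by apply: measurableX => //; exact: measurableC.
have mCyl : measurable (~` @cyl R E P) by apply: measurableC; exact: measurable_cyl.
apply: (@le_trans _ _ (prm muT P (setT `*` (~` K) `|` ~` @cyl R E P))).
  have mU : measurable (setT `*` (~` K) `|` ~` @cyl R E P : set ((MR * MR) * Bor E)) by exact: measurableU.
  have mp : measurable (spiral @^-1` (~` (spiral @` ((`[0, P%:R] `*` `[0, 1]) `*` K))) : set ((MR * MR) * Bor E)).
    rewrite -[X in measurable X]setTI; apply: spiral_measurable => //.
    by apply: measurableC; exact: compact_Bor.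
  apply: le_measure; rewrite ?inE//.
  move=> p hp; have [Kp|nKp] := pselect (K p.2); last by left.
  right => -[[/= p1 p2] _]; apply: hp; exists p => //; split => //; split => /=.
    by move: p1; rewrite !in_itv /= => /andP[/ltW -> ->].
  by move: p2; rewrite !in_itv /= => /andP[/ltW -> ->].
apply: le_trans (measureU2 _ mTK mCyl) _.
apply: (@le_trans _ _ ((P%:R)%:E * (e / (P%:R + 1))%:E + 0)%E).
  apply: leeD; last by apply: eq_imp_le; exact: prm_cylC.
  apply: (@le_trans _ _ ((P%:R)%:E * mu (~` K : set (Bor E)))%E); last first.
    by rewrite lee_wpmul2l.
  apply: eq_imp_le.
  rewrite -[LHS]/((pm R P \x fmu muT)%E _) product_measure1E//; last exact: measurableC.
  rewrite fmuE; congr (_ * _)%E.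
  rewrite -setXTT [LHS]polar_measureX// !RrestrE !setTI.
  rewrite !lebesgue_measure_itv /= !lte_fin ltr01 -!EFinB !subr0 mule1.
  by case: ltP => // h0; congr EFin; apply/eqP; rewrite eq_le h0 ler0n.
rewrite adde0 -EFinM lee_fin mulrCA -[leRHS]mulr1 ler_wpM2l ?(ltW e0)//.
by rewrite ler_pdivrMr// mul1r lerDl.
Qed.
End spiral_measure.
End spiral.
End Spiral.

(** * The Leibniz rule *)

Section Clip.
Variable R : realType.

Lemma min_lip (a s t : R) : `|Num.min a s - Num.min a t| <= `|s - t|.
Proof.
have h1 := ler_norm (s - t); have := ler_norm (t - s); rewrite distrC => h2.
rewrite ler_norml; move: `|s - t| h1 h2 => b h1 h2.
by rewrite !minElt; case: (ltP a s) => ?; case: (ltP a t) => ?; apply/andP; split; lra.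
Qed.

Lemma max_lip (a s t : R) : `|Num.max a s - Num.max a t| <= `|s - t|.
Proof.
have h1 := ler_norm (s - t); have := ler_norm (t - s); rewrite distrC => h2.
rewrite ler_norml; move: `|s - t| h1 h2 => b h1 h2.
by rewrite !maxElt; case: (ltP a s) => ?; case: (ltP a t) => ?; apply/andP; split; lra.
Qed.

Definition clip01 (s : R) : R := Num.min 1 (Num.max 0 s).

Lemma clip01_lip s t : `|clip01 s - clip01 t| <= `|s - t|.
Proof. exact: le_trans (min_lip _ _ _) (max_lip _ _ _). Qed.

Lemma clip01_ge0 s : 0 <= clip01 s.
Proof. by rewrite /clip01 le_min ler01 le_max lexx. Qed.

Lemma clip01_le1 s : clip01 s <= 1.
Proof. by rewrite /clip01 ge_min lexx. Qed.

Lemma clip01_mono s t : s <= t -> clip01 s <= clip01 t.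
Proof.
by move=> st; rewrite /clip01 !minElt !maxElt; case: (ltP 0 s) => ?; (try case: (ltP 0 t) => ?); repeat (case: ltP => ?); lra.
Qed.

Lemma clip01_0 s : s <= 0 -> clip01 s = 0.
Proof. by move=> h; rewrite /clip01 (max_idPl h) (min_idPr ler01). Qed.

Lemma clip01_1 s : 1 <= s -> clip01 s = 1.
Proof.
by move=> h; rewrite /clip01 (max_idPr (le_trans ler01 h)) (min_idPl h).
Qed.

Definition clip (e s : R) : R := Num.min e (Num.max (- e) s).

Lemma clip_lip e s t : `|clip e s - clip e t| <= `|s - t|.
Proof. exact: le_trans (min_lip _ _ _) (max_lip _ _ _). Qed.

Lemma clip_bound e s : 0 <= e -> `|clip e s| <= e.
Proof.
move=> e0; rewrite ler_norml /clip le_min le_max ge_min !lexx /= andbT; lra.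
Qed.

Lemma clip_id e s : `|s| <= e -> clip e s = s.
Proof.
rewrite ler_norml => /andP[h1 h2].
by rewrite /clip (max_idPr h1) (min_idPr h2).
Qed.

End Clip.

Section Leibniz.
Variables (R : realType) (E : normedModType (Cplx R)).
Local Notation C := (Cplx R).
Variables (mu : {measure set (Bor E) -> \bar R}) (muT : (mu setT < +oo)%E).
Variables (J : (E -> C) -> Prop) (Phi : (E -> C) -> (E -> C) -> C) (K : R).
Hypothesis J0 : J (fun=> 0).
Hypothesis Jlip : forall f, J f -> lipb f.
Hypothesis JM : forall f g, J f -> lipb g -> J (fun x => f x * g x).
Hypothesis JD : forall f g, J f -> J g -> J (fun x => f x + g x).
Hypothesis PhiL : forall a f g u, J f -> J g -> lipb u ->
  Phi (fun x => a * f x + g x) u = a * Phi f u + Phi g u.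
Hypothesis PhiR : forall a f u v, J f -> lipb u -> lipb v ->
  Phi f (fun x => a * u x + v x) = a * Phi f u + Phi f v.
Hypothesis Philoc : forall f u c (V : set E), J f -> lipb u -> open V ->
  fsupp f `<=` V -> (forall x, V x -> u x = c) -> Phi f u = 0.
Hypothesis K0 : 0 <= K.
Hypothesis PhiM : forall f u L, J f -> lipb u -> 0 <= L -> Lip L u ->
  cabs (Phi f u) <= K * L * mint mu (fun x => cabs (f x)).

Definition defect (f : E -> C) (v : E -> R) : C := (Phi f (fun x => rC (v x) * rC (v x))
  - 2 * Phi (fun x => f x * rC (v x)) (fun x => rC (v x))).

Lemma lipb_rC (v : E -> R) L B : 0 <= L -> (forall x y, `|v x - v y| <= L * nrm (x - y)) ->
  (forall x, `|v x| <= B) -> lipb (fun x => rC (v x)).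
Proof.
move=> L0 hL hB; split; first by apply/lipfP; exists L => //; exact: Lip_rC.
by exists B => x; rewrite cabs_rC.
Qed.

Lemma Phi_cst f c : J f -> Phi f (fun=> c) = 0.
Proof.
move=> hf; apply: (@Philoc f _ c setT) => //; [exact: lipb_cst|exact: openT].
Qed.

(** On a cell where [v] is within [e] of the constant [c], the terms linear in
    [v - c] cancel and [(v - c)^2] has Lipschitz constant [O(e L)]; [clip] makes
    this bound global. *)
Lemma defect_cell f (v : E -> R) (L B e c : R) : 0 <= L -> 0 < e ->
  (forall x y, `|v x - v y| <= L * nrm (x - y)) -> (forall x, `|v x| <= B) ->
  J f -> (forall x, f x != 0 -> `|v x - c| <= e) ->
  cabs (defect f v) <= 8 * e * L * K * mint mu (fun x => cabs (f x)).
Proof.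
move=> L0 e0 hL hB Jf supf.
have lv : lipb (fun x => rC (v x)) := lipb_rC L0 hL hB.
pose w x : C := rC (v x) - rC c.
have lw : lipb w by apply: lipbB => //; exact: lipb_cst.
pose z x : C := rC (clip (2 * e) (v x - c)).
have e20 : 0 <= 2 * e by lra.
have Lz : Lip L z.
  apply: Lip_rC => x y; apply: le_trans (clip_lip _ _ _) _.
  by rewrite opprB addrA subrK.
have Bz : bnd (2 * e) z by move=> x; rewrite cabs_rC clip_bound.
have lz : lipb z by apply/lipbP; exists L, (2 * e).
have hdef : defect f v = Phi f (fun x => z x * z x) - 2 * Phi (fun x => f x * w x) w.
  have wz : Phi f (fun x => w x * w x) = Phi f (fun x => z x * z x).
    apply/eqP; rewrite -subr_eq0; apply/eqP.
    have := @PhiR (-1) f (fun x => z x * z x) (fun x => w x * w x) Jf (lipbM lz lz) (lipbM lw lw).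
    rewrite mulN1r addrC => <-.
    apply: (@Philoc _ _ 0 [set x | `|v x - c| < 2 * e]) => //.
    - by apply: lipbD; [apply: lipbZ|]; exact: lipbM.
    - have cv : continuous (fun x => v x - c).
        by apply: (@real_lip_continuous _ _ _ L) => x y; rewrite opprB addrA subrK.
      have := @open_comp _ _ (fun x => `|v x - c|) [set s | s < 2 * e] _ (@open_lt _ _).
      apply => x _; exact: (cvg_norm (cv x)).
    - have cl : closed [set x | `|v x - c| <= e].
        have cv : continuous (fun x => v x - c).
          by apply: (@real_lip_continuous _ _ _ L) => x y; rewrite opprB addrA subrK.
        have := @closed_comp _ _ (fun x => `|v x - c|) [set s | s <= e] _ (@closed_le _ _).
        apply => x _; exact: (cvg_norm (cv x)).
      apply: subset_trans (fsupp_sub cl supf) _ => x /= h.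
      by apply: le_lt_trans h _; rewrite ltr_pMl// ltr1n.
    - move=> x /= h; rewrite /z clip_id ?(ltW h)// /w rCD rCN; ring.
  have e1 : Phi f (fun x => rC (v x) * rC (v x)) = Phi f (fun x => w x * w x) + 2 * rC c * Phi f w.
    rewrite (_ : (fun x => rC (v x) * rC (v x)) =
        fun x => (2 * rC c) * w x + (1 * (w x * w x) + rC c * rC c)); last first.
      by apply/funext => x; rewrite /w; ring.
    rewrite PhiR//; last by apply: lipbD; [apply: lipbZ; exact: lipbM|exact: lipb_cst].
    rewrite PhiR//; [|exact: lipbM|exact: lipb_cst].
    by rewrite Phi_cst//; ring.
  have e2 : Phi (fun x => f x * rC (v x)) (fun x => rC (v x)) =
      Phi (fun x => f x * w x) w + rC c * Phi f w.
    rewrite (_ : Phi _ _ = Phi (fun x => rC c * f x + f x * w x) (fun x => 1 * w x + rC c)); last first.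
      by congr Phi; apply/funext => x; rewrite /w; ring.
    rewrite PhiL//; [|exact: JM|by apply: lipbD; [exact: lipbZ|exact: lipb_cst]].
    rewrite !PhiR//; [|exact: JM|exact: lipb_cst|exact: lipb_cst].
    by rewrite !Phi_cst//; [ring|exact: JM].
  by rewrite /defect e1 e2 wz; ring.
rewrite hdef /=.
have I0 : 0 <= mint mu (fun x => cabs (f x)) by exact: mint_cabs_ge0.
have b1 : cabs (Phi f (fun x => z x * z x)) <= K * (2 * e * L + 2 * e * L) * mint mu (fun x => cabs (f x)).
  apply: PhiM => //; [exact: lipbM|by rewrite addr_ge0// mulr_ge0|].
  exact: LipM.
have Lw : Lip L w.
  by move=> x y; rewrite /w opprB addrA subrK -rCN -rCD cabs_rC.
have b2 : cabs (Phi (fun x => f x * w x) w) <= K * L * (e * mint mu (fun x => cabs (f x))).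
  apply: le_trans (PhiM _ _ L0 Lw) _ => //; first exact: JM.
  rewrite ler_wpM2l ?mulr_ge0// -mintZ//; last by apply: cbnd_cabs; exact: Jlip.
  apply: mint_le => //.
  - by apply: cbnd_cabs; apply: Jlip; exact: JM.
  - by apply: cbndZ; apply: cbnd_cabs; exact: Jlip.
  - move=> x; rewrite cabsM mulrC; have [->|fx] := eqVneq (f x) 0; first by rewrite cabs0 !mulr0.
    by rewrite ler_wpM2r ?cabs_ge0// /w -rCN -rCD cabs_rC; exact: supf.
apply: le_trans (cabsD _ _) _; rewrite cabsN cabsM (_ : cabs 2 = 2); last exact: cabs_nat.
apply: le_trans (lerD b1 (ler_wpM2l _ b2)) _ => //.
by rewrite [leRHS](_ : _ = K * (2 * e * L + 2 * e * L) * mint mu (fun x => cabs (f x)) + 4 * (K * L * (e * mint mu (fun x => cabs (f x))))); [rewrite lerD2l ler_wpM2r ?ler_nat// !mulr_ge0// ltW|ring].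
Qed.

Lemma defectD f g (v : E -> R) : lipb (fun x => rC (v x)) -> J f -> J g ->
  defect (fun x => f x + g x) v = defect f v + defect g v.
Proof.
move=> lv Jf Jg; rewrite /defect /=.
rewrite (_ : (fun x => f x + g x) = fun x => 1 * f x + g x); last first.
  by apply/funext => x; rewrite mul1r.
rewrite (_ : (fun x => (f x + g x) * rC (v x)) =
   fun x => 1 * (f x * rC (v x)) + g x * rC (v x)); last first.
  by apply/funext => x; rewrite mul1r mulrDl.
have lvv := lipbM lv lv; have Jfv := JM Jf lv; have Jgv := JM Jg lv.
rewrite (PhiL 1 Jf Jg lvv) (PhiL 1 Jfv Jgv lv). ring.
Qed.

Lemma Phi_0l u : lipb u -> Phi (fun=> 0) u = 0.
Proof.
move=> lu; transitivity (Phi (fun x : E => -1 * 0 + 0) u).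
  by congr Phi; apply/funext => x; rewrite mulr0 addr0.
by rewrite [LHS](PhiL (-1) J0 J0 lu) mulN1r addNr.
Qed.

Lemma defect0_fun (v : E -> R) : lipb (fun x => rC (v x)) -> defect (fun=> 0) v = 0.
Proof.
move=> lv; rewrite /defect Phi_0l; last exact: lipbM.
rewrite (_ : (fun x => 0 * rC (v x)) = fun=> 0); last by apply/funext => x; rewrite mul0r.
by rewrite Phi_0l// mulr0 subr0.
Qed.

Lemma defect_sum (v : E -> R) N (F : nat -> E -> C) : lipb (fun x => rC (v x)) ->
  (forall m, J (F m)) ->
  J (fun x => \sum_(m < N) F m x) /\
  defect (fun x => \sum_(m < N) F m x) v = \sum_(m < N) defect (F m) v.
Proof.
move=> lv JF; elim: N => [|N [ih1 ih2]].
  rewrite big_ord0 (_ : (fun x => _) = fun=> 0); last by apply/funext => x; rewrite big_ord0.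
  by split => //; exact: defect0_fun.
rewrite (_ : (fun x => \sum_(m < N.+1) F m x) = fun x => \sum_(m < N) F m x + F N x); last first.
  by apply/funext => x; rewrite big_ord_recr.
by rewrite big_ord_recr/= -ih2 defectD//; split => //; exact: JD.
Qed.

(** The cells of size [e] cover [f] by a partition of unity [chi], so the masses
    of the pieces add up and the defect is [O(e)]. *)
Lemma defect_eq0 f (v : E -> R) (L B : R) : 0 <= L ->
  (forall x y, `|v x - v y| <= L * nrm (x - y)) -> (forall x, `|v x| <= B) ->
  J f -> defect f v = 0.
Proof.
move=> L0 hL hB Jf.
have lv : lipb (fun x => rC (v x)) := lipb_rC L0 hL hB.
have I0 : 0 <= mint mu (fun x => cabs (f x)) by exact: mint_cabs_ge0.
apply/eqP; rewrite -cabs_eq0 eq_le cabs_ge0 andbT; apply/ler_addgt0Pr => e' e'0; rewrite add0r.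
set I := mint mu (fun x => cabs (f x)) in I0 *.
pose e := e' / (8 * L * K * I + 1).
have d0 : 0 < 8 * L * K * I + 1 by rewrite ltr_wpDl// !mulr_ge0.
have e0 : 0 < e by rewrite divr_gt0.
suff h : cabs (defect f v) <= 8 * e * L * K * I.
  have ee : e' = e * (8 * L * K * I + 1) by rewrite /e divfK// gt_eqF.
  apply: le_trans h _; rewrite ee mulrDr mulr1.
  by rewrite (_ : e * _ = 8 * e * L * K * I); [rewrite lerDl ltW|ring].
pose th m x := clip01 ((v x + B + e) / e - m%:R).
pose chi m x := th m x - th m.+1 x.
have th_lip m x y : `|th m x - th m y| <= L / e * nrm (x - y).
  apply: le_trans (clip01_lip _ _) _.
  rewrite opprB addrA subrK -mulrBl normrM (gtr0_norm (_ : 0 < e^-1)) ?invr_gt0//.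
  rewrite mulrAC ler_pM2r ?invr_gt0// (_ : _ - _ = v x - v y); last by ring.
  exact: hL.
have chi_ge0 m x : 0 <= chi m x.
  by rewrite subr_ge0 clip01_mono// lerD2l lerN2 ler_nat.
have lchi m : lipb (fun x => rC (chi m x)).
  apply: (@lipb_rC _ (L / e + L / e) 2).
  - by rewrite addr_ge0// divr_ge0// ltW.
  - move=> x y; rewrite mulrDl (_ : chi m x - chi m y =
      (th m x - th m y) + (th m.+1 y - th m.+1 x)); last by rewrite /chi; ring.
    apply: le_trans (ler_normD _ _) _; apply: lerD; first exact: th_lip.
    by rewrite distrC; exact: th_lip.
  - move=> x; have := clip01_ge0 ((v x + B + e) / e - m%:R).
    have := clip01_ge0 ((v x + B + e) / e - m.+1%:R).
    have := clip01_le1 ((v x + B + e) / e - m%:R).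
    have := clip01_le1 ((v x + B + e) / e - m.+1%:R).
    rewrite -/(th m x) -/(th m.+1 x) => h1 h2 h3 h4.
    by rewrite /chi ler_norml; apply/andP; split; lra.
have chi_supp m x : chi m x != 0 -> `|v x - (m%:R * e - B)| <= e.
  move=> h; rewrite ler_norml; apply/andP; split; rewrite leNgt; apply/negP => hh;
    move/negP: h; apply; apply/eqP.
  + have h1 : (v x + B + e) / e <= m%:R by rewrite ler_pdivrMr//; lra.
    have h2 : (v x + B + e) / e <= m.+1%:R by rewrite (le_trans h1)// ler_nat.
    by rewrite /chi /th !clip01_0 ?subr_le0// subrr.
  + have h1 : 1 + m.+1%:R <= (v x + B + e) / e.
      by rewrite ler_pdivlMr// -natr1 !mulrDl !mul1r; lra.
    have h2 : 1 + m%:R <= (v x + B + e) / e.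
      by rewrite (le_trans _ h1)// lerD2l ler_nat.
    by rewrite /chi /th !clip01_1 ?lerBrDr// subrr.
pose N := (Num.truncn ((2 * B + e) / e)).+1.
have B0 : 0 <= B by exact: le_trans (normr_ge0 _) (hB 0).
have chi1 x : \sum_(m < N) chi m x = 1.
  have tele n : \sum_(m < n) chi m x = th 0 x - th n x.
    elim: n => [|n ih]; first by rewrite big_ord0 subrr.
    by rewrite big_ord_recr /= ih /chi; ring.
  have := hB x; rewrite ler_norml => /andP[hB1 hB2].
  rewrite tele /th clip01_1; last by rewrite subr0 ler_pdivlMr// mul1r; lra.
  rewrite clip01_0 ?subr0// subr_le0.
  apply: (@le_trans _ _ ((2 * B + e) / e)); last by apply/ltW; exact: truncnS_gt.
  by rewrite ler_pM2r ?invr_gt0//; lra.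
have Jfc m : J (fun x => f x * rC (chi m x)) by exact: JM.
have [_ hsum] := @defect_sum v N (fun m x => f x * rC (chi m x)) lv Jfc.
have fE : f = fun x => \sum_(m < N) f x * rC (chi m x).
  apply/funext => x; rewrite -mulr_sumr.
  rewrite (_ : \sum_(m < N) rC (chi m x) = 1) ?mulr1//.
  by rewrite -[RHS]/(rC 1) -(chi1 x); apply/esym/(rmorph_sum (@real_complex R)).
rewrite [X in defect X v]fE hsum; apply: le_trans (cabs_sum _ _ _) _.
have IE : I = \sum_(m < N) mint mu (fun x => cabs (f x * rC (chi m x))).
  rewrite -mint_sum//; last by move=> m; apply: cbnd_cabs; exact: Jlip.
  congr mint; apply/funext => x.
  under eq_bigr do rewrite cabsM cabs_rC ger0_norm//.
  by rewrite -mulr_sumr chi1 mulr1.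
rewrite IE mulr_sumr; apply: ler_sum => m _.
apply: (@defect_cell _ v L B e (m%:R * e - B)) => // x hx.
apply: chi_supp; apply: contraNneq hx => ->; by rewrite rC0 mulr0.
Qed.

Lemma Phi_leibniz_real f (v w : E -> R) (L B : R) : 0 <= L ->
  (forall x y, `|v x - v y| <= L * nrm (x - y)) -> (forall x, `|v x| <= B) ->
  (forall x y, `|w x - w y| <= L * nrm (x - y)) -> (forall x, `|w x| <= B) ->
  J f -> Phi f (fun x => rC (v x) * rC (w x)) =
    Phi (fun x => f x * rC (v x)) (fun x => rC (w x)) +
    Phi (fun x => f x * rC (w x)) (fun x => rC (v x)).
Proof.
move=> L0 hL hB hL' hB' Jf.
have lv : lipb (fun x => rC (v x)) := lipb_rC L0 hL hB.
have lw : lipb (fun x => rC (w x)) := lipb_rC L0 hL' hB'.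
have dv := defect_eq0 L0 hL hB Jf; have dw := defect_eq0 L0 hL' hB' Jf.
move: dv dw; rewrite /defect => dv dw.
have : defect f (fun x => v x + w x) = 0.
  apply: (@defect_eq0 _ _ (L + L) (B + B)) => //; first by rewrite addr_ge0.
    move=> x y; rewrite opprD addrACA mulrDl.
    by apply: le_trans (ler_normD _ _) _; apply: lerD.
  by move=> x; apply: le_trans (ler_normD _ _) _; apply: lerD.
rewrite /defect (_ : (fun x => rC (v x + w x) * rC (v x + w x)) = fun x =>
   2 * (rC (v x) * rC (w x)) + (1 * (rC (v x) * rC (v x)) + rC (w x) * rC (w x))); last first.
  by apply/funext => x; rewrite rCD; ring.
rewrite (_ : (fun x => rC (v x + w x)) = fun x => 1 * rC (v x) + rC (w x)); last first.
  by apply/funext => x; rewrite rCD mul1r.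
rewrite (_ : (fun x => f x * rC (v x + w x)) = fun x => 1 * (f x * rC (v x)) + f x * rC (w x)); last first.
  by apply/funext => x; rewrite rCD; ring.
rewrite PhiR//; [|exact: lipbM|by apply: lipbD; [apply: lipbZ|]; exact: lipbM].
rewrite PhiR//; [|exact: lipbM..].
rewrite PhiL//; [|exact: JM..|by apply: lipbD => //; exact: lipbZ].
rewrite !PhiR//; [|exact: JM..].
move/eqP: dv; rewrite subr_eq0 => /eqP ->.
move/eqP: dw; rewrite subr_eq0 => /eqP ->.
move=> h; apply: (@mulfI _ (2 : C)); first by rewrite pnatr_eq0.
by apply/eqP; rewrite -subr_eq0 -h; apply/eqP; ring.
Qed.

Lemma real_imag_lipb (u : E -> C) : lipb u -> exists v w L B,
  [/\ 0 <= L, u = fun x => rC (v x) + Complex 0 1 * rC (w x),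
    (forall x y, `|v x - v y| <= L * nrm (x - y)) /\ (forall x, `|v x| <= B) &
    (forall x y, `|w x - w y| <= L * nrm (x - y)) /\ (forall x, `|w x| <= B)].
Proof.
move=> /lipbP[L [B [L0 B0 hL hB]]].
exists (fun x => complex.Re (u x)), (fun x => complex.Im (u x)), L, B; split => //.
- by apply/funext => x; case: (u x) => a b; rewrite /rC; simpc.
- split=> [x y|x]; last exact: le_trans (cabs_Re _) (hB x).
  apply: le_trans (hL x y).
  by rewrite (_ : _ - _ = complex.Re (u x - u y)) ?cabs_Re//; case: (u x) (u y) => ? ? [].
- split=> [x y|x]; last exact: le_trans (cabs_Im _) (hB x).
  apply: le_trans (hL x y).
  by rewrite (_ : _ - _ = complex.Im (u x - u y)) ?cabs_Im//; case: (u x) (u y) => ? ? [].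
Qed.

Lemma Phi_leibniz f u v : J f -> lipb u -> lipb v ->
  Phi f (fun x => u x * v x) = Phi (fun x => f x * u x) v + Phi (fun x => f x * v x) u.
Proof.
move=> Jf /real_imag_lipb[a [b [L1 [B1 [L10 -> [ha1 ha2] [hb1 hb2]]]]]].
move=> /real_imag_lipb[c [d [L2 [B2 [L20 -> [hc1 hc2] [hd1 hd2]]]]]].
pose L := L1 + L2; pose B := `|B1| + `|B2|.
have wL (z : E -> R) l : l <= L -> (forall x y, `|z x - z y| <= l * nrm (x - y)) ->
    forall x y, `|z x - z y| <= L * nrm (x - y).
  by move=> lL h x y; apply: le_trans (h x y) _; rewrite ler_wpM2r// nrm_ge0.
have wB (z : E -> R) l : l <= B -> (forall x, `|z x| <= l) -> forall x, `|z x| <= B.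
  by move=> lB h x; exact: le_trans (h x) _.
have L1L : L1 <= L by rewrite lerDl.
have L2L : L2 <= L by rewrite lerDr.
have B1B : B1 <= B by apply: le_trans (ler_norm _) _; rewrite lerDl.
have B2B : B2 <= B by apply: le_trans (ler_norm _) _; rewrite lerDr.
have {}ha1 := wL _ _ L1L ha1; have {}hb1 := wL _ _ L1L hb1.
have {}hc1 := wL _ _ L2L hc1; have {}hd1 := wL _ _ L2L hd1.
have {}ha2 := wB _ _ B1B ha2; have {}hb2 := wB _ _ B1B hb2.
have {}hc2 := wB _ _ B2B hc2; have {}hd2 := wB _ _ B2B hd2.
have L0 : 0 <= L by rewrite addr_ge0.
have la := lipb_rC L0 ha1 ha2; have lb := lipb_rC L0 hb1 hb2.
have lc := lipb_rC L0 hc1 hc2; have ld := lipb_rC L0 hd1 hd2.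
have ac := Phi_leibniz_real L0 ha1 ha2 hc1 hc2 Jf.
have ad := Phi_leibniz_real L0 ha1 ha2 hd1 hd2 Jf.
have bc := Phi_leibniz_real L0 hb1 hb2 hc1 hc2 Jf.
have bd := Phi_leibniz_real L0 hb1 hb2 hd1 hd2 Jf.
set i : C := Complex 0 1.
have i2 : i * i = -1 by rewrite /i; simpc.
pose fa x := f x * rC (a x); pose fb x := f x * rC (b x).
pose fc x := f x * rC (c x); pose fd x := f x * rC (d x).
have [Ja Jb Jc Jd] : [/\ J fa, J fb, J fc & J fd] by split; exact: JM.
rewrite (_ : (fun x => f x * (rC (a x) + i * rC (b x))) = fun x => i * fb x + fa x); last first.
  by apply/funext => x; rewrite /fa /fb; ring.
rewrite (_ : (fun x => f x * (rC (c x) + i * rC (d x))) = fun x => i * fd x + fc x); last first.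
  by apply/funext => x; rewrite /fc /fd; ring.
rewrite (_ : (fun x => rC (a x) + i * rC (b x)) = fun x => i * rC (b x) + rC (a x)); last first.
  by apply/funext => x; rewrite addrC.
rewrite (_ : (fun x => rC (c x) + i * rC (d x)) = fun x => i * rC (d x) + rC (c x)); last first.
  by apply/funext => x; rewrite addrC.
have -> : (fun x => (rC (a x) + i * rC (b x)) * (rC (c x) + i * rC (d x))) = fun x =>
   i * (rC (a x) * rC (d x)) + (i * (rC (b x) * rC (c x)) +
    ((-1) * (rC (b x) * rC (d x)) + rC (a x) * rC (c x))).
  apply/funext => x; rewrite -i2; ring.
rewrite !PhiL//; [|by apply: lipbD => //; exact: lipbZ..].
rewrite !PhiR//; try exact: lipbM; try (by apply: lipbD; [apply: lipbZ; exact: lipbM|exact: lipbM]);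
 last first.
  by apply: lipbD; [apply: lipbZ; exact: lipbM|apply: lipbD; [apply: lipbZ; exact: lipbM|exact: lipbM]].
by rewrite ac ad bc bd -/fa -/fb -/fc -/fd -i2; ring.
Qed.

End Leibniz.

(** * Closed currents of bidimension (0,k) as alternating functionals *)

Section Families.
Variables (R : realType) (E : normedModType (Cplx R)).
Local Notation C := (Cplx R).
Local Notation fam := (nat -> E -> C).

(* A test form [(f, pi_1, .., pi_k)] is a family [nat -> E -> C] of which only the
   entries [0 .. k] matter. *)
Definition upd (p : fam) (j : nat) (u : E -> C) : fam :=
  fun i => if i == j then u else p i.

Definition allb (p : fam) := forall i, lipb (p i).

Lemma upd_same p j u : upd p j u j = u.
Proof. by rewrite /upd eqxx. Qed.

Lemma upd_other p j u i : i != j -> upd p j u i = p i.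
Proof. by rewrite /upd => /negbTE ->. Qed.

Lemma upd_id p j : upd p j (p j) = p.
Proof. by apply/funext => i; rewrite /upd; case: eqP => [->|]. Qed.

Lemma upd_upd p j u v : upd (upd p j u) j v = upd p j v.
Proof. by apply/funext => i; rewrite /upd; case: eqP. Qed.

Lemma updC p i j u v : i != j -> upd (upd p i u) j v = upd (upd p j v) i u.
Proof.
move=> ij; apply/funext => l; rewrite /upd; case: eqP => [->|//].
by rewrite eq_sym (negbTE ij).
Qed.

Lemma allb_upd p j u : allb p -> lipb u -> allb (upd p j u).
Proof. by move=> hp hu i; rewrite /upd; case: eqP. Qed.

Definition slot (T : (E -> C) -> seq (E -> C) -> C) (k : nat) (p : fam) : C :=
  T (p 0%N) (mkseq (fun i => p i.+1) k).

Section Slot.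
Variables (k : nat) (T : (E -> C) -> seq (E -> C) -> C).
Variables (mu : {measure set (Bor E) -> \bar R}) (muT : (mu setT < +oo)%E).
Hypothesis Tlin : AK_multilinear k T.
Hypothesis Tloc : AK_local k T.
Hypothesis Tmass : AK_mass_bound k T mu.
Hypothesis Thol : AK_bidim 0 k k T.
Hypothesis Tclosed : dbar_zero_0k k T.

Local Notation tau := (slot T k).

Lemma slot_form p : allb p -> AK_form k (p 0%N) (mkseq (fun i => p i.+1) k).
Proof.
move=> hp; split; first exact: hp.
rewrite size_mkseq; split=> // j jk; rewrite /ent nth_mkseq//.
by have [] := hp j.+1.
Qed.

Lemma slot_ext p q : (forall i, (i <= k)%N -> p i = q i) -> tau p = tau q.
Proof.
move=> h; rewrite /slot h//; congr T; apply/eq_in_map => i.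
by rewrite mem_iota add0n => /andP[_ ik]; exact: h.
Qed.

Lemma mkseq_upd p j u : (j < k)%N ->
  mkseq (fun i => upd p j.+1 u i.+1) k =
  set_nth (fun _ => 0) (mkseq (fun i => p i.+1) k) j u.
Proof.
move=> jk; apply: (@eq_from_nth _ (fun _ => 0)).
  by rewrite size_set_nth !size_mkseq (maxn_idPr _).
move=> i; rewrite size_mkseq => ik.
by rewrite nth_set_nth /= !nth_mkseq// /upd eqSS; case: eqP.
Qed.

Lemma slot_lin p j a u v : (j <= k)%N -> allb p -> lipb u -> lipb v ->
  tau (upd p j (fun x => a * u x + v x)) = a * tau (upd p j u) + tau (upd p j v).
Proof.
move=> jk hp hu hv; have [Tl1 Tl2] := Tlin.
case: j jk => [_|j jk].
  have fu := slot_form (allb_upd 0 hp hu); have fv := slot_form (allb_upd 0 hp hv).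
  exact: Tl1.
have fu := slot_form (allb_upd j.+1 hp hu); have fv := slot_form (allb_upd j.+1 hp hv).
rewrite /slot !mkseq_upd// in fu fv *.
exact: (Tl2 a _ _ j u v jk fu fv).
Qed.

Lemma slot_mass0 p (L : nat -> R) : allb p ->
  (forall i, 0 <= L i) -> (forall i, Lip (L i) (p i)) ->
  cabs (tau p) <= (\prod_(i < k) L i.+1) * mint mu (fun x => cabs (p 0%N x)).
Proof.
move=> hp L0 hL; have [_ hm] := Tmass.
have := hm _ _ (slot_form hp) (fun j => rC (L j.+1)) _.
rewrite mintE//; last exact: cbnd_cabs.
rewrite -EFinM lee_fin => h; apply: le_trans (h _) _.
  by move=> j jk; rewrite /ent nth_mkseq//; exact: Lip_lipschitz.
apply: ler_wpM2r; first exact: mint_cabs_ge0.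
apply: eq_imp_le.
by apply: eq_bigr => i _; rewrite cabs_rC ger0_norm.
Qed.

Lemma slot_loc0 p i (V : set E) c : allb p -> (0 < i <= k)%N -> open V ->
  fsupp (p 0%N) `<=` V -> (forall x, V x -> p i x = c) -> tau p = 0.
Proof.
case: i => // i hp /andP[_ ik] oV sV hc.
apply: Tloc; first exact: slot_form.
exists i; rewrite size_mkseq; split=> //; exists V, c; split => //; split => // x Vx.
by rewrite /ent nth_mkseq//; exact: hc.
Qed.

Lemma slot_hol0 p i : allb p -> (0 < i <= k)%N ->
  holo_near (p i) (fsupp (p 0%N)) -> tau p = 0.
Proof.
case: i => // i hp /andP[_ ik] hol.
apply: Thol; first exact: slot_form.
left; rewrite -has_count; apply/hasP; exists (p i.+1); last exact/asboolP.
by apply/mapP; exists i => //; rewrite mem_iota.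
Qed.

Lemma slot_closed p : (0 < k)%N -> allb p -> tau (upd p 0 (fun=> 1)) = 0.
Proof.
move=> k0 hp; rewrite /slot upd_same.
have -> : mkseq (fun i => upd p 0 (fun=> 1) i.+1) k = p 1%N :: mkseq (fun i => p i.+2) k.-1.
  rewrite -[in LHS](prednK k0) /mkseq /= -(addn0 1%N) iotaDl -map_comp.
  by congr cons; apply: eq_map.
apply: (Tclosed k0); split; first exact: hp.
rewrite size_mkseq; split=> // j jk; rewrite /ent nth_mkseq//.
by have [] := hp j.+2.
Qed.

Lemma lip_consts p : allb p -> exists L : nat -> R,
  (forall i, 0 <= L i) /\ (forall i, Lip (L i) (p i)).
Proof.
move=> hp; have /choice[L hL] : forall i, exists L, 0 <= L /\ Lip L (p i).
  by move=> i; have [/lipfP[L L0 h] _] := hp i; exists L.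
by exists L; split => i; have [] := hL i.
Qed.

Lemma slot_leibniz0 p j f u v : (0 < j <= k)%N -> allb p -> lipb f -> lipb u -> lipb v ->
  tau (upd (upd p 0 f) j (fun x => u x * v x)) =
  tau (upd (upd p 0 (fun x => f x * u x)) j v) + tau (upd (upd p 0 (fun x => f x * v x)) j u).
Proof.
move=> /andP[j0 jk] hp hf hu hv.
have j0' : 0%N != j by rewrite neq_ltn j0.
have j0'' : j != 0%N by rewrite eq_sym.
have [L [L0 hL]] := lip_consts hp.
pose K := \prod_(i < k | i.+1 != j) L i.+1.
apply: (@Phi_leibniz _ _ mu muT (@lipb _ E) (fun f u => tau (upd (upd p 0 f) j u)) K) => //.
- exact: lipb_cst.
- by move=> ? ?; exact: lipbM.
- by move=> ? ?; exact: lipbD.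
- by move=> a f1 g1 w hf1 hg1 hw; rewrite !(updC p _ _ j0') slot_lin//; exact: allb_upd.
- by move=> a f1 g1 w hf1 hg1 hw; rewrite slot_lin//; exact: allb_upd.
- move=> f1 w c V hf1 hw oV sV hc.
  apply: (@slot_loc0 _ j V c) => //; [by apply: allb_upd => //; exact: allb_upd|by rewrite j0| |].
    by rewrite upd_other// upd_same.
  by move=> x Vx; rewrite upd_same; exact: hc.
- by apply: prodr_ge0.
- move=> f1 w l hf1 hw l0 hl.
  have hq : allb (upd (upd p 0 f1) j w) by apply: allb_upd => //; exact: allb_upd.
  have [M [M0 [_ hM]]] : exists M, 0 <= M /\ (lipb f1 /\ Lip M f1).
    by have [/lipfP[M M0 hM] _] := hf1; exists M.
  pose L' i := if i == j then l else if i == 0%N then M else L i.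
  have := @slot_mass0 (upd (upd p 0 f1) j w) L' hq.
  rewrite [in X in _ -> _ -> _ <= _ * X]/upd (negbTE j0')/=.
  move=> h; apply: le_trans (h _ _) _.
  + by move=> i; rewrite /L'; case: eqP => // _; case: eqP.
  + by move=> i; rewrite /L' /upd; case: eqP => // _; case: eqP.
  + apply: ler_wpM2r; first exact: mint_cabs_ge0.
    have jk' : (j.-1 < k)%N by rewrite prednK.
    rewrite (bigD1 (Ordinal jk'))//= /L' prednK// eqxx mulrC.
    apply: eq_imp_le; congr (_ * _).
    rewrite /K; apply: eq_big => [i|i].
      by rewrite -(inj_eq val_inj)/= -eqSS prednK.
    by rewrite -(inj_eq val_inj)/= -eqSS prednK// => /negbTE ->.
Qed.

(** Leibniz applied to [T(1, .., p_0 p_j, ..)], which vanishes since [dT = 0]. *)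
Lemma slot_swap p j : (0 < j <= k)%N -> allb p ->
  tau p = - tau (upd (upd p 0 (p j)) j (p 0%N)).
Proof.
move=> jk hp; have /andP[j0 jk'] := jk.
have k0 : (0 < k)%N by apply: leq_trans j0 jk'.
have j0' : 0%N != j by rewrite neq_ltn j0.
have := @slot_leibniz0 p j (fun=> 1) (p 0%N) (p j) jk hp (lipb_cst _ _) (hp _) (hp _).
rewrite updC// slot_closed//; last by apply: allb_upd => //; exact: lipbM.
rewrite (_ : (fun x => 1 * p 0%N x) = p 0%N); last by apply/funext => x; rewrite mul1r.
rewrite (_ : (fun x => 1 * p j x) = p j); last by apply/funext => x; rewrite mul1r.
by rewrite !upd_id => /esym/eqP; rewrite addr_eq0 => /eqP.
Qed.

End Slot.
End Families.

Section Alternating.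
Variables (R : realType) (E : normedModType (Cplx R)).
Local Notation C := (Cplx R).
Local Notation fam := (nat -> E -> C).

Record slot_functional (k : nat) (mu : {measure set (Bor E) -> \bar R}) (tau : fam -> C) : Prop := {
  sf_ext : forall p q, (forall i, (i <= k)%N -> p i = q i) -> tau p = tau q;
  sf_lin : forall p j a u v, (j <= k)%N -> allb p -> lipb u -> lipb v ->
    tau (upd p j (fun x => a * u x + v x)) = a * tau (upd p j u) + tau (upd p j v);
  sf_mass : forall p j (L : nat -> R), (j <= k)%N -> allb p ->
    (forall i, 0 <= L i) -> (forall i, i != j -> Lip (L i) (p i)) ->
    cabs (tau p) <= (\prod_(i < k.+1 | i != j :> nat) L i) * mint mu (fun x => cabs (p j x));
  sf_holo : forall p i j, (i <= k)%N -> (j <= k)%N -> i != j -> allb p ->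
    holo_near (p i) (fsupp (p j)) -> tau p = 0;
  sf_leibniz : forall p i j f g h, (i <= k)%N -> (j <= k)%N -> i != j -> allb p ->
    lipb f -> lipb g -> lipb h ->
    tau (upd (upd p i g) j (fun x => f x * h x)) =
    tau (upd (upd p i (fun x => g x * f x)) j h) + tau (upd (upd p i (fun x => g x * h x)) j f)
}.

Section Slot.
Variables (k : nat) (T : (E -> C) -> seq (E -> C) -> C).
Variables (mu : {measure set (Bor E) -> \bar R}) (muT : (mu setT < +oo)%E).
Hypothesis Tlin : AK_multilinear k T.
Hypothesis Tloc : AK_local k T.
Hypothesis Tmass : AK_mass_bound k T mu.
Hypothesis Thol : AK_bidim 0 k k T.
Hypothesis Tclosed : dbar_zero_0k k T.

Local Notation tau := (slot T k).

Lemma slot_swap2 p j u v : (0 < j <= k)%N -> allb p -> lipb u -> lipb v ->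
  tau (upd (upd p 0 u) j v) = - tau (upd (upd p 0 v) j u).
Proof.
move=> jk hp hu hv; have j0 : 0%N != j by rewrite neq_ltn; case/andP: jk => ->.
rewrite (slot_swap muT Tlin Tloc Tmass Tclosed jk); last by apply: allb_upd => //; exact: allb_upd.
rewrite upd_same upd_other// upd_same; congr (- tau _).
by apply/funext => i; rewrite /upd; case: (i == j) => //; case: (i == 0)%N.
Qed.

Lemma slot_mass p j (L : nat -> R) : (j <= k)%N -> allb p ->
    (forall i, 0 <= L i) -> (forall i, i != j -> Lip (L i) (p i)) ->
    cabs (tau p) <= (\prod_(i < k.+1 | i != j :> nat) L i) * mint mu (fun x => cabs (p j x)).
Proof.
move=> jk hp L0 hL.
have [Lj Lj0 hLj] : exists2 l, 0 <= l & Lip l (p j).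
  by have [/lipfP] := hp j.
pose L1 i := if i == j then Lj else L i.
have L10 i : 0 <= L1 i by rewrite /L1; case: eqP.
have hL1 i : Lip (L1 i) (p i) by rewrite /L1; case: eqVneq => [->|/hL].
have [j0|j0] := posnP j.
  subst j.
  apply: le_trans (slot_mass0 muT Tmass hp L10 hL1) _.
  rewrite [in leRHS]big_mkcond [in leRHS]big_ord_recl /= mul1r.
  by apply: ler_wpM2r => //; apply: mint_ge0 => x; exact: cabs_ge0.
have jk' : (0 < j <= k)%N by rewrite j0.
rewrite (slot_swap muT Tlin Tloc Tmass Tclosed jk' hp) cabsN.
pose L2 i := if i == j then L1 0%N else if i == 0%N then Lj else L i.
have hq : allb (upd (upd p 0 (p j)) j (p 0%N)) by apply: allb_upd => //; exact: allb_upd.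
have := slot_mass0 muT Tmass hq (L := L2) _ _.
rewrite [X in _ <= _ * X](_ : _ = mint mu (fun x => cabs (p j x))); last first.
  by rewrite updC ?upd_same// neq_ltn j0.
move=> h; apply: le_trans (h _ _) _.
- by move=> i; rewrite /L2; case: eqP => // _; case: eqP.
- move=> i; rewrite /L2 /upd; case: eqP => // /eqP ij; case: eqP => // _.
  exact: hL.
apply: ler_wpM2r; first exact: mint_cabs_ge0.
have jk1 : (j.-1 < k)%N by rewrite prednK.
rewrite (bigD1 (Ordinal jk1))//= /L2 prednK// eqxx.
rewrite [in leRHS]big_mkcond [in leRHS]big_ord_recl /= /L1 neq_ltn j0 /= (_ : (0%N == j) = false); last first.
  by rewrite eq_sym; apply/negbTE; rewrite -lt0n.
apply: eq_imp_le; congr (_ * _).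
rewrite [LHS]big_mkcond; apply: eq_bigr => i _.
rewrite -(inj_eq val_inj)/= -eqSS prednK// /bump /= add1n.
by case: eqVneq.
Qed.

Lemma slot_holo p i j : (i <= k)%N -> (j <= k)%N -> i != j -> allb p ->
    holo_near (p i) (fsupp (p j)) -> tau p = 0.
Proof.
move=> ik jk ij hp hol.
have [j0|j0] := posnP j.
  rewrite j0 in ij hol; apply: (slot_hol0 Thol hp (i := i)) => //.
  by rewrite lt0n ij.
have jk' : (0 < j <= k)%N by rewrite j0.
rewrite (slot_swap muT Tlin Tloc Tmass Tclosed jk' hp).
have j0' : 0%N != j by rewrite neq_ltn j0.
have hq : allb (upd (upd p 0 (p j)) j (p 0%N)) by apply: allb_upd => //; exact: allb_upd.
have q0 : upd (upd p 0 (p j)) j (p 0%N) 0%N = p j by rewrite upd_other// upd_same.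
apply/eqP; rewrite oppr_eq0; apply/eqP.
have [i0|i0] := posnP i.
  apply: (slot_hol0 Thol hq (i := j)) => //; rewrite q0 upd_same.
  by rewrite -i0.
apply: (slot_hol0 Thol hq (i := i)); first by rewrite i0.
by rewrite q0 upd_other// upd_other// -lt0n.
Qed.

Lemma slot_leibniz p i j f g h : (i <= k)%N -> (j <= k)%N -> i != j -> allb p ->
    lipb f -> lipb g -> lipb h ->
    tau (upd (upd p i g) j (fun x => f x * h x)) =
    tau (upd (upd p i (fun x => g x * f x)) j h) + tau (upd (upd p i (fun x => g x * h x)) j f).
Proof.
move=> ik jk ij hp hf hg hh.
have lfh := lipbM hf hh; have lgf := lipbM hg hf; have lgh := lipbM hg hh.
have [i0|i0] := posnP i.
  rewrite i0 in ij *; apply: (slot_leibniz0 muT Tlin Tloc Tmass) => //.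
  by rewrite jk andbT lt0n eq_sym.
have ik' : (0 < i <= k)%N by rewrite i0.
have [j0|j0] := posnP j.
  rewrite j0 in ij *; have ij' : 0%N != i by rewrite eq_sym.
  rewrite !(updC p _ _ ij) (slot_swap2 ik' hp lfh hg) (slot_swap2 ik' hp hh lgf) (slot_swap2 ik' hp hf lgh).
  by rewrite (slot_leibniz0 muT Tlin Tloc Tmass)// opprD.
have j0' : 0%N != j by rewrite neq_ltn j0.
have jk' : (0 < j <= k)%N by rewrite j0.
have key u v : lipb u -> lipb v ->
    tau (upd (upd p i u) j v) = - tau (upd (upd (upd p i (p 0%N)) 0 u) j v).
  move=> hu hv; have hq := allb_upd j hp hv.
  have i0' : i != 0%N by rewrite -lt0n.
  rewrite (updC _ _ _ ij) -{1}(upd_id (upd p j v) 0) (slot_swap2 ik' hq (hq 0%N) hu).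
  congr (- tau _); rewrite upd_other//.
  apply/funext => l; rewrite /upd; case: (eqVneq l i) => [->|li].
    by rewrite (negbTE ij) (negbTE i0').
  by case: (eqVneq l 0%N) => [->|//]; rewrite (negbTE j0').
rewrite !key//.
rewrite (slot_leibniz0 muT Tlin Tloc Tmass)//; last exact: allb_upd.
by rewrite opprD.
Qed.

Lemma slot_is_functional : slot_functional k mu tau.
Proof.
split.
- exact: slot_ext.
- by move=> *; exact: slot_lin.
- exact: slot_mass.
- exact: slot_holo.
- exact: slot_leibniz.
Qed.

End Slot.
End Alternating.

Section Telescope.
Variables (R : realType) (E : normedModType (Cplx R)).
Local Notation C := (Cplx R).
Local Notation fam := (nat -> E -> C).

Definition mix (p q : fam) (j : nat) : fam := fun i => if (i < j)%N then p i else q i.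

Lemma allb_mix p q j : allb p -> allb q -> allb (mix p q j).
Proof. by move=> hp hq i; rewrite /mix; case: ifP. Qed.

Lemma mix_upd_l p q j : upd (mix p q j) j (p j) = mix p q j.+1.
Proof.
by apply/funext => i; rewrite /upd /mix ltnS [in RHS]leq_eqVlt; case: eqVneq => [->|].
Qed.

Lemma mix_upd_r p q j : upd (mix p q j) j (q j) = mix p q j.
Proof.
by apply/funext => i; rewrite /upd /mix; case: eqVneq => [->|//]; rewrite ltnn.
Qed.

Lemma telescope (Psi : fam -> C) k p q :
  (forall p' q', (forall i, (i <= k)%N -> p' i = q' i) -> Psi p' = Psi q') ->
  (forall s j u v, (j <= k)%N -> allb s -> lipb u -> lipb v ->
     Psi (upd s j (fun x => u x - v x)) = Psi (upd s j u) - Psi (upd s j v)) ->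
  allb p -> allb q ->
  Psi p - Psi q = \sum_(j < k.+1) Psi (upd (mix p q j) j (fun x => p j x - q j x)).
Proof.
move=> ext lin hp hq.
have h n : (n <= k.+1)%N -> \sum_(j < n) Psi (upd (mix p q j) j (fun x => p j x - q j x)) =
    Psi (mix p q n) - Psi (mix p q 0).
  elim: n => [|n ih] nk; first by rewrite big_ord0 subrr.
  rewrite big_ord_recr /= ih ?(ltnW nk)// lin//; last exact: allb_mix.
  by rewrite mix_upd_l mix_upd_r addrC addrA subrK.
rewrite h//; congr (_ - _); apply: ext => i ik; rewrite /mix ?ltn0//.
by rewrite ltnS ik.
Qed.

End Telescope.

Section Grid.
Variable R : realType.
Local Notation C := (Cplx R).

Definition grid (M a b : nat) : C := lam (node R M a) (node R M b).

(* [angcoef n r] is chosen so that the radial increment [n (l_r - l)] and the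
   angular one [angcoef n r * (l_t - l)] cancel for [l = lam r t]: a discrete
   [d/d(conj l)]. *)
Definition angcoef (n : nat) (r : R) : C := - (rC r * (cis (n%:R)^-1 - 1))^-1.

Lemma node_shift (n m a : nat) : (0 < n)%N -> (0 < m)%N ->
  node R (n * m) (a + m) = node R (n * m) a + (n%:R)^-1.
Proof.
move=> n0 m0; rewrite /node -addSn natrD mulrDl natrM; congr (_ + _).
by rewrite invfM mulrCA divff ?mulr1// pnatr_eq0 -lt0n.
Qed.

Lemma grid_radial (n m a b : nat) : (0 < n)%N -> (0 < m)%N ->
  grid (n * m) (a + m) b - grid (n * m) a b = rC (n%:R)^-1 * cis (node R (n * m) b).
Proof. by move=> n0 m0; rewrite /grid /lam node_shift// rCD; ring. Qed.

Lemma grid_angular (n m a b : nat) : (0 < n)%N -> (0 < m)%N ->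
  grid (n * m) a (b + m) - grid (n * m) a b =
  rC (node R (n * m) a) * cis (node R (n * m) b) * (cis (n%:R)^-1 - 1).
Proof. by move=> n0 m0; rewrite /grid /lam node_shift// cisD; ring. Qed.

Lemma cabs_grid_radial n m a b : (0 < n)%N -> (0 < m)%N ->
  cabs (grid (n * m) (a + m) b - grid (n * m) a b) = (n%:R)^-1.
Proof.
by move=> n0 m0; rewrite grid_radial// cabsM cabs_cis mulr1 cabs_rC ger0_norm.
Qed.

Lemma cabs_grid_angular n m a b : (0 < n)%N -> (0 < m)%N ->
  cabs (grid (n * m) a (b + m) - grid (n * m) a b) =
  node R (n * m) a * cabs (cis (n%:R)^-1 - 1).
Proof.
move=> n0 m0; rewrite grid_angular// !cabsM cabs_cis mulr1 cabs_rC ger0_norm//.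
by rewrite divr_ge0.
Qed.

Lemma angcoef_le (n m a b : nat) : (0 < n)%N -> (0 < m)%N ->
  cabs (angcoef n (node R (n * m) a)) * cabs (grid (n * m) a (b + m) - grid (n * m) a b) <= 1.
Proof.
move=> n0 m0; rewrite cabs_grid_angular// /angcoef cabsN cabsV cabsM cabs_rC.
rewrite ger0_norm; last by rewrite divr_ge0.
set z := node R _ a * cabs _; have [->|z0] := eqVneq z 0; first by rewrite mulr0.
by rewrite mulVf.
Qed.

Lemma node_ge0 M a : 0 <= node R M a. Proof. by rewrite divr_ge0. Qed.

Lemma node_le (P M a : nat) : (a < P * M)%N -> node R M a <= P%:R.
Proof.
move=> h; have M0 : 0 < M%:R :> R by rewrite ltr0n; case: M h => //; rewrite muln0.
by rewrite ler_pdivrMr// -natrM ler_nat.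
Qed.

Lemma node_gt (P M a : nat) : (0 < M)%N -> (P * M <= a)%N -> P%:R <= node R M a.
Proof.
move=> M0 h; rewrite ler_pdivlMr ?ltr0n// -natrM ler_nat.
exact: leq_trans h _.
Qed.

Lemma cabs_grid_le M a b : cabs (grid M a b) <= 1 + node R M a.
Proof. by apply: le_trans (cabs_lam_le _ _) _; rewrite ger0_norm// node_ge0. Qed.

Lemma cabs_grid_ge M a b : node R M a - 1 <= cabs (grid M a b).
Proof. by apply: le_trans _ (cabs_lam_ge _ _); rewrite ger0_norm// node_ge0. Qed.

End Grid.

Section Cutoff.
Variables (R : realType) (E : normedModType (Cplx R)).
Local Notation C := (Cplx R).
Implicit Types f g : E -> C.

Definition cutoff (r : R) : E -> C := fun x => rC (clip01 (r + 1 - nrm x)).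

Lemma Lip_cutoff r : Lip 1 (cutoff r).
Proof.
apply: Lip_rC => x y; rewrite mul1r; apply: le_trans (clip01_lip _ _) _.
rewrite opprB addrC addrA subrK distrC -[leRHS]/(nrm (x - y)).
by rewrite (_ : _ - _ = nrm x - nrm y) ?nrm_dist//; ring.
Qed.

Lemma cutoff_bnd r : bnd 1 (cutoff r).
Proof. by move=> x; rewrite cabs_rC ger0_norm ?clip01_le1// clip01_ge0. Qed.

Lemma lipb_cutoff r : lipb (cutoff r).
Proof. by apply/lipbP; exists 1, 1; split => //; [exact: Lip_cutoff|exact: cutoff_bnd]. Qed.

Lemma cutoff1 r x : nrm x <= r -> cutoff r x = 1.
Proof. by move=> h; rewrite /cutoff clip01_1 ?rC1//; lra. Qed.

Lemma cutoff0 r x : r + 1 <= nrm x -> cutoff r x = 0.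
Proof. by move=> h; rewrite /cutoff clip01_0 ?rC0//; lra. Qed.

(* The cutoff equals [1] on [supp mu]; it bounds [nrm x], hence the displacement
   [(l' - l) x], on the support of [amp r0 l f]. *)
Definition amp (r0 : R) (l : C) (f : E -> C) : E -> C := fun x => cutoff r0 x * pull l f x.

Lemma lipb_amp r0 l f : lipb f -> lipb (amp r0 l f).
Proof. by move=> hf; apply: lipbM; [exact: lipb_cutoff|exact: lipb_pull]. Qed.

Definition bsupp (rho : R) (f : E -> C) := lipb f /\ forall x, rho <= nrm x -> f x = 0.

Lemma bsuppM rho f g : bsupp rho f -> lipb g -> bsupp rho (fun x => f x * g x).
Proof.
by move=> [hf h] hg; split; [exact: lipbM|move=> x /h ->; rewrite mul0r].
Qed.

Lemma bsupp_lin rho a f g : bsupp rho f -> bsupp rho g -> bsupp rho (fun x => a * f x + g x).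
Proof.
move=> [hf hf0] [hg hg0]; split; first by apply: lipbD => //; exact: lipbZ.
by move=> x hx; rewrite hf0// hg0// mulr0 addr0.
Qed.

Lemma bsupp_le rho rho' f : rho <= rho' -> bsupp rho f -> bsupp rho' f.
Proof. by move=> rr [hf h]; split => // x hx; apply: h; exact: le_trans hx. Qed.

Lemma bsupp_bnd rho L (f : E -> C) : 0 <= rho -> 0 <= L -> Lip L f -> bsupp rho f ->
  bnd (cabs (f 0) + L * rho) f.
Proof.
move=> rho0 L0 hL [_ f0] x; have [xr|xr] := leP rho (nrm x).
  by rewrite f0// cabs0 addr_ge0 ?cabs_ge0// mulr_ge0.
rewrite -[f x](subrK (f 0)) addrC; apply: le_trans (cabsD _ _) _; rewrite lerD2l.
by apply: le_trans (hL _ _) _; rewrite subr0 ler_wpM2l// ltW.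
Qed.

End Cutoff.

Section PolarDCT.
Variables (R : realType) (E : normedModType (Cplx R)).
Local Notation C := (Cplx R).
Variables (mu : {measure set (Bor E) -> \bar R}) (muT : (mu setT < +oo)%E) (P : nat).

Lemma polar_int_cvg0 (phi : nat -> R -> R -> E -> R) (B : R) :
  (forall n r t, cbnd (phi n r t)) -> (forall n r t x, 0 <= phi n r t x) ->
  (forall n r t x, phi n r t x <= B) ->
  (forall n (r t : R) x (r_ t_ : nat -> R), 0 < r ->
    r_ s @[s --> \oo] --> r -> t_ s @[s --> \oo] --> t ->
    phi n (r_ s) (t_ s) x @[s --> \oo] --> phi n r t x) ->
  (forall (r t : R) x, 0 < r -> phi n r t x @[n --> \oo] --> (0 : R)) ->
  polar_int muT P (phi n) @[n --> \oo] --> (0 : R).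
Proof.
move=> cphi phi0 phiB phic lim0.
have B0 : 0 <= B by exact: le_trans (phi0 0%N 0 0 0) (phiB 0%N 0 0 0).
have mcyl := measurable_cyl (E := E) (R := R) P.
have : (\int[prm muT P]_(p in @cyl R E P) (phi n p.1.1 p.1.2 p.2)%:E)%E @[n --> \oo] -->
    (\int[prm muT P]_(p in @cyl R E P) 0%:E)%E.
  apply: (@dominated_cvg _ _ _ (prm muT P) _ mcyl _ _ (EFin \o cst B)) => //.
  - move=> n; apply/measurable_EFinP.
    exact: (measurable_phi (cphi n) (phic n)).
  - move=> p [[p1 _] _]; apply: cvg_EFin; first exact: nearW.
    by apply: lim0; move: p1; rewrite /= in_itv /= => /andP[].
  - exact: cyl_cst_integrable.
  - by move=> n p _ /=; rewrite lee_fin ger0_norm.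
by rewrite integral0 => /fine_cvgP[].
Qed.

End PolarDCT.

Section Differentiable.
Variables (R : realType) (E : normedModType (Cplx R)).
Local Notation C := (Cplx R).

Lemma differentiable_pull (l : C) (g : E -> C) x :
  differentiable g (l *: x) -> differentiable (pull l g) x.
Proof.
move=> h; have : differentiable (g \o (fun z : E => l *: z)) x; last by [].
by apply: differentiable_comp.
Qed.

Lemma derivable_quotient (g : E -> C) y w (z : nat -> C) : differentiable g y ->
  (forall n, z n != 0) -> z n @[n --> \oo] --> (0 : C) ->
  (z n)^-1 * (g (z n *: w + y) - g y) @[n --> \oo] --> 'D_w g y.
Proof.
move=> dg z0 hz.
have /cvg_ex[l hl] : derivable g y w by exact: diff_derivable.
have -> : 'D_w g y = l by exact: cvg_lim hl.
have hz' : z n @[n --> \oo] --> (0 : C)^'.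
  move=> A hA; have : \forall n \near \oo, z n != 0 -> A (z n) by exact: (hz _ hA).
  by apply: filterS => n; apply; exact: z0.
exact: (cvg_comp _ _ hz' hl).
Qed.

End Differentiable.

Section Quotient.
Variables (R : realType) (E : normedModType (Cplx R)).
Local Notation C := (Cplx R).

Lemma lam_radial (r s t : R) : lam (r + s) t - lam r t = rC s * cis t.
Proof. by rewrite /lam rCD; ring. Qed.

Lemma lam_angular (r s t : R) : lam r (t + s) - lam r t = rC r * cis t * (cis s - 1).
Proof. by rewrite /lam cisD; ring. Qed.

Variables (g : E -> C) (L : R).
Hypothesis (L0 : 0 <= L) (hL : Lip L g).

Definition dquot (n : nat) (r t : R) (x : E) : C :=
  n%:R * (g (lam (r + n%:R^-1) t *: x) - g (lam r t *: x)) +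
  angcoef n r * (g (lam r (t + n%:R^-1) *: x) - g (lam r t *: x)).

Lemma dquot_le n r t x : (0 < n)%N -> cabs (dquot n r t x) <= 2 * L * nrm x.
Proof.
move=> n0; rewrite /dquot; apply: le_trans (cabsD _ _) _; rewrite !cabsM cabs_nat.
have h l l' : cabs (g (l' *: x) - g (l *: x)) <= L * (cabs (l' - l) * nrm x).
  by rewrite (le_trans (hL _ _))// -scalerBl nrmZ.
have -> : 2 * L * nrm x = L * nrm x + L * nrm x by ring.
have Lx : 0 <= L * nrm x by rewrite mulr_ge0// nrm_ge0.
have aux (p q : R) : p * (L * (q * nrm x)) = (p * q) * (L * nrm x) by ring.
apply: lerD.
  apply: le_trans (ler_wpM2l (ler0n _ _) (h _ _)) _.
  rewrite lam_radial cabsM cabs_cis mulr1 cabs_rC ger0_norm//.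
  by rewrite aux divff ?mul1r// pnatr_eq0 -lt0n.
apply: le_trans (ler_wpM2l (cabs_ge0 _) (h _ _)) _.
rewrite aux lam_angular !cabsM cabs_cis mulr1 /angcoef cabsN cabsV cabsM.
set z := cabs (rC r) * _; apply: ler_piMl => //.
by have [->|z0] := eqVneq z 0; rewrite ?mulr0// mulVf.
Qed.

Lemma angcoef_cvg n (r : R) (r_ : nat -> R) : 0 < r -> r_ s @[s --> \oo] --> r ->
  angcoef n.+3 (r_ s) @[s --> \oo] --> angcoef n.+3 r.
Proof.
move=> r1 hr; apply: cvgN; apply: cvgV.
  rewrite mulf_neq0// ?subr_eq0 ?cis_neq1//.
  by rewrite -cabs_eq0 cabs_rC normr_eq0 gt_eqF.
by apply: cvgM; [exact: (cvg_comp _ _ hr (@rC_continuous _ _))|exact: cvg_cst].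
Qed.

Lemma glam_cvg (f : E -> C) x (r t : R) (r_ t_ : nat -> R) : lipf f ->
  r_ s @[s --> \oo] --> r -> t_ s @[s --> \oo] --> t ->
  f (lam (r_ s) (t_ s) *: x) @[s --> \oo] --> f (lam r t *: x).
Proof.
move=> /lipfP[l l0 hl] hr ht.
have h1 : lam (r_ n) (t_ n) *: x @[n --> \oo] --> lam r t *: x.
  by apply: cvgZr_tmp; exact: lam_cvg.
apply: (cvg_comp _ _ h1); exact: (Lip_continuous hl).
Qed.

Lemma dquot_cvg n (r t : R) x (r_ t_ : nat -> R) : 0 < r ->
  r_ s @[s --> \oo] --> r -> t_ s @[s --> \oo] --> t ->
  dquot n.+3 (r_ s) (t_ s) x @[s --> \oo] --> dquot n.+3 r t x.
Proof.
move=> r1 hr ht; have lg : lipf g by apply/lipfP; exists L.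
have hr' : r_ s + n.+3%:R^-1 @[s --> \oo] --> r + n.+3%:R^-1.
  by apply: cvgD => //; exact: cvg_cst.
have ht' : t_ s + n.+3%:R^-1 @[s --> \oo] --> t + n.+3%:R^-1.
  by apply: cvgD => //; exact: cvg_cst.
apply: cvgD; apply: cvgM.
- exact: cvg_cst.
- by apply: cvgB; exact: glam_cvg.
- exact: angcoef_cvg.
- by apply: cvgB; exact: glam_cvg.
Qed.

Lemma inv_nat_cvg : n.+3%:R^-1 @[n --> \oo] --> (0 : R).
Proof.
have := @cvg_harmonic R; rewrite -(cvg_shiftn 2); apply: cvg_trans.
by apply: near_eq_cvg; apply: nearW => n; rewrite /harmonic /= addn2.
Qed.

Lemma cis_inv_cvg : cis n.+3%:R^-1 @[n --> \oo] --> (1 : C).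
Proof.
have := cvg_comp _ _ inv_nat_cvg (@cis_continuous R 0).
by rewrite {2}/cis mulr0 cos0 sin0.
Qed.

(** The radial and the angular difference quotients both tend to the complex
    derivative of [g] in the direction [cis t *: x], with opposite signs. *)
Lemma dquot_cvg0 (r t : R) x : 0 < r -> differentiable g (lam r t *: x) ->
  dquot n.+3 r t x @[n --> \oo] --> (0 : C).
Proof.
move=> r1 dg; set y := lam r t *: x in dg *; pose w := cis t *: x.
pose z1 (n : nat) : C := rC n.+3%:R^-1.
pose z2 (n : nat) : C := rC r * (cis n.+3%:R^-1 - 1).
have rr : rC r != 0 :> C by rewrite -cabs_eq0 cabs_rC normr_eq0 gt_eqF.
have h1 := @derivable_quotient R E g y w z1 dg _ _.
have h2 := @derivable_quotient R E g y w z2 dg _ _.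
have {}h1 : (z1 n)^-1 * (g (z1 n *: w + y) - g y) @[n --> \oo] --> 'D_w g y.
  apply: h1; first by move=> n; rewrite -cabs_eq0 cabs_rC normr_eq0 invr_eq0 pnatr_eq0.
  by have := cvg_comp _ _ inv_nat_cvg (@rC_continuous R 0); rewrite rC0.
have {}h2 : (z2 n)^-1 * (g (z2 n *: w + y) - g y) @[n --> \oo] --> 'D_w g y.
  apply: h2; first by move=> n; rewrite mulf_neq0// subr_eq0 cis_neq1.
  have h : rC r * (cis n.+3%:R^-1 - 1) @[n --> \oo] --> rC r * (1 - 1).
    have h3 : (fun n => cis n.+3%:R^-1 - 1) @ \oo --> (1 - 1 : C).
      have h4 : (fun=> 1 : C) @ \oo --> (1 : C) by exact: cvg_cst.
      exact: (@cvgB _ C _ _ _ _ _ _ _ cis_inv_cvg h4).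
    by apply: cvgM; [exact: cvg_cst|exact: h3].
  by rewrite subrr mulr0 in h.
have h3 : (z1 n)^-1 * (g (z1 n *: w + y) - g y) -
    (z2 n)^-1 * (g (z2 n *: w + y) - g y) @[n --> \oo] --> 'D_w g y - 'D_w g y.
  exact: (@cvgB _ C _ _ _ _ _ _ _ h1 h2).
rewrite subrr in h3.
suff <- : (fun n => (z1 n)^-1 * (g (z1 n *: w + y) - g y) -
    (z2 n)^-1 * (g (z2 n *: w + y) - g y)) = (fun n => dquot n.+3 r t x) by [].
apply/funext => n; rewrite /dquot /angcoef -/(z2 n) mulNr.
congr (_ * (g _ - _) - _ * (g _ - _)).
- rewrite /z1 rCV invrK; exact: (rmorph_nat (@real_complex R)).
- by rewrite /w /y scalerA -scalerDl; congr (_ *: _); rewrite /lam rCD /z1; ring.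
- by rewrite /w /y scalerA -scalerDl; congr (_ *: _); rewrite /lam cisD /z2; ring.
Qed.

Lemma lipb_dquot n r t : lipb g -> lipb (dquot n r t).
Proof.
move=> lg; apply: lipbD; apply: lipbZ; apply: lipbB.
- exact: (lipb_pull (lam (r + n%:R^-1) t) lg).
- exact: (lipb_pull (lam r t) lg).
- exact: (lipb_pull (lam r (t + n%:R^-1)) lg).
- exact: (lipb_pull (lam r t) lg).
Qed.

End Quotient.

Section Psi.
Variables (R : realType) (E : normedModType (Cplx R)).
Local Notation C := (Cplx R).
Variables (f g : E -> C) (L B r0 : R).
Hypotheses (r00 : 0 <= r0) (lf : lipb f) (lg : lipb g) (L0 : 0 <= L) (B0 : 0 <= B).
Hypotheses (hL : Lip L g) (hB : bnd B f).
Hypothesis dg : forall y, f y != 0 -> differentiable g y.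
Variables (mu : {measure set (Bor E) -> \bar R}) (muT : (mu setT < +oo)%E) (P : nat).

Definition psi (n : nat) (r t : R) (x : E) : R :=
  cabs (amp r0 (lam r t) f x * dquot g n r t x).

Lemma psi_cbnd n r t : cbnd (psi n r t).
Proof.
by apply: cbnd_cabs; apply: lipbM; [exact: lipb_amp|exact: lipb_dquot].
Qed.

Lemma psi_le n r t x : psi n.+3 r t x <= B * (2 * L * (r0 + 1)).
Proof.
have rhs0 : 0 <= B * (2 * L * (r0 + 1)).
  by apply: mulr_ge0 => //; apply: mulr_ge0; [exact: mulr_ge0|exact: addr_ge0].
rewrite /psi /amp; have [hx|hx] := leP (r0 + 1) (nrm x).
  by rewrite cutoff0// !mul0r cabs0.
rewrite cabsM; apply: ler_pM; rewrite ?cabs_ge0//.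
  rewrite cabsM -[leRHS]mul1r; apply: ler_pM; rewrite ?cabs_ge0//; last exact: hB.
  exact: cutoff_bnd.
apply: le_trans (dquot_le L0 hL _ _ _ _) _ => //.
by apply: ler_wpM2l; [exact: mulr_ge0|exact: ltW].
Qed.

Lemma cabs_cvg (u : nat -> C) (l : C) : u n @[n --> \oo] --> l ->
  cabs (u n) @[n --> \oo] --> cabs l.
Proof.
move=> hu; apply: (cvg_comp _ _ hu).
apply: (@real_lip_continuous R C (@cabs R) 1) => x y; rewrite mul1r.
exact: (@nrm_dist R C x y).
Qed.

Lemma psi_cont n (r t : R) x (r_ t_ : nat -> R) : 0 < r ->
  r_ s @[s --> \oo] --> r -> t_ s @[s --> \oo] --> t ->
  psi n.+3 (r_ s) (t_ s) x @[s --> \oo] --> psi n.+3 r t x.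
Proof.
move=> r1 hr ht; apply: cabs_cvg; apply: cvgM; last exact: (dquot_cvg L0 hL).
apply: cvgM; first exact: cvg_cst.
by apply: glam_cvg => //; exact: lipb_lipf.
Qed.

Lemma psi_lim (r t : R) x : 0 < r -> psi n.+3 r t x @[n --> \oo] --> (0 : R).
Proof.
move=> r1; rewrite -(@cabs0 R); apply: cabs_cvg.
have [fx|fx] := eqVneq (f (lam r t *: x)) 0.
  rewrite (_ : (fun n => _) = fun=> 0); first exact: cvg_cst.
  by apply/funext => n; rewrite /amp /pull fx mulr0 mul0r.
rewrite -(mulr0 (amp r0 (lam r t) f x)).
by apply: cvgM; [exact: cvg_cst|apply: dquot_cvg0 => //; exact: dg].
Qed.

Lemma psi_riemann n : riemann mu P (psi n.+3) M @[M --> \oo] --> polar_int muT P (psi n.+3).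
Proof.
apply: (riemann_cvg (psi_cbnd n.+3) _ (psi_le n)).
- by move=> *; exact: cabs_ge0.
- exact: psi_cont.
Qed.

Lemma psi_polar_cvg0 : polar_int muT P (psi n.+3) @[n --> \oo] --> (0 : R).
Proof.
apply: (@polar_int_cvg0 _ _ _ muT P (fun n => psi n.+3) (B * (2 * L * (r0 + 1)))).
- by move=> n r t; exact: psi_cbnd.
- by move=> *; exact: cabs_ge0.
- by move=> *; exact: psi_le.
- by move=> n; exact: psi_cont.
- exact: psi_lim.
Qed.

End Psi.

Section Asymptotics.
Variable R : realType.
Local Notation C := (Cplx R).

Lemma near_shift3 (Q : nat -> Prop) : (\forall n \near \oo, Q n.+3) ->
  \forall n \near \oo, Q n.
Proof.
move=> [N _ h]; exists (N + 3)%N => // n /= Nn.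
have -> : n = (n - 3).+3 by lia.
by apply: h => /=; lia.
Qed.

Lemma near_lt0 (u : nat -> R) e : u n @[n --> \oo] --> (0 : R) -> 0 < e ->
  \forall n \near \oo, u n < e.
Proof. by move=> hu e0; apply: (cvgr_lt 0 hu). Qed.

Lemma cis_dist_cvg : cabs (cis n.+3%:R^-1 - 1 : C) @[n --> \oo] --> (0 : R).
Proof.
have h4 : (fun=> 1 : C) @ \oo --> (1 : C) by exact: cvg_cst.
have h : cis n.+3%:R^-1 - 1 @[n --> \oo] --> (1 - 1 : C).
  exact: (@cvgB _ C _ _ _ _ _ _ _ (@cis_inv_cvg R) h4).
by have := cabs_cvg h; rewrite subrr cabs0.
Qed.

Lemma near_iterated (Q : nat -> nat -> Prop) :
  (\forall n \near \oo, (0 < n)%N -> \forall m \near \oo, (0 < m)%N -> Q n m) ->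
  \forall nm \near iterated_oo, Q nm.1 nm.2.
Proof.
move=> h; change (\forall n \near \oo, \forall m \near \oo, Q n m).
have h0 : \forall n \near \oo, (0 < n)%N by exact: nbhs_infty_gt.
apply: filterS2 (h) (h0) => n hn n0.
by apply: filterS2 (hn n0) (h0) => m hm m0; exact: hm.
Qed.

Lemma cvg_mulnr (u : nat -> R) (l : R) n : (0 < n)%N -> u M @[M --> \oo] --> l ->
  u (n * m)%N @[m --> \oo] --> l.
Proof.
move=> n0; apply: cvg_comp; move=> A [N _ hN]; exists N => // m /= Nm.
by apply: hN => /=; apply: leq_trans Nm _; exact: leq_pmull.
Qed.

End Asymptotics.

Section LocallyConstant.
Variables (R : realType) (E : normedModType (Cplx R)).
Local Notation C := (Cplx R).

Lemma differentiable_locally_cst (g : E -> C) (V : set E) c x : open V ->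
  (forall y, V y -> g y = c) -> V x -> differentiable g x.
Proof.
move=> oV hc Vx.
have h : g \o shift x = cst (g x) + (\0 : E -> C) +o_ 0 id.
  apply/eqaddoP => e e0.
  have : \forall y \near (0 : E), V (y + x).
    have : \forall z \near x, V z by exact: open_nbhs_nbhs.
    by rewrite (near_shift 0) /= subr0.
  apply: filterS => y Vy.
  by rewrite /= !fctE /= hc// hc// addr0 subrr normr0 mulr_ge0// ltW.
have z0 : continuous (\0 : E -> C) by move=> y; exact: cst_continuous.
apply/diff_locallyP; rewrite (diff_unique z0 h); split=> //.
Qed.

Lemma holo_near_locally_cst (g : E -> C) (A V : set E) c : open V -> A `<=` V ->
  (forall y, V y -> g y = c) -> holo_near g A.
Proof.
move=> oV AV hc; exists V; split=> //; split=> // x; exact: (differentiable_locally_cst oV hc).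
Qed.
End LocallyConstant.

Lemma sum_shift_telescope (W : zmodType) (G : nat -> W) (Q m : nat) :
  \sum_(a < Q) (G (a + m)%N - G a) = \sum_(i < m) (G (Q + i)%N - G i).
Proof.
elim: Q => [|Q ih].
  by rewrite big_ord0 big1// => i _; rewrite add0n subrr.
have h : \sum_(i < m) G (Q + i)%N + G (Q + m)%N = G Q + \sum_(i < m) G (Q.+1 + i)%N.
  rewrite -(big_ord_recr m (fun i => G (Q + i)%N)) big_ord_recl /= addn0; congr (_ + _).
  by apply: eq_bigr => i _; rewrite /bump /= add1n addnS addSn.
rewrite big_ord_recr /= ih !sumrB addrACA h (addrC (G Q)) (addrC (- _)) addrA addrK.
by [].
Qed.

Section ComplexLimits.
Variables (R : realType).
Local Notation C := (Cplx R).

Lemma cvg_of_cabs (u : nat -> C) (l : C) :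
  cabs (u n - l) @[n --> \oo] --> (0 : R) -> u n @[n --> \oo] --> l.
Proof.
move=> h; apply/cvgrPdist_lt => e e0.
have e1 : 0 < complex.Re e.
  by rewrite -(@rC_lt R) rC0 -rC_Re// ltW.
have : \forall n \near \oo, cabs (u n - l) < complex.Re e by exact: near_lt0.
apply: filterS => n hn; rewrite distrC cabsE (rC_Re (ltW e0)) rC_lt//.
Qed.

Lemma cabs_sub_cvg (u : nat -> C) (l : C) : u n @[n --> \oo] --> l ->
  cabs (u n - l) @[n --> \oo] --> (0 : R).
Proof.
move=> h; have h4 : (fun=> l) @ \oo --> (l : C) by exact: cvg_cst.
have h5 : u n - l @[n --> \oo] --> (l - l : C) by exact: (@cvgB _ C _ _ _ _ _ _ _ h h4).
by have := cabs_cvg h5; rewrite subrr cabs0.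
Qed.

Lemma cvg_le0 (u v : nat -> R) : (forall n, 0 <= u n) -> (forall n, u n <= v n) ->
  v n @[n --> \oo] --> (0 : R) -> u n @[n --> \oo] --> (0 : R).
Proof.
move=> u0 uv hv; apply: (@squeeze_cvgr _ _ _ _ (fun=> 0) v) => //; last exact: cvg_cst.
by apply: nearW => n; rewrite u0 uv.
Qed.

Lemma cvg_sum0 N (c : nat -> nat -> R) :
  (forall j, (j < N)%N -> c j n @[n --> \oo] --> (0 : R)) ->
  \sum_(j < N) c j n @[n --> \oo] --> (0 : R).
Proof.
elim: N => [|N ih] h.
  by under eq_fun do rewrite big_ord0; exact: cvg_cst.
rewrite (_ : (fun n => _) = fun n => \sum_(j < N) c j n + c N n); last first.
  by apply/funext => n; rewrite big_ord_recr.
have h1 := ih (fun j jN => h j (ltnW jN)); have h2 := h N (ltnSn N).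
by rewrite -[X in _ --> X](addr0 (0 : R)); exact: (cvgD h1 h2).
Qed.
Lemma cvg_cabs_bounded (u : nat -> C) (l : C) : u n @[n --> \oo] --> l ->
  exists2 M, 0 <= M & forall n, cabs (u n) <= M.
Proof.
move=> /cabs_cvg h.
have [M [_ hM]] : bounded_fun (fun n => cabs (u n)).
  by apply: cvg_seq_bounded; apply/cvg_ex; exists (cabs l).
exists (`|M| + 1); first by rewrite addr_ge0.
move=> n; apply: le_trans (ler_norm _) _; apply: (hM (`|M| + 1)) => //.
by apply: le_lt_trans (ler_norm _) _; rewrite ltrDl.
Qed.

End ComplexLimits.

Section Retraction.
Variables (R : realType) (E : normedModType (Cplx R)).
Local Notation C := (Cplx R).
Implicit Types (f g : E -> C) (N : R) (x y : E).

(* Radial retraction onto the closed ball of radius [N]. *)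
Definition retr N (x : E) : E := rC (N / Num.max N (nrm x)) *: x.

Definition cutr N g : E -> C := fun x => g (retr N x).

Lemma retr_id N x : 0 < N -> nrm x <= N -> retr N x = x.
Proof.
by move=> N0 xN; rewrite /retr (max_idPl xN) divff ?rC1 ?scale1r// gt_eqF.
Qed.

Lemma retr_max N x : 0 < N -> 0 < Num.max N (nrm x).
Proof. by move=> N0; rewrite lt_max N0. Qed.

Lemma retr_le N x : 0 < N -> nrm (retr N x) <= N.
Proof.
move=> N0; have m0 := retr_max x N0.
rewrite /retr nrmZ cabs_rC ger0_norm; last by rewrite divr_ge0 ?ltW.
by rewrite mulrAC ler_pdivrMr// ler_pM2l// le_max lexx orbT.
Qed.

Lemma retr_out N x : 0 < N -> N <= nrm x -> nrm (retr N x) = N.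
Proof.
move=> N0 Nx; have x0 : 0 < nrm x by exact: lt_le_trans Nx.
rewrite /retr (max_idPr Nx) nrmZ cabs_rC ger0_norm ?divfK ?gt_eqF//.
by rewrite divr_ge0 ?ltW.
Qed.

Lemma retr_lip N x y : 0 < N -> nrm (retr N x - retr N y) <= 2 * nrm (x - y).
Proof.
move=> N0; rewrite /retr; set a := Num.max N (nrm x); set b := Num.max N (nrm y).
have a0 : 0 < a by exact: retr_max. have b0 : 0 < b by exact: retr_max.
have Na : N / a <= 1 by rewrite ler_pdivrMr// mul1r le_max lexx.
have Na0 : 0 <= N / a by rewrite divr_ge0// ltW.
have -> : rC (N / a) *: x - rC (N / b) *: y =
    rC (N / a) *: (x - y) + rC (N / a - N / b) *: y.
  by rewrite rCD rCN scalerBr scalerBl addrA subrK.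
apply: le_trans (nrmD _ _) _; rewrite mulr_natl mulr2n; apply: lerD.
  by rewrite nrmZ cabs_rC ger0_norm//; apply: ler_piMl => //; exact: nrm_ge0.
rewrite nrmZ cabs_rC.
have -> : N / a - N / b = (N / a) * ((b - a) / b) by field; rewrite !gt_eqF.
rewrite normrM (ger0_norm Na0) normrM.
rewrite (gtr0_norm (_ : 0 < b^-1)) ?invr_gt0//.
have ba : `|b - a| <= nrm (x - y).
  rewrite distrC; apply: le_trans (max_lip _ _ _) _; exact: nrm_dist.
apply: (@le_trans _ _ (1 * (`|b - a| / b) * nrm y)).
  by rewrite ler_wpM2r ?nrm_ge0// ler_wpM2r// mulr_ge0// invr_ge0 ltW.
rewrite mul1r mulrAC ler_pdivrMr//.
apply: ler_pM => //; first exact: nrm_ge0.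
by rewrite le_max lexx orbT.
Qed.

Lemma cutr_id N g x : 0 < N -> nrm x <= N -> cutr N g x = g x.
Proof. by move=> N0 xN; rewrite /cutr retr_id. Qed.

Definition Lip_ball L N g := forall x y, nrm x < N -> nrm y < N ->
  cabs (g x - g y) <= L * nrm (x - y).

Lemma qloc_lip_ball g N : qloc_lip g -> exists2 L, 0 <= L & Lip_ball L N g.
Proof.
move=> [_ /(_ N)[L hL]]; exists (cabs L); first exact: cabs_ge0.
move=> x y xN yN; apply: (lipschitz_on_nrm hL); exact/ball0_nrm.
Qed.

Lemma Lip_cutr L N N' g : 0 < N -> N < N' -> 0 <= L -> Lip_ball L N' g -> Lip (2 * L) (cutr N g).
Proof.
move=> N0 NN L0 h x y; apply: le_trans (h _ _ _ _) _.
- by apply: le_lt_trans NN; exact: retr_le.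
- by apply: le_lt_trans NN; exact: retr_le.
by rewrite (mulrC 2) -mulrA ler_wpM2l// retr_lip.
Qed.

Lemma bnd_cutr L N N' g : 0 < N -> N < N' -> 0 <= L -> Lip_ball L N' g ->
  bnd (cabs (g 0) + L * N) (cutr N g).
Proof.
move=> N0 NN L0 h x.
have -> : cutr N g x = g 0 + (g (retr N x) - g 0) by rewrite addrC subrK.
apply: le_trans (cabsD _ _) _; rewrite lerD2l; apply: le_trans (h _ _ _ _) _.
- by apply: le_lt_trans NN; exact: retr_le.
- by rewrite nrm0; exact: lt_trans NN.
by rewrite subr0 ler_wpM2l// retr_le.
Qed.

Lemma lipb_cutr N g : 0 < N -> qloc_lip g -> lipb (cutr N g).
Proof.
move=> N0 hg; have [L L0 hL] := qloc_lip_ball (N + 1) hg.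
have NN : N < N + 1 by rewrite ltrDl.
apply/lipbP; exists (2 * L), (cabs (g 0) + L * N); split.
- exact: mulr_ge0.
- by rewrite addr_ge0 ?cabs_ge0// mulr_ge0// ltW.
- exact: (Lip_cutr N0 NN L0 hL).
- exact: (bnd_cutr N0 NN L0 hL).
Qed.

(** On the closed ball the constant of the open ball survives, by shrinking
    both points towards the centre. *)
Lemma Lip_cutr_sharp L N g : 0 < N -> 0 <= L -> qloc_lip g -> Lip_ball L N g ->
  Lip (2 * L) (cutr N g).
Proof.
move=> N0 L0 hg hL; have [L1 L10 hL1] := qloc_lip_ball (N + 1) hg.
have closed_ball u v : nrm u <= N -> nrm v <= N -> cabs (g u - g v) <= L * nrm (u - v).
  move=> uN vN; apply/ler_addgt0Pr => e e0.
  pose D := 2 * L1 * N + 1 + e.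
  have D1 : 0 < 2 * L1 * N + 1 by rewrite ltr_wpDl// !mulr_ge0// ltW.
  have D0 : 0 < D by rewrite addr_gt0.
  pose q := e / D.
  have q0 : 0 < q by rewrite divr_gt0.
  have q1 : q < 1 by rewrite ltr_pdivrMr// mul1r ltrDr.
  pose t : C := rC (1 - q).
  have ct : cabs t = 1 - q by rewrite cabs_rC ger0_norm// subr_ge0 ltW.
  have tN (w : E) : nrm w <= N -> nrm (t *: w) < N.
    move=> wN; rewrite nrmZ ct; apply: (@le_lt_trans _ _ ((1 - q) * N)).
      by rewrite ler_wpM2l// subr_ge0 ltW.
    by rewrite gtr_pMl// ltrBlDr ltrDl.
  have N1 : N < N + 1 by rewrite ltrDl.
  have near_t (w : E) : nrm w <= N -> cabs (g w - g (t *: w)) <= L1 * (q * N).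
    move=> wN; apply: le_trans (hL1 _ _ _ _) _.
    - exact: le_lt_trans N1.
    - by apply: lt_trans N1; exact: tN.
    rewrite ler_wpM2l// -[X in X - _]scale1r -scalerBl nrmZ -rC1 -rCN -rCD subKr cabs_rC.
    by rewrite gtr0_norm// ler_wpM2l// ltW.
  have -> : g u - g v = (g u - g (t *: u)) + (g (t *: u) - g (t *: v)) - (g v - g (t *: v)).
    by ring.
  apply: le_trans (cabsD _ _) _; rewrite cabsN.
  apply: (@le_trans _ _ (L1 * (q * N) + L * nrm (u - v) + L1 * (q * N))).
    apply: lerD; last exact: near_t.
    apply: le_trans (cabsD _ _) _; apply: lerD; first exact: near_t.
    apply: le_trans (hL _ _ (tN _ uN) (tN _ vN)) _; rewrite ler_wpM2l//.
    rewrite -scalerBr nrmZ ct ler_piMl ?nrm_ge0// gerBl; exact: ltW.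
  have -> : L1 * (q * N) + L * nrm (u - v) + L1 * (q * N) = L * nrm (u - v) + q * (2 * L1 * N).
    by ring.
  rewrite lerD2l /q mulrAC ler_pdivrMr// ler_wpM2l ?(ltW e0)//.
  by rewrite /D; lra.
move=> x y; apply: le_trans (closed_ball _ _ _ _) _; [exact: retr_le|exact: retr_le|].
by rewrite (mulrC 2) -mulrA ler_wpM2l// retr_lip.
Qed.

Lemma cutr_bsupp rho N f : 0 < N -> rho <= N -> (forall x, rho <= nrm x -> f x = 0) ->
  cutr N f = f.
Proof.
move=> N0 rN f0; apply/funext => x; have [xN|/ltW xN] := leP (nrm x) N.
  exact: cutr_id.
by rewrite /cutr !f0//; [exact: le_trans xN|rewrite retr_out].
Qed.

Lemma differentiable_near_eq (g h : E -> C) (V : set E) x : open V ->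
  (forall y, V y -> h y = g y) -> V x -> differentiable g x -> differentiable h x.
Proof.
move=> oV hg Vx dg.
have -> : h = g + (fun y => h y - g y) by apply/funext => y /=; rewrite !fctE /= addrC subrK.
apply: differentiableD dg (differentiable_locally_cst (c := 0) oV _ Vx) => y Vy.
by rewrite hg// subrr.
Qed.

Lemma holo_near_cutr N g (A : set E) : 0 < N -> A `<=` [set x | nrm x < N] ->
  holo_near g A -> holo_near (cutr N g) A.
Proof.
move=> N0 AN [V [oV [AV dV]]]; exists (V `&` [set x | nrm x < N]); split.
  by apply: openI => //; exact: open_nrm_lt.
split; first by move=> x Ax; split; [exact: AV|exact: AN].
move=> x [Vx xN]; apply: (@differentiable_near_eq g _ [set x | nrm x < N]) => //.
- exact: open_nrm_lt.
- by move=> y /ltW yN; rewrite cutr_id.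
- exact: dV.
Qed.

Lemma qloc_fun_bsupp f : qloc_fun f -> exists2 rho : R, 0 < rho & bsupp rho f.
Proof.
move=> [/lipfP[L L0 hL] [r hr]]; exists (Num.max r 1); first by rewrite lt_max ltr01 orbT.
have f0 x : Num.max r 1 <= nrm x -> f x = 0.
  rewrite ge_max => /andP[rx _]; apply: fsuppP => /hr /ball0_nrm.
  by rewrite ltNge rx.
split => //; apply/lipbP; exists L, (cabs (f 0) + L * Num.max r 1); split=> //.
  by rewrite addr_ge0 ?cabs_ge0// mulr_ge0// le_max ler01 orbT.
move=> x; have [xr|xr] := leP (Num.max r 1) (nrm x).
  by rewrite f0// cabs0 addr_ge0 ?cabs_ge0// mulr_ge0// le_max ler01 orbT.
rewrite -[f x](subrK (f 0)) addrC; apply: le_trans (cabsD _ _) _; rewrite lerD2l.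
by apply: le_trans (hL _ _) _; rewrite subr0 ler_wpM2l// ltW.
Qed.

Lemma bsupp_fsupp rho N f : rho < N -> bsupp rho f -> fsupp f `<=` [set x | nrm x < N].
Proof.
move=> rN [_ f0]; apply: (@subset_trans _ [set x | nrm x <= rho]).
  apply: fsupp_sub; first exact: closed_nrm_le.
  by move=> x; apply: contraNP => /negP; rewrite -ltNge => /ltW /f0 ->.
by move=> x /= h; exact: le_lt_trans rN.
Qed.

Lemma lipf_qloc_lip f : lipf f -> qloc_lip f.
Proof.
move=> /lipfP[L L0 hL]; split; first exact: Lip_continuous hL.
by move=> r; exists (rC L); apply: nrm_lipschitz_on => x y _ _; exact: hL.
Qed.

Lemma qloc_ent k f s i : qloc_form k f s -> qloc_lip (ent s i).
Proof.
move=> [_ [sk hs]]; have [ik|ik] := ltnP i k; first exact: hs.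
rewrite /ent nth_default ?sk//; apply: lipf_qloc_lip; exact: lipb_lipf (lipb_cst E 0).
Qed.

Definition trunc N (s : seq (E -> C)) : nat -> E -> C := fun i => cutr N (ent s i).

Lemma allb_trunc k N f s : 0 < N -> qloc_form k f s -> allb (trunc N s).
Proof. by move=> N0 hs i; apply: lipb_cutr => //; exact: qloc_ent hs. Qed.

Lemma ent_set_nth (s : seq (E -> C)) j p i :
  ent (set_nth (fun _ => 0) s j p) i = if i == j then p else ent s i.
Proof. by rewrite /ent nth_set_nth. Qed.

Lemma trunc_set_nth N s j p :
  trunc N (set_nth (fun _ => 0) s j p) = upd (trunc N s) j (cutr N p).
Proof.
by apply/funext => i; rewrite /trunc /upd ent_set_nth; case: eqP.
Qed.

(* Any radius would do, see [qconeE]; [1] is the junk value off [qloc_fun]. *)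
Definition radius (f : E -> C) : R := xget 1 [set r : R | 0 < r /\ bsupp r f].

Lemma radiusP f : qloc_fun f -> 0 < radius f /\ bsupp (radius f) f.
Proof.
move=> /qloc_fun_bsupp[rho rho0 hf].
by apply: (@xgetPex _ 1 [set r : R | 0 < r /\ bsupp r f]); exists rho.
Qed.

End Retraction.

(** * The cone over a current *)

Section Cone.
Variables (R : realType) (E : normedModType (Cplx R)).
Local Notation C := (Cplx R).
Local Notation fam := (nat -> E -> C).
Local Notation node := (node R).
Variables (k : nat) (mu : {measure set (Bor E) -> \bar R}) (muT : (mu setT < +oo)%E).
Variables (tau : fam -> C) (sf : slot_functional k mu tau).
Variables (d r0 : R) (d0 : 0 < d) (r00 : 0 <= r0).
Hypothesis mu_annulus : mu (~` [set x : Bor E | d <= nrm (x : E) <= r0]) = 0%E.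
Local Notation amp := (amp r0).
Local Notation nu P := (spiral_measure muT P).
Local Notation form := (@qloc_form R E k.+1).

Lemma measurable_annulus : measurable [set x : Bor E | d <= nrm (x : E) <= r0].
Proof.
rewrite (_ : [set x | _] = [set x : E | d <= nrm x] `&` [set x : E | nrm x <= r0]).
  by apply: measurableI; apply: closed_Bor; [exact: closed_nrm_ge|exact: closed_nrm_le].
by apply/seteqP; split => x /= => [/andP[]|[-> ->]].
Qed.

Lemma mint_le_annulus v w : cbnd v -> cbnd w ->
  (forall x, d <= nrm x <= r0 -> v x <= w x) -> mint mu v <= mint mu w.
Proof.
move=> cv cw h; have mX := measurable_annulus.
have e u : cbnd u -> mint mu u =
    \int[mu]_(x in [set x : Bor E | d <= nrm (x : E) <= r0]) (u : Bor E -> R) x.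
  move=> cu; rewrite /mint /Rintegral (negligible_integral (measurableC mX))//.
    by rewrite setTD setCK.
  exact: cbnd_integrable.
rewrite !e//; apply: le_Rintegral => //;
  apply: (integrableS measurableT) => //; exact: cbnd_integrable.
Qed.

Lemma slot_zero p j : (j <= k)%N -> allb p ->
  (forall x, d <= nrm x <= r0 -> p j x = 0) -> tau p = 0.
Proof.
move=> jk hp h; have [L [L0 hL]] := lip_consts hp.
apply/eqP; rewrite -cabs_eq0 eq_le cabs_ge0 andbT.
apply: le_trans (sf_mass sf jk hp L0 (fun i _ => hL i)) _.
rewrite (_ : mint mu _ = 0) ?mulr0//.
apply: (mint_ae0 muT _ measurable_annulus) => //; first by apply: cbnd_cabs; exact: hp.
by move=> x /h ->; rewrite cabs0.
Qed.

Lemma sf_sub s j u v : (j <= k)%N -> allb s -> lipb u -> lipb v ->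
  tau (upd s j (fun x => u x - v x)) = tau (upd s j u) - tau (upd s j v).
Proof.
move=> jk hs hu hv.
rewrite (_ : (fun x => u x - v x) = fun x => (-1) * v x + u x); last first.
  by apply/funext => x; rewrite mulN1r addrC.
by rewrite (sf_lin sf)// mulN1r addrC.
Qed.

(** Only the values of a slot on the support of the mass measure matter. *)
Lemma slot_eq p j u v : (j <= k)%N -> allb p -> lipb u -> lipb v ->
  (forall x, d <= nrm x <= r0 -> u x = v x) -> tau (upd p j u) = tau (upd p j v).
Proof.
move=> jk hp hu hv h; apply/eqP; rewrite -subr_eq0 -sf_sub//; apply/eqP.
apply: (slot_zero jk) => [|x hx]; first by apply: allb_upd => //; exact: lipbB.
by rewrite upd_same h// subrr.
Qed.

Definition pl (l : C) (pi : fam) : fam := fun i => pull l (pi i).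

Lemma allb_pl l pi : allb pi -> allb (pl l pi).
Proof. by move=> h i; exact: lipb_pull. Qed.

Definition kterm (l l' : C) (F : E -> C) (pi : fam) (j : nat) : C :=
  tau (upd (mix (pl l' pi) (pl l pi) j) j
    (fun x => F x * (pull l' (pi j) x - pull l (pi j) x))).

(* For [F = 1] this telescopes to [tau (pl l' pi) - tau (pl l pi)]. *)
Definition kern l l' F pi : C := \sum_(j < k.+1) kterm l l' F pi j.

Lemma lipb_kslot l l' (F g : E -> C) : lipb F -> lipb g ->
  lipb (fun x => F x * (pull l' g x - pull l g x)).
Proof. by move=> hF hg; apply: lipbM => //; apply: lipbB; exact: lipb_pull. Qed.

Lemma kern_ext l l' F pi pi' : (forall i, (i <= k)%N -> pi i = pi' i) ->
  kern l l' F pi = kern l l' F pi'.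
Proof.
move=> h; apply: eq_bigr => j _; apply: (sf_ext sf) => i ik.
have jk : (j <= k)%N by rewrite -ltnS.
by rewrite /upd /mix /pl !h.
Qed.

Lemma kern_linF l l' a F G pi : lipb F -> lipb G -> allb pi ->
  kern l l' (fun x => a * F x + G x) pi = a * kern l l' F pi + kern l l' G pi.
Proof.
move=> hF hG hp; rewrite /kern mulr_sumr -big_split /=; apply: eq_bigr => j _.
rewrite /kterm -(sf_lin sf)//; last 4 first.
- by rewrite -ltnS.
- by apply: allb_mix; exact: allb_pl.
- exact: lipb_kslot.
- exact: lipb_kslot.
by congr (tau (upd _ _ _)); apply/funext => x; ring.
Qed.

Lemma kern_linpi l l' a F pi i u v : (i <= k)%N -> lipb F -> allb pi -> lipb u -> lipb v ->
  kern l l' F (upd pi i (fun x => a * u x + v x)) =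
  a * kern l l' F (upd pi i u) + kern l l' F (upd pi i v).
Proof.
move=> ik hF hp hu hv; rewrite /kern mulr_sumr -big_split /=; apply: eq_bigr => j _.
have jk : (j <= k)%N by rewrite -ltnS.
rewrite /kterm; have [ji|ji] := eqVneq (j : nat) i.
  have e w : mix (pl l' (upd pi i w)) (pl l (upd pi i w)) j =
      upd (mix (pl l' pi) (pl l pi) j) j (pull l w).
    apply/funext => s; rewrite /mix /upd /pl ji.
    by case: eqVneq => [->|]; rewrite ?ltnn.
  have hj w : upd pi i w j = w by rewrite ji upd_same.
  rewrite !e !upd_upd !hj -(sf_lin sf)//; last 3 first.
  - by apply: allb_mix; exact: allb_pl.
  - exact: lipb_kslot.
  - exact: lipb_kslot.
  by congr (tau (upd _ _ _)); apply/funext => x; rewrite /pull; ring.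
pose l2 := if (i < j)%N then l' else l.
have e w Y : upd (mix (pl l' (upd pi i w)) (pl l (upd pi i w)) j) j Y =
    upd (upd (mix (pl l' pi) (pl l pi) j) j Y) i (pull l2 w).
  apply/funext => s; rewrite /mix /upd /pl /l2.
  case: (eqVneq s j) => [->|sj]; first by rewrite (negbTE ji).
  by case: (eqVneq s i) => [->|]; case: ifP.
rewrite !e !upd_other//.
rewrite (_ : pull l2 (fun x => a * u x + v x) = fun x => a * pull l2 u x + pull l2 v x)//.
rewrite (sf_lin sf)//; [|exact: lipb_pull..].
by apply: allb_upd; [apply: allb_mix; exact: allb_pl|exact: lipb_kslot].
Qed.

Lemma kern_one l l' pi : allb pi ->
  kern l l' (fun=> 1) pi = tau (pl l' pi) - tau (pl l pi).
Proof.
move=> hp; rewrite (telescope (sf_ext sf) sf_sub)//; [|exact: allb_pl..].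
apply: eq_bigr => j _; rewrite /kterm; congr (tau (upd _ _ _)).
by apply/funext => x; rewrite mul1r.
Qed.

Section mass.
Variables (L : nat -> R) (pi : fam).
Hypothesis hpi : allb pi.
Hypothesis L0 : forall i, 0 <= L i.
Hypothesis hL : forall i, Lip (L i) (pi i).

Lemma pull_diff l l' i x : cabs (pull l' (pi i) x - pull l (pi i) x) <=
  L i * (cabs (l' - l) * nrm x).
Proof. by rewrite (le_trans (hL _ _ _))// -scalerBl nrmZ. Qed.

Lemma kterm_mass l l' F j Lam : (j <= k)%N -> lipb F -> 1 <= Lam -> cabs l <= Lam -> cabs l' <= Lam ->
  cabs (kterm l l' F pi j) <= (\prod_(i < k.+1) (Lam * L i)) *
    (cabs (l' - l) * r0 * mint mu (fun x => cabs (F x))).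
Proof.
move=> jk hF Lam1 hl hl'.
have Lam0 : 0 <= Lam by exact: le_trans ler01 _.
have hs := lipb_kslot l l' hF (hpi j).
have hm : allb (mix (pl l' pi) (pl l pi) j) by apply: allb_mix; exact: allb_pl.
have := sf_mass sf jk (allb_upd j hm hs) (L := fun i => Lam * L i).
rewrite upd_same => h; apply: le_trans (h _ _) _.
- by move=> i; rewrite mulr_ge0.
- move=> i ij; rewrite upd_other// /mix /pl; case: ifP => _.
    by apply: Lip_le (Lip_pull _ (hL i)); rewrite ler_wpM2r.
  by apply: Lip_le (Lip_pull _ (hL i)); rewrite ler_wpM2r.
have jk' : (j < k.+1)%N by [].
rewrite [in leRHS](bigD1 (Ordinal jk'))//= [in leRHS]mulrC mulrA [leRHS]mulrC.
rewrite (eq_bigl (fun i : 'I_k.+1 => (i : nat) != j)); last by [].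
apply: ler_wpM2l; first by apply: prodr_ge0 => i _; rewrite mulr_ge0.
have cF : cbnd (fun x => cabs (F x)) by exact: cbnd_cabs.
have I0 : 0 <= mint mu (fun x => cabs (F x)) by exact: mint_cabs_ge0.
apply: (@le_trans _ _ (mint mu (fun x => (L j * (cabs (l' - l) * r0)) * cabs (F x)))).
  apply: mint_le_annulus; [exact: cbnd_cabs|exact: cbndZ|].
  move=> x /andP[_ xr]; rewrite cabsM mulrC ler_wpM2r ?cabs_ge0//.
  apply: le_trans (pull_diff _ _ _ _) _.
  by rewrite ler_wpM2l// ler_wpM2l// cabs_ge0.
rewrite mintZ//.
rewrite (_ : _ * _ = (cabs (l' - l) * r0 * mint mu (fun x => cabs (F x))) * L j); last by ring.
apply: ler_wpM2l; first by rewrite !mulr_ge0// cabs_ge0.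
by rewrite ler_peMl.
Qed.

Lemma kern_mass l l' F Lam : lipb F -> 1 <= Lam -> cabs l <= Lam -> cabs l' <= Lam ->
  cabs (kern l l' F pi) <= k.+1%:R * (\prod_(i < k.+1) (Lam * L i)) *
    (cabs (l' - l) * r0 * mint mu (fun x => cabs (F x))).
Proof.
move=> hF h1 h2 h3; apply: le_trans (cabs_sum _ _ _) _.
apply: (@le_trans _ _ (\sum_(j < k.+1) ((\prod_(i < k.+1) (Lam * L i)) *
    (cabs (l' - l) * r0 * mint mu (fun x => cabs (F x)))))).
  by apply: ler_sum => j _; apply: kterm_mass => //; rewrite -ltnS.
by rewrite sumr_const card_ord -[leRHS]mulrA mulr_natl lexx.
Qed.

End mass.

Definition gterm n m f (pi : fam) a b : C :=
  let M := (n * m)%N in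
  n%:R * kern (grid R M a b) (grid R M (a + m) b) (amp (grid R M a b) f) pi +
  angcoef n (node M a) * kern (grid R M a b) (grid R M a (b + m)) (amp (grid R M a b) f) pi.

Definition gsum Q n m f pi : C :=
  - (rC (((n * m)%:R)^-1 ^+ 2) * \sum_(a < Q * (n * m)) \sum_(b < n * m) gterm n m f pi a b).

Definition Usum n m f pi : C := gsum n n m f pi.

Lemma kern_far l l' rho f pi : bsupp rho f -> allb pi -> rho <= d * cabs l ->
  kern l l' (amp l f) pi = 0.
Proof.
move=> [lf hf] hp hrho; apply: big1 => j _.
have jk : (j <= k)%N by rewrite -ltnS.
apply: (slot_zero jk).
  apply: allb_upd; first by apply: allb_mix; exact: allb_pl.
  by apply: lipb_kslot; [exact: lipb_amp|exact: hp].
move=> x /andP[dx _]; rewrite upd_same /amp /pull hf ?mulr0 ?mul0r//.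
apply: le_trans hrho _; rewrite nrmZ mulrC ler_wpM2l// cabs_ge0//.
Qed.

Lemma Usum_restrict P n m rho f pi : bsupp rho f -> allb pi -> rho <= d * (P%:R - 1) ->
  (P <= n)%N -> Usum n m f pi = gsum P n m f pi.
Proof.
move=> hf hp hrho Pn; rewrite /Usum /gsum; congr (- (_ * _)).
have [M0|M0] := posnP (n * m)%N; first by rewrite M0 !muln0 !big_ord0.
rewrite -!(big_mkord xpredT (fun a => \sum_(b < n * m) gterm n m f pi a b)).
rewrite (@big_cat_nat _ _ _ (P * (n * m)))//=; last by rewrite leq_mul2r Pn orbT.
rewrite [X in _ + X]big1_seq ?addr0// => a /andP[_]; rewrite mem_index_iota => /andP[ha _].
apply: big1 => b _; rewrite /gterm.
have h : rho <= d * cabs (grid R (n * m) a b).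
  apply: le_trans hrho _; rewrite ler_pM2l//.
  by apply: le_trans _ (cabs_grid_ge _ _ _ _); rewrite lerD2r node_gt.
by rewrite !(kern_far _ hf hp h) !mulr0 addr0.
Qed.

Definition phif (f : E -> C) : R -> R -> E -> R := fun r t x => cabs (f (lam r t *: x)).

Section phif.
Variable f : E -> C.
Hypothesis lf : lipb f.

Lemma phif_cbnd r t : cbnd (phif f r t).
Proof. by apply: (@cbnd_cabs _ _ (pull (lam r t) f)); exact: lipb_pull. Qed.

Lemma phif_ge0 r t x : 0 <= phif f r t x. Proof. exact: cabs_ge0. Qed.

Lemma phif_le : exists B, forall r t x, phif f r t x <= B.
Proof. by case: lf => _ [B hB]; exists B => r t x; exact: hB. Qed.

Lemma phif_cont (r t : R) x (r_ t_ : nat -> R) : 0 < r ->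
  r_ n @[n --> \oo] --> r -> t_ n @[n --> \oo] --> t ->
  phif f (r_ n) (t_ n) x @[n --> \oo] --> phif f r t x.
Proof.
move=> _ hr ht.
have h1 : lam (r_ n) (t_ n) *: x @[n --> \oo] --> lam r t *: x.
  by apply: cvgZr_tmp; exact: lam_cvg.
exact: (cvg_comp _ _ h1 (@cabs_continuous _ _ f (lipb_lipf lf) _)).
Qed.

Lemma riemann_phif P : riemann mu P (phif f) M @[M --> \oo] -->
  mint (spiral_measure muT P) (fun x => cabs (f x)).
Proof.
have [B hB] := phif_le.
rewrite spiral_measure_integral; [|exact: cbnd_cabs|by move=> x; exact: cabs_ge0].
exact: (riemann_cvg phif_cbnd phif_ge0 hB phif_cont).
Qed.

End phif.

Definition Kst (P : nat) (L : nat -> R) : R :=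
  2 * (k.+1%:R * (\prod_(i < k.+1) ((P%:R + 2) * L i))) * r0.

Lemma Kst_ge0 P L : (forall i, 0 <= L i) -> 0 <= Kst P L.
Proof.
move=> L0; rewrite /Kst !mulr_ge0//; apply: prodr_ge0 => i _.
by rewrite mulr_ge0// addr_ge0.
Qed.

Lemma gterm_le P n m f pi a b (L : nat -> R) : (0 < n)%N -> (0 < m)%N ->
  (a < P * (n * m))%N -> lipb f -> allb pi ->
  (forall i, 0 <= L i) -> (forall i, Lip (L i) (pi i)) ->
  cabs (gterm n m f pi a b) <= Kst P L * mint mu (phif f (node (n * m) a) (node (n * m) b)).
Proof.
move=> n0 m0 aP lf hp L0 hL.
set M := (n * m)%N in aP *; set l := grid R M a b.
have aP' : node M a <= P%:R by exact: node_le.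
have n1 : n%:R^-1 <= 1 :> R by rewrite invf_le1 ?ltr0n// ler1n.
have l1 : cabs l <= P%:R + 2 by apply: le_trans (cabs_grid_le _ _ _ _) _; lra.
have l2 : cabs (grid R M (a + m) b) <= P%:R + 2.
  by apply: le_trans (cabs_grid_le _ _ _ _) _; rewrite node_shift//; lra.
have l3 : cabs (grid R M a (b + m)) <= P%:R + 2.
  by apply: le_trans (cabs_grid_le _ _ _ _) _; lra.
have P2 : 1 <= P%:R + 2 :> R by have : 0 <= P%:R :> R by []; lra.
have la : lipb (amp l f) by exact: lipb_amp.
have k1 := kern_mass hp L0 hL la P2 l1 l2.
have k2 := kern_mass hp L0 hL la P2 l1 l3.
set Kp := k.+1%:R * _ in k1 k2.
have Kp0 : 0 <= Kp.
  by rewrite mulr_ge0//; apply: prodr_ge0 => i _; rewrite mulr_ge0// (le_trans ler01).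
set I := mint mu _ in k1 k2.
have I0 : 0 <= I by exact: mint_cabs_ge0.
have II : I <= mint mu (phif f (node M a) (node M b)).
  apply: mint_le => //; [exact: cbnd_cabs|exact: phif_cbnd|].
  by move=> x; rewrite /amp cabsM; apply: ler_piMl; [exact: cabs_ge0|exact: cutoff_bnd].
apply: (@le_trans _ _ (2 * Kp * r0 * I)); last first.
  by rewrite /Kst -/Kp; apply: ler_wpM2l => //; apply: mulr_ge0 => //; exact: mulr_ge0.
apply: le_trans (cabsD _ _) _; rewrite !cabsM cabs_nat.
have := ler_wpM2l (_ : 0 <= n%:R :> R) k1; move=> /(_ (ler0n _ _)).
rewrite cabs_grid_radial// => b1.
have b2 := ler_wpM2l (cabs_ge0 (angcoef n (node M a))) k2.
apply: le_trans (lerD b1 b2) _.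
have nn : n%:R * n%:R^-1 = 1 :> R by rewrite divff// pnatr_eq0 -lt0n.
have -> : n%:R * (Kp * (n%:R^-1 * r0 * I)) = Kp * r0 * I.
  have aux (p q : R) : p * (Kp * (q * r0 * I)) = (p * q) * (Kp * r0 * I) by ring.
  by rewrite aux nn mul1r.
have -> : 2 * Kp * r0 * I = Kp * r0 * I + Kp * r0 * I by ring.
rewrite lerD2l.
set c1 := cabs (angcoef _ _); set c2 := cabs _.
have -> : c1 * (Kp * (c2 * r0 * I)) = (c1 * c2) * (Kp * r0 * I) by ring.
apply: ler_piMl; [by apply: mulr_ge0 => //; exact: mulr_ge0|exact: angcoef_le].
Qed.

Lemma gsum_le P n m f pi (L : nat -> R) : (0 < n)%N -> (0 < m)%N ->
  lipb f -> allb pi -> (forall i, 0 <= L i) -> (forall i, Lip (L i) (pi i)) ->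
  cabs (gsum P n m f pi) <= Kst P L * riemann mu P (phif f) (n * m).
Proof.
move=> n0 m0 lf hp L0 hL.
rewrite /gsum /riemann cabsN cabsM cabs_rC ger0_norm ?sqr_ge0// mulrCA.
rewrite ler_wpM2l ?sqr_ge0//; apply: le_trans (cabs_sum _ _ _) _.
rewrite mulr_sumr; apply: ler_sum => a _.
apply: le_trans (cabs_sum _ _ _) _; rewrite mulr_sumr; apply: ler_sum => b _.
exact: gterm_le.
Qed.

Lemma Usum_near P rho f pi L e : bsupp rho f -> allb pi -> rho <= d * (P%:R - 1) ->
  (forall i, 0 <= L i) -> (forall i, Lip (L i) (pi i)) -> 0 < e ->
  \forall nm \near @iterated_oo,
    cabs (Usum nm.1 nm.2 f pi) <= Kst P L * (mint (nu P) (fun x => cabs (f x)) + e).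
Proof.
move=> hf hp hrho L0 hL e0; have lf := proj1 hf.
apply: (@near_iterated (fun n m => cabs (Usum n m f pi) <=
  Kst P L * (mint (nu P) (fun x => cabs (f x)) + e))).
near=> n => n0.
have Pn : (P <= n)%N by near: n; exact: nbhs_infty_ge.
have h := cvg_mulnr n0 (riemann_phif lf (P := P)).
near=> m => m0.
rewrite (Usum_restrict m hf hp hrho Pn).
apply: le_trans (gsum_le P n0 m0 lf hp L0 hL) _.
apply: ler_wpM2l; first exact: Kst_ge0.
have : `|mint (nu P) (fun x => cabs (f x)) - riemann mu P (phif f) (n * m)| < e.
  by near: m; exact: cvgr_dist_lt.
by rewrite distrC ltr_norml => /andP[_]; rewrite ltrBlDl => /ltW; rewrite addrC.
Unshelve. all: by end_near. Qed.

Section Margin.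
Variables (f g : E -> C) (V : set E) (eta : R).
Hypothesis (eta0 : 0 < eta) (oV : open V).
Hypothesis lf : lipb f.
Hypothesis hV : forall y, f y != 0 -> forall z, nrm (y - z) < eta -> V z.
Hypothesis dg : forall y, V y -> differentiable g y.

Lemma margin_closure y z : fsupp f y -> nrm (y - z) < eta -> V z.
Proof.
move=> fy yz.
have e0 : 0 < eta - nrm (y - z) by rewrite subr_gt0.
have [y' [/= fy' yy']] : [set x | f x != 0] `&` ball y (rC (eta - nrm (y - z))) !=set0.
  by apply: fy; apply: nbhsx_ballx; rewrite -[0]/(rC 0) rC_lt.
apply: (hV fy'); have {yy'} := proj1 (ball_nrm _ _ _) yy'.
have := nrmD (y' - y) (y - z); rewrite addrA subrK (nrm_distC y' y).
by move=> h1 h2; lra.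
Qed.

Lemma fsupp_amp l x : fsupp (amp l f) x -> nrm x <= r0 + 1 /\ fsupp f (l *: x).
Proof.
move=> hx; split.
  have : fsupp (cutoff r0 : E -> C) x by exact: (@fsupp_mulr _ _ _ (pull l f)).
  apply: (fsupp_sub (@closed_nrm_le _ _ _)) => z /=; apply: contraNT.
  by rewrite -ltNge => /ltW h; rewrite cutoff0.
by apply: (@fsupp_pull _ _ l f x); exact: (@fsupp_mull _ _ (cutoff r0)).
Qed.

Lemma holo_pull_amp l l' (A : set E) : cabs (l' - l) * (r0 + 1) < eta -> A `<=` fsupp (amp l f) ->
  holo_near (pull l' g) A.
Proof.
move=> hl hA; exists ((fun x => l' *: x) @^-1` V); split.
  by apply: open_comp => // x _; exact: scale_continuous.
split; last by move=> x /= Vx; apply: differentiable_pull; exact: dg.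
move=> x /hA /fsupp_amp[xr fx]; apply: (margin_closure fx).
rewrite nrm_distC -scalerBl nrmZ; apply: le_lt_trans hl.
by rewrite ler_wpM2l// cabs_ge0.
Qed.

Lemma holoB (u v : E -> C) (A : set E) : holo_near u A -> holo_near v A ->
  holo_near (fun x => u x - v x) A.
Proof.
move=> [V1 [op1 [A1 h1]]] [V2 [op2 [A2 h2]]]; exists (V1 `&` V2); split; first exact: openI.
split; first by move=> x Ax; split; [exact: A1|exact: A2].
by move=> x [/h1 d1 /h2 d2]; exact: differentiableB.
Qed.

Variables (pi : fam) (s : nat).
Hypothesis (hpi : allb pi) (sk : (s <= k)%N) (gs : pi s = g).

Lemma cabs_dist0 (l : C) : 0 <= r0 + 1 -> cabs (l - l) * (r0 + 1) < eta.
Proof. by move=> _; rewrite subrr cabs0 mul0r. Qed.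

(** Slot [s] still carries a dilate of [g], holomorphic near the support of [amp l f]. *)
Lemma kterm_off l l' j : (j <= k)%N -> j != s -> cabs (l' - l) * (r0 + 1) < eta ->
  kterm l l' (amp l f) pi j = 0.
Proof.
move=> jk js hl; apply: (sf_holo sf sk jk); first by rewrite eq_sym.
  apply: allb_upd; first by apply: allb_mix; exact: allb_pl.
  by apply: lipb_kslot; [exact: lipb_amp|exact: hpi].
rewrite upd_same upd_other 1?eq_sym// /mix /pl gs.
have r01 : 0 <= r0 + 1 by rewrite addr_ge0.
case: ifP => _; apply: holo_pull_amp; (try exact: fsupp_mulr); first exact: hl.
exact: cabs_dist0.
Qed.

Variables (L : nat -> R) (LF B : R).
Hypothesis L0 : forall i, 0 <= L i.
Hypothesis hL : forall i, Lip (L i) (pi i).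

Definition errconst (Lam LA : R) : R :=
  \sum_(j < k.+1) (\prod_(i < k.+1 | i != j :> nat) (if (i : nat) == s then LA else Lam * L i)) *
     (L j * r0 * (L s * r0) * mint mu (fun=> 1)).

(** Replacing [l'] by [l] in a slot [j < s] produces two small increments, in [j]
    and in [s]; Leibniz separates the one in [j] from [F], and each remaining
    term is either zero by holomorphy or quadratic in [l' - l]. *)
Lemma kterm_main l l' Lam LA : cabs (l' - l) * (r0 + 1) < eta ->
  1 <= Lam -> cabs l <= Lam -> cabs l' <= Lam -> 0 <= LA -> Lip LA (amp l f) ->
  cabs (kterm l l' (amp l f) pi s -
    tau (upd (pl l pi) s (fun x => amp l f x * (pull l' g x - pull l g x)))) <=
  errconst Lam LA * cabs (l' - l) ^+ 2.
Proof.
move=> hl Lam1 hl1 hl2 LA0 hLA.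
have Lam0 : 0 <= Lam by exact: le_trans ler01 _.
set F := amp l f; set h := fun x => pull l' g x - pull l g x.
have lF : lipb F by exact: lipb_amp.
have lg : lipb g by rewrite -gs.
have lh : lipb h by apply: lipbB; exact: lipb_pull.
have hX : lipb (fun x => F x * h x) by exact: lipbM.
pose p := upd (mix (pl l' pi) (pl l pi) s) s (fun x => F x * h x).
pose q := upd (pl l pi) s (fun x => F x * h x).
have ap : allb p by apply: allb_upd => //; apply: allb_mix; exact: allb_pl.
have aq : allb q by apply: allb_upd => //; exact: allb_pl.
rewrite (_ : kterm _ _ _ _ _ = tau p); last by rewrite /kterm gs.
rewrite (telescope (sf_ext sf) (sf_sub))//.
apply: le_trans (cabs_sum _ _ _) _; rewrite /errconst mulr_suml.
apply: ler_sum => j _; have jk : (j <= k)%N by rewrite -ltnS.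
have rhs0 : 0 <= (\prod_(i < k.+1 | i != j :> nat) (if (i : nat) == s then LA else Lam * L i)) *
     (L j * r0 * (L s * r0) * mint mu (fun=> 1)) * cabs (l' - l) ^+ 2.
  apply: mulr_ge0; last exact: sqr_ge0.
  apply: mulr_ge0; first by apply: prodr_ge0 => i _; case: eqP => // _; rewrite mulr_ge0.
  apply: mulr_ge0; last exact: mint_ge0.
  by apply: mulr_ge0; apply: mulr_ge0.
set am := mix p q j; have aam : allb am by exact: allb_mix.
have [js|js] := ltnP j s; last first.
  rewrite (_ : tau _ = 0) ?cabs0//.
  apply: (slot_zero jk).
    by apply: allb_upd => //; apply: lipbB; [exact: ap|exact: aq].
  move=> x _; rewrite upd_same /p /q /upd /mix.
  by case: eqVneq => [|_]; rewrite ?subrr// ltnNge js /= subrr.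
have js' : (j : nat) != s by rewrite neq_ltn js.
have sj : s != j by rewrite eq_sym.
pose del x := pull l' (pi j) x - pull l (pi j) x.
have ldel : lipb del by apply: lipbB; exact: lipb_pull.
have -> : upd am j (fun x => p j x - q j x) = upd (upd am j del) s (fun x => F x * h x).
  apply/funext => i; rewrite /am /upd /mix /p /q /upd /mix /pl.
  case: (eqVneq i s) => [->|ns]; first by rewrite (negbTE sj) ?eqxx; case: ifP.
  by case: (eqVneq i j) => // _; rewrite (negbTE js') js.
rewrite (sf_leibniz sf jk sk js' aam lF ldel lh).
rewrite [X in cabs (X + _)](_ : _ = 0) ?add0r; last first.
  apply: (sf_holo sf sk jk sj).
    by apply: allb_upd => //; apply: allb_upd => //; exact: lipbM.
  rewrite upd_same upd_other// upd_same.
  have sub : fsupp (fun x => del x * F x) `<=` fsupp F by exact: fsupp_mull.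
  have r01 : 0 <= r0 + 1 by rewrite addr_ge0.
  by apply: holoB; apply: holo_pull_amp; try exact: sub; [exact: hl|exact: cabs_dist0].
have lfin : allb (upd (upd am j (fun x => del x * h x)) s F).
  by apply: allb_upd => //; apply: allb_upd => //; exact: lipbM.
have := sf_mass sf jk lfin (L := fun i => if i == s then LA else Lam * L i).
rewrite upd_other// upd_same => hm; apply: le_trans (hm _ _) _.
- by move=> i; case: eqP => // _; rewrite mulr_ge0.
- move=> i ij; case: (eqVneq i s) => [->|ns]; first by rewrite upd_same.
  rewrite upd_other// upd_other// /am /mix.
  have P' (l2 : C) : cabs l2 <= Lam -> Lip (Lam * L i) (pull l2 (pi i)).
    by move=> h2; apply: Lip_le (Lip_pull _ (hL i)); rewrite ler_wpM2r.
  by case: ifP => _; rewrite /p /q upd_other// /mix /pl; [case: ifP => _|]; exact: P'.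
rewrite -[leRHS]mulrA ler_wpM2l//.
  by apply: prodr_ge0 => i _; case: eqP => // _; rewrite mulr_ge0.
rewrite (_ : _ * _ = mint mu (fun=> (L j * r0 * (L s * r0) * cabs (l' - l) ^+ 2) * 1)); last first.
  by rewrite mintZ//; [ring|exact: cbnd_cst].
apply: (mint_le_annulus).
- by apply: cbnd_cabs; exact: lipbM.
- exact: cbnd_cst.
move=> x /andP[_ xr]; rewrite mulr1 cabsM.
have b1 : cabs (del x) <= L j * (cabs (l' - l) * r0).
  apply: le_trans (pull_diff hL _ _ _ _) _.
  by rewrite ler_wpM2l// ler_wpM2l// cabs_ge0.
have b2 : cabs (h x) <= L s * (cabs (l' - l) * r0).
  rewrite /h -gs; apply: le_trans (pull_diff hL _ _ _ _) _.
  by rewrite ler_wpM2l// ler_wpM2l// cabs_ge0.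
apply: le_trans (ler_pM _ _ b1 b2) _; rewrite ?cabs_ge0//.
by apply: eq_imp_le; ring.
Qed.

End Margin.

Lemma sf_zero p j : (j <= k)%N -> allb p -> tau (upd p j (fun=> 0)) = 0.
Proof.
move=> jk hp; apply: (slot_zero jk).
  by apply: allb_upd => //; exact: lipb_cst.
by move=> x _; rewrite upd_same.
Qed.

Lemma sf_scale p j a u : (j <= k)%N -> allb p -> lipb u ->
  tau (upd p j (fun x => a * u x)) = a * tau (upd p j u).
Proof.
move=> jk hp hu; have := sf_lin sf a jk hp hu (lipb_cst E 0).
rewrite sf_zero// addr0 => <-; congr (tau (upd _ _ _)).
by apply/funext => x; rewrite addr0.
Qed.

Section Margin.
Variables (f g : E -> C) (V : set E) (eta : R).
Hypothesis (eta0 : 0 < eta) (oV : open V).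
Hypothesis hV : forall y, f y != 0 -> forall z, nrm (y - z) < eta -> V z.
Hypothesis dg : forall y, V y -> differentiable g y.
Variables (pi : fam) (s : nat).
Hypothesis (hpi : allb pi) (sk : (s <= k)%N) (gs : pi s = g).
Variables (L : nat -> R) (Lf Bf : R).
Hypothesis L0 : forall i, 0 <= L i.
Hypothesis hL : forall i, Lip (L i) (pi i).
Hypotheses (Lf0 : 0 <= Lf) (Bf0 : 0 <= Bf) (hLf : Lip Lf f) (hBf : bnd Bf f).
Variable P : nat.

Let Lam : R := P%:R + 2.
Let LA : R := 1 * (Lam * Lf) + Bf * 1.
Let W : R := errconst s L Lam LA.
Let KL : R := \prod_(i < k.+1 | i != s :> nat) (Lam * L i).

Lemma W_ge0 : 0 <= W.
Proof.
have Lam0 : 0 <= Lam by rewrite addr_ge0.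
have LA0 : 0 <= LA by rewrite /LA mul1r mulr1 addr_ge0// mulr_ge0.
apply: sumr_ge0 => j _; apply: mulr_ge0.
  by apply: prodr_ge0 => i _; case: eqP => // _; exact: mulr_ge0.
apply: mulr_ge0; last exact: mint_ge0.
by apply: mulr_ge0; apply: mulr_ge0.
Qed.

Lemma gterm_holo n m a b : (0 < n)%N -> (0 < m)%N -> (a < P * (n * m))%N ->
  n%:R^-1 * (r0 + 1) < eta -> P%:R * cabs (cis n%:R^-1 - 1 : C) * (r0 + 1) < eta ->
  cabs (gterm n m f pi a b) <= W * (n%:R^-1 + P%:R * cabs (cis n%:R^-1 - 1 : C)) +
    KL * mint mu (psi f g r0 n (node (n * m) a) (node (n * m) b)).
Proof.
move=> n0 m0 aP hr ha; have lf : lipb f by apply/lipbP; exists Lf, Bf.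
set M := (n * m)%N in aP *; set l := grid R M a b.
set lr := grid R M (a + m) b; set lt := grid R M a (b + m).
have aP' : node M a <= P%:R by exact: node_le.
have n1 : n%:R^-1 <= 1 :> R by rewrite invf_le1 ?ltr0n// ler1n.
have Pge0 : 0 <= P%:R :> R by [].
have l1 : cabs l <= Lam by apply: le_trans (cabs_grid_le _ _ _ _) _; rewrite /Lam; lra.
have l2 : cabs lr <= Lam.
  by apply: le_trans (cabs_grid_le _ _ _ _) _; rewrite node_shift// /Lam; lra.
have l3 : cabs lt <= Lam.
  by apply: le_trans (cabs_grid_le _ _ _ _) _; rewrite /Lam; lra.
have Lam1 : 1 <= Lam by rewrite /Lam; lra.
have Lam0 : 0 <= Lam by exact: le_trans ler01 _.
have LA0 : 0 <= LA by rewrite /LA mul1r mulr1 addr_ge0// mulr_ge0.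
set F := amp l f; have lF : lipb F by exact: lipb_amp.
have hLA : Lip LA F.
  apply: LipM; [exact: Lip_cutoff|exact: cutoff_bnd| |by move=> x; exact: hBf].
  by apply: Lip_le (Lip_pull _ hLf); rewrite ler_wpM2r.
have dr : cabs (lr - l) = n%:R^-1 by exact: cabs_grid_radial.
have dt : cabs (lt - l) <= P%:R * cabs (cis n%:R^-1 - 1 : C).
  by rewrite cabs_grid_angular// ler_wpM2r// cabs_ge0.
have r01 : 0 <= r0 + 1 by rewrite addr_ge0.
have hr' : cabs (lr - l) * (r0 + 1) < eta by rewrite dr.
have ht' : cabs (lt - l) * (r0 + 1) < eta.
  by apply: le_lt_trans ha; rewrite ler_wpM2r.
have off l' : cabs (l' - l) * (r0 + 1) < eta -> kern l l' F pi = kterm l l' F pi s.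
  move=> hl; rewrite /kern; have sk' : (s < k.+1)%N by [].
  rewrite (bigD1 (Ordinal sk'))//= big1 ?addr0// => j js.
  have jk : (j <= k)%N by rewrite -ltnS.
  by apply: (kterm_off eta0 oV lf hV dg hpi sk gs jk js hl).
rewrite /gterm -/M -/l -/lr -/lt -/F !off//.
pose T l' := tau (upd (pl l pi) s (fun x => F x * (pull l' g x - pull l g x))).
have main l' : cabs (l' - l) * (r0 + 1) < eta -> cabs l' <= Lam ->
    cabs (kterm l l' F pi s - T l') <= W * cabs (l' - l) ^+ 2.
  move=> hl hl'; exact: (kterm_main eta0 oV lf hV dg hpi sk gs L0 hL hl Lam1 l1 hl' LA0 hLA).
have e1 := main lr hr' l2; have e2 := main lt ht' l3.
set kr := kterm l lr F pi s in e1 *; set kt := kterm l lt F pi s in e2 *.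
set c := angcoef n (node M a).
have lg : lipb g by rewrite -gs.
have apl : allb (pl l pi) by exact: allb_pl.
have lkr l' : lipb (fun x => F x * (pull l' g x - pull l g x)) by exact: lipb_kslot.
have TT : n%:R * T lr + c * T lt =
    tau (upd (pl l pi) s (fun x => F x * dquot g n (node M a) (node M b) x)).
  rewrite /T -[c * _]sf_scale// -(sf_lin sf)//; last by apply: lipbZ.
  congr (tau (upd _ _ _)); apply/funext => x.
  rewrite /dquot /pull /l /lr /lt /grid !node_shift// -/c; ring.
have e3 : cabs (n%:R * T lr + c * T lt) <= KL * mint mu (psi f g r0 n (node M a) (node M b)).
  have lX : lipb (fun x => F x * dquot g n (node M a) (node M b) x).
    by apply: lipbM => //; exact: lipb_dquot.
  rewrite TT; have := sf_mass sf sk (allb_upd s apl lX) (L := fun i => Lam * L i).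
  rewrite upd_same => h; apply: (h _ _).
    by move=> i; rewrite mulr_ge0.
  move=> i ij; rewrite upd_other// /pl.
  by apply: Lip_le (Lip_pull _ (hL i)); rewrite ler_wpM2r.
have -> : n%:R * kr + c * kt = (n%:R * (kr - T lr) + c * (kt - T lt)) + (n%:R * T lr + c * T lt).
  by ring.
apply: le_trans (cabsD _ _) _; apply: lerD => //.
apply: le_trans (cabsD _ _) _; rewrite [leRHS]mulrDr; apply: lerD; rewrite cabsM.
  rewrite cabs_nat; apply: le_trans (ler_wpM2l (ler0n _ _) e1) _.
  rewrite dr (_ : n%:R * _ = W * n%:R^-1 * (n%:R * n%:R^-1)); last by rewrite expr2; ring.
  by rewrite divff ?mulr1// pnatr_eq0 -lt0n.
apply: le_trans (ler_wpM2l (cabs_ge0 _) e2) _.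
rewrite mulrCA ler_wpM2l ?W_ge0// expr2 mulrA; apply: le_trans dt.
rewrite ler_piMl ?cabs_ge0//; exact: angcoef_le.
Qed.

Lemma gsum_holo n m : (0 < n)%N -> (0 < m)%N ->
  n%:R^-1 * (r0 + 1) < eta -> P%:R * cabs (cis n%:R^-1 - 1 : C) * (r0 + 1) < eta ->
  cabs (gsum P n m f pi) <= P%:R * (W * (n%:R^-1 + P%:R * cabs (cis n%:R^-1 - 1 : C))) +
    KL * riemann mu P (psi f g r0 n) (n * m).
Proof.
move=> n0 m0 hr ha; rewrite /gsum cabsN cabsM cabs_rC ger0_norm ?sqr_ge0//.
have M0 : (n * m)%:R != 0 :> R by rewrite pnatr_eq0 -lt0n muln_gt0 n0.
set err := W * _.
apply: (@le_trans _ _ ((n * m)%:R^-1 ^+ 2 * \sum_(a < P * (n * m)) \sum_(b < n * m)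
   (err + KL * mint mu (psi f g r0 n (node (n * m) a) (node (n * m) b))))).
  rewrite ler_wpM2l ?sqr_ge0//; apply: le_trans (cabs_sum _ _ _) _; apply: ler_sum => a _.
  apply: le_trans (cabs_sum _ _ _) _; apply: ler_sum => b _; exact: gterm_holo.
under eq_bigr do rewrite big_split/= sumr_const card_ord -mulr_sumr.
rewrite big_split/= sumr_const card_ord -mulr_sumr mulrDr; apply: lerD.
  rewrite -mulrnA -(mulr_natr err) (natrM _ (n * m)%N (P * (n * m))%N) (natrM _ P).
  apply: eq_imp_le; move: ((n * m)%:R : R) M0 => Mr M0.
  by field.
by rewrite /riemann mulrCA.
Qed.

End Margin.

Variable Lam : (nat * nat -> C) -> C.
Hypothesis Lam_lin : forall a u v, evbounded iterated_oo u -> evbounded iterated_oo v ->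
  Lam (fun x => a * u x + v x) = a * Lam u + Lam v.
Hypothesis Lam_le : forall u B, (\forall x \near @iterated_oo, cabs (u x) <= B) ->
  cabs (Lam u) <= 2 * B.
Hypothesis Lam_cst : forall c, Lam (fun=> c) = c.

Definition cone (f : E -> C) (pi : fam) : C := Lam (fun nm => Usum nm.1 nm.2 f pi).

Lemma ex_radius rho : exists P : nat, rho <= d * (P%:R - 1).
Proof.
exists (Num.truncn (rho / d)).+2.
by rewrite -natr1 addrK mulrC -ler_pdivrMr//; apply/ltW; exact: truncnS_gt.
Qed.

Lemma Usum_bounded rho f pi : bsupp rho f -> allb pi ->
  evbounded iterated_oo (fun nm => Usum nm.1 nm.2 f pi).
Proof.
move=> hf hp; have [P hP] := ex_radius rho; have [L [L0 hL]] := lip_consts hp.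
by eexists; exact: (Usum_near hf hp hP L0 hL ltr01).
Qed.

Lemma cone_ext f pi pi' : (forall i, (i <= k)%N -> pi i = pi' i) -> cone f pi = cone f pi'.
Proof.
move=> h; congr Lam; apply/funext => nm; rewrite /Usum /gsum; congr (- (_ * _)).
apply: eq_bigr => a _; apply: eq_bigr => b _; rewrite /gterm.
by rewrite !(kern_ext _ _ _ h).
Qed.

Lemma cone_linl rho a f g pi : bsupp rho f -> bsupp rho g -> allb pi ->
  cone (fun x => a * f x + g x) pi = a * cone f pi + cone g pi.
Proof.
move=> hf hg hp; rewrite -Lam_lin; [|exact: Usum_bounded hf hp|exact: Usum_bounded hg hp].
congr Lam; apply/funext => nm; rewrite /Usum /gsum mulrN -opprD mulrCA -mulrDr.
congr (- (_ * _)); rewrite mulr_sumr -big_split; apply: eq_bigr => i _ /=.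
rewrite mulr_sumr -big_split; apply: eq_bigr => j _ /=; rewrite /gterm.
set l := grid _ _ _ _.
have -> : amp l (fun x => a * f x + g x) = fun x => a * amp l f x + amp l g x.
  by apply/funext => x; rewrite /amp /pull; ring.
have [lf lg] := (lipb_amp r0 l (proj1 hf), lipb_amp r0 l (proj1 hg)).
by rewrite !(kern_linF)//; ring.
Qed.

Lemma cone_linr rho a f pi i u v : bsupp rho f -> allb pi -> (i <= k)%N -> lipb u -> lipb v ->
  cone f (upd pi i (fun x => a * u x + v x)) = a * cone f (upd pi i u) + cone f (upd pi i v).
Proof.
move=> hf hp ik hu hv; rewrite -Lam_lin; last 2 first.
- by apply: (Usum_bounded hf); exact: allb_upd.
- by apply: (Usum_bounded hf); exact: allb_upd.
congr Lam; apply/funext => nm; rewrite /Usum /gsum mulrN -opprD mulrCA -mulrDr.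
congr (- (_ * _)); rewrite mulr_sumr -big_split; apply: eq_bigr => s _ /=.
rewrite mulr_sumr -big_split; apply: eq_bigr => j _ /=; rewrite /gterm.
set l := grid _ _ _ _; have lf := lipb_amp r0 l (proj1 hf).
by rewrite !(kern_linpi)//; ring.
Qed.

Lemma cone_mass P rho f pi L : bsupp rho f -> allb pi -> rho <= d * (P%:R - 1) ->
  (forall i, 0 <= L i) -> (forall i, Lip (L i) (pi i)) ->
  cabs (cone f pi) <= 2 * Kst P L * mint (nu P) (fun x => cabs (f x)).
Proof.
move=> hf hp hrho L0 hL; apply/ler_addgt0Pr => e e0.
have K0 := Kst_ge0 P L0.
have e1 : 0 < e / (2 * Kst P L + 1) by rewrite divr_gt0// ltr_wpDl// mulr_ge0.
apply: le_trans (Lam_le (Usum_near hf hp hrho L0 hL e1)) _.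
rewrite mulrA mulrDr lerD2l mulrCA -[leRHS]mulr1 ler_wpM2l ?(ltW e0)//.
by rewrite ler_pdivrMr ?mul1r ?lerDl// ltr_wpDl// mulr_ge0.
Qed.

Lemma Lam_small u : (forall e, 0 < e -> \forall x \near @iterated_oo, cabs (u x) <= e) ->
  Lam u = 0.
Proof.
move=> h; apply/eqP; rewrite -cabs_eq0 eq_le cabs_ge0 andbT.
apply/ler_addgt0Pr => e e0; rewrite add0r.
have e2 : 0 < e / 2 by rewrite divr_gt0.
by apply: le_trans (Lam_le (h _ e2)) _; rewrite mulrC divfK.
Qed.

(** The case where [f] stays at distance [eta] from the complement of [V]; the
    general one follows by truncating the values of [f] below [delta]. *)
Lemma cone_margin0 rho f pi s (V : set E) eta : bsupp rho f -> allb pi -> (s <= k)%N ->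
  0 < eta -> open V -> (forall y, f y != 0 -> forall z, nrm (y - z) < eta -> V z) ->
  (forall y, V y -> differentiable (pi s) y) -> cone f pi = 0.
Proof.
move=> hf hp sk eta0 oV hV dg; apply: Lam_small => e e0.
have [P hP] := ex_radius rho; have [L [L0 hL]] := lip_consts hp.
have lf := proj1 hf; have /lipbP[Lf [Bf [Lf0 Bf0 hLf hBf]]] := lf.
pose W := errconst s L (P%:R + 2) (1 * ((P%:R + 2) * Lf) + Bf * 1).
pose KL := \prod_(i < k.+1 | i != s :> nat) ((P%:R + 2) * L i).
have KL0 : 0 <= KL by apply: prodr_ge0 => i _; rewrite mulr_ge0// addr_ge0.
have dg' y : f y != 0 -> differentiable (pi s) y.
  by move=> fy; apply: dg; apply: (hV _ fy); rewrite subrr nrm0.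
have e2 : 0 < e / 2 by rewrite divr_gt0.
have cinv := @inv_nat_cvg R; have ccis := @cis_dist_cvg R.
have h1 : \forall n \near \oo, n.+3%:R^-1 * (r0 + 1) < eta.
  apply: near_lt0 => //; rewrite -[X in _ --> X](mul0r (r0 + 1)).
  by apply: cvgM => //; exact: cvg_cst.
have h2 : \forall n \near \oo, P%:R * cabs (cis n.+3%:R^-1 - 1 : C) * (r0 + 1) < eta.
  apply: near_lt0 => //; rewrite -[X in _ --> X](mul0r (r0 + 1)) -[in X in _ --> X](mulr0 P%:R).
  by apply: cvgM; [apply: cvgM => //|]; exact: cvg_cst.
have h3 : \forall n \near \oo,
    P%:R * (W * (n.+3%:R^-1 + P%:R * cabs (cis n.+3%:R^-1 - 1 : C))) < e / 2.
  apply: near_lt0 => //.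
  have -> : 0 = P%:R * (W * (0 + P%:R * 0)) :> R by rewrite mulr0 addr0 !mulr0.
  apply: cvgM; first exact: cvg_cst.
  apply: cvgM; first exact: cvg_cst.
  by apply: cvgD => //; apply: cvgM => //; exact: cvg_cst.
have h4 : \forall n \near \oo, KL * polar_int muT P (psi f (pi s) r0 n.+3) < e / 2.
  apply: near_lt0 => //; rewrite -[X in _ --> X](mulr0 KL).
  apply: cvgM; first exact: cvg_cst.
  exact: (psi_polar_cvg0 r00 lf (hp s) (L0 s) Bf0 (hL s) hBf dg').
apply: (@near_iterated (fun n m => cabs (Usum n m f pi) <= e)).
apply: near_shift3; near=> n => _.
have Pn : (P <= n.+3)%N.
  by do 3 apply: leqW; near: n; exact: nbhs_infty_ge.
have a1 : n.+3%:R^-1 * (r0 + 1) < eta by near: n.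
have a2 : P%:R * cabs (cis n.+3%:R^-1 - 1 : C) * (r0 + 1) < eta by near: n.
have a3 : P%:R * (W * (n.+3%:R^-1 + P%:R * cabs (cis n.+3%:R^-1 - 1 : C))) < e / 2 by near: n.
have a4 : KL * polar_int muT P (psi f (pi s) r0 n.+3) < e / 2 by near: n.
have cR : KL * riemann mu P (psi f (pi s) r0 n.+3) (n.+3 * m) @[m --> \oo] -->
    KL * polar_int muT P (psi f (pi s) r0 n.+3).
  apply: cvgM; first exact: cvg_cst.
  apply: cvg_mulnr => //.
  exact: (psi_riemann r00 lf (hp s) (L0 s) Bf0 (hL s) hBf).
near=> m => m0.
rewrite (Usum_restrict m hf hp hP Pn).
apply: le_trans (gsum_holo eta0 oV hV dg hp sk (erefl _) L0 hL Lf0 Bf0 hLf hBf _ m0 a1 a2) _ => //.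
rewrite [leRHS]splitr; apply: lerD; first exact: ltW.
by apply/ltW; near: m; exact: (cvgr_lt _ cR).
Unshelve. all: by end_near. Qed.

Section Threshold.
Variables (f : E -> C) (delta : R).
Hypotheses (delta0 : 0 < delta) (lf : lipb f).

Definition shrink : E -> C := fun x => f x * rC (clip01 (cabs (f x) / delta - 1)).

Lemma lipb_shrink_factor : lipb (fun x => rC (clip01 (cabs (f x) / delta - 1))).
Proof.
have [/lipfP[l l0 hl] _] := lf.
apply/lipbP; exists (l / delta), 1; split => //; first by rewrite divr_ge0// ltW.
  apply: Lip_rC => x y; apply: le_trans (clip01_lip _ _) _.
  rewrite (_ : _ - _ - _ = (cabs (f x) - cabs (f y)) / delta); last by ring.
  rewrite normrM (gtr0_norm (_ : 0 < delta^-1)) ?invr_gt0// mulrAC ler_pM2r ?invr_gt0//.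
  exact: le_trans (@nrm_dist R C (f x) (f y)) (hl x y).
by move=> x; rewrite cabs_rC ger0_norm ?clip01_le1// clip01_ge0.
Qed.

Lemma shrink_supp y : shrink y != 0 -> delta < cabs (f y).
Proof.
apply: contraNT; rewrite -leNgt => h; rewrite /shrink clip01_0 ?rC0 ?mulr0//.
by rewrite subr_le0 ler_pdivrMr// mul1r.
Qed.

Lemma shrink_dist y : cabs (f y - shrink y) <= 2 * delta.
Proof.
rewrite /shrink -[X in X - _](mulr1 (f y)) -mulrBr cabsM -rC1 -rCN -rCD cabs_rC.
have [h|h] := leP (2 * delta) (cabs (f y)).
  rewrite clip01_1 ?subrr ?normr0 ?mulr0; first by rewrite mulr_ge0// ltW.
  by rewrite lerBrDr ler_pdivlMr//; lra.
rewrite -[leRHS]mulr1; apply: ler_pM; rewrite ?cabs_ge0 ?(ltW h)//.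
have := clip01_ge0 (cabs (f y) / delta - 1); have := clip01_le1 (cabs (f y) / delta - 1).
by move=> h1 h2; rewrite ger0_norm; lra.
Qed.

End Threshold.

Lemma cone_holo rho f pi s : bsupp rho f -> allb pi -> (s <= k)%N ->
  holo_near (pi s) (fsupp f) -> cone f pi = 0.
Proof.
move=> hf hp sk [V [oV [fV dV]]]; have lf := proj1 hf.
have [/lipfP[l l0 hl] _] := lf.
have [P hP] := ex_radius rho; have [L [L0 hL]] := lip_consts hp.
have K0 := Kst_ge0 P L0.
set nu := spiral_measure muT P.
have nuT : (nu setT < +oo)%E by exact: spiral_measure_fin.
set A := 2 * Kst P L * (mint nu (fun=> 1)).
have A0 : 0 <= A by apply: mulr_ge0; [exact: mulr_ge0|exact: mint_ge0].
apply/eqP; rewrite -cabs_eq0 eq_le cabs_ge0 andbT.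
apply/ler_addgt0Pr => e e0; rewrite add0r.
pose delta := e / (2 * A + 1).
have d1 : 0 < delta by rewrite divr_gt0// ltr_wpDl// mulr_ge0.
have hs : bsupp rho (shrink f delta) by apply: bsuppM => //; exact: lipb_shrink_factor.
have c0 : cone (shrink f delta) pi = 0.
  pose eta := delta / (l + 1).
  have eta0 : 0 < eta by rewrite divr_gt0// ltr_wpDl.
  apply: (cone_margin0 hs hp sk eta0 oV _ dV) => y /(shrink_supp d1) hy z yz.
  apply: fV; apply: subset_closure => /=; apply/eqP => fz.
  have := hl y z; rewrite fz subr0 => h.
  move: yz; rewrite /eta ltr_pdivlMr ?ltr_wpDl// => yz.
  have : nrm (y - z) * (l + 1) < nrm (y - z) * (l + 1); last by rewrite ltxx.
  apply: lt_trans yz _; apply: lt_le_trans hy _; apply: le_trans h _.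
  by rewrite mulrC ler_wpM2l ?nrm_ge0// lerDl.
have hd : bsupp rho (fun x => (-1) * shrink f delta x + f x) by exact: bsupp_lin.
have fE : f = fun x => 1 * ((-1) * shrink f delta x + f x) + shrink f delta x.
  by apply/funext => x; ring.
rewrite fE (cone_linl 1 hd hs hp) c0 addr0 mul1r.
apply: le_trans (cone_mass hd hp hP L0 hL) _.
apply: (@le_trans _ _ (2 * Kst P L * (2 * delta * mint nu (fun=> 1)))).
  apply: ler_wpM2l; first by rewrite mulr_ge0.
  rewrite -mintZ//; last exact: cbnd_cst.
  apply: mint_le => //; [by apply: cbnd_cabs; exact: (proj1 hd)|by apply: cbndZ; exact: cbnd_cst|].
  by move=> x; rewrite mulr1 mulN1r addrC; exact: shrink_dist.
rewrite (_ : 2 * Kst P L * (2 * delta * mint nu (fun=> 1)) = delta * (2 * A)); last by rewrite /A; ring.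
rewrite /delta mulrAC ler_pdivrMr; last by rewrite ltr_wpDl// mulr_ge0.
by apply: ler_wpM2l; [exact: ltW|rewrite lerDl].
Qed.

Section Exact.
Variables (pi : fam) (s : nat) (rho : R).
Hypotheses (hp : allb pi) (sk : (s <= k)%N) (hs : bsupp rho (pi s)).

Lemma nrm_scale_move (l l' : C) (x : E) (r : R) : nrm x <= r -> 0 <= r ->
  nrm (l *: x) <= nrm (l' *: x) + cabs (l' - l) * r.
Proof.
move=> xr r_0; have -> : l *: x = l' *: x + (l - l') *: x.
  by rewrite -scalerDl addrC subrK.
apply: le_trans (nrmD _ _) _; rewrite lerD2l nrmZ -cabsN opprB.
by rewrite ler_wpM2l// cabs_ge0.
Qed.

Lemma kern_cutoff l l' : cabs (l' - l) * (r0 + 1) < 1 ->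
  kern l l' (amp l (cutoff (rho + 1))) pi = tau (pl l' pi) - tau (pl l pi).
Proof.
move=> hl; rewrite -(kern_one)//; apply: eq_bigr => j _.
have jk : (j <= k)%N by rewrite -ltnS.
have r01 : 0 <= r0 + 1 by rewrite addr_ge0.
have hl0 : cabs (l' - l) * r0 < 1.
  by apply: le_lt_trans hl; rewrite ler_wpM2l ?cabs_ge0// lerDl.
have lc : lipb (@cutoff R E (rho + 1)) by exact: lipb_cutoff.
have la : lipb (amp l (@cutoff R E (rho + 1))) by exact: lipb_amp.
have l1 : lipb (fun _ : E => 1 : C) by exact: lipb_cst.
rewrite /kterm; set m := mix _ _ _; have hm : allb m by apply: allb_mix; exact: allb_pl.
have [js|js] := eqVneq (j : nat) s.
  apply: (slot_eq) => //; [exact: lipb_kslot|exact: lipb_kslot|].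
  move=> x /andP[_ xr]; rewrite js mul1r /amp cutoff1// mul1r.
  have [h|h] := leP (nrm (l *: x)) (rho + 1).
    by rewrite {1}/pull cutoff1// mul1r.
  have h' : rho <= nrm (l' *: x).
    by have := nrm_scale_move l l' xr r00; lra.
  have [_ h0] := hs.
  have h2 : rho <= nrm (l *: x) by lra.
  by rewrite /pull (h0 _ h') (h0 _ h2) subrr mulr0.
pose D x := pull l' (pi j) x - pull l (pi j) x.
have lD : lipb D by apply: lipbB; exact: lipb_pull.
have l0 : lipb (@cutoff R E r0) by exact: lipb_cutoff.
transitivity (tau (upd m j (fun x => cutoff r0 x * D x))); last first.
  apply: (slot_eq) => //; [exact: lipbM|exact: lipb_kslot|].
  by move=> x /andP[_ xr]; rewrite cutoff1.
apply/eqP; rewrite -subr_eq0 -(sf_sub)//; last 2 first.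
- exact: lipb_kslot.
- exact: lipbM.
have lu : lipb (fun x => amp l (@cutoff R E (rho + 1)) x * D x - cutoff r0 x * D x).
  by apply: lipbB; exact: lipbM.
apply/eqP; apply: (sf_holo sf sk jk); [by rewrite eq_sym|exact: allb_upd|].
rewrite upd_same upd_other; last by rewrite eq_sym.
pose l2 := if (s < j)%N then l' else l.
have -> : m s = pull l2 (pi s) by rewrite /m /mix /pl /l2; case: ifP.
apply: (@holo_near_locally_cst _ _ _ _ [set x | rho < nrm (l2 *: x)] 0).
- apply: (@open_comp _ _ (fun x : E => l2 *: x) [set y | rho < nrm y]).
    by move=> x _; exact: scale_continuous.
  exact: open_nrm_gt.
- apply: (@subset_trans _ ([set x | nrm x <= r0 + 1] `&` [set x | rho + 1 <= nrm (l *: x)])); last first.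
    move=> x /= [xr h]; rewrite /l2; case: ifP => _; last by lra.
    by have := nrm_scale_move l l' xr r01; lra.
  apply: fsupp_sub.
    apply: closedI; first exact: closed_nrm_le.
    apply: (@closed_comp _ _ (fun x : E => l *: x) [set y | rho + 1 <= nrm y]).
      by move=> x _; exact: scale_continuous.
    exact: closed_nrm_ge.
  move=> x /=; rewrite -mulrBl => hx; split; rewrite leNgt; apply/negP => h.
    by move: hx; rewrite /amp cutoff0 ?(ltW h)// mul0r subrr mul0r eqxx.
  by move: hx; rewrite /amp /pull (cutoff1 (ltW h)) mulr1 subrr mul0r eqxx.
- by move=> x /= h; rewrite /pull (proj2 hs)// ltW.
Qed.

Let G (l : C) : C := tau (pl l pi).

Lemma G_far l : rho <= d * cabs l -> G l = 0.
Proof.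
move=> h; apply: (slot_zero sk); first exact: allb_pl.
move=> x /andP[dx _]; rewrite /pl /pull (proj2 hs)//; apply: le_trans h _.
by rewrite nrmZ mulrC ler_wpM2l// cabs_ge0.
Qed.

(** The angular differences sum to zero by periodicity, the radial ones telescope
    to the first [m] circles. *)
Lemma gsum_cutoff P n m : (0 < n)%N -> (0 < m)%N -> rho <= d * (P%:R - 1) ->
  n%:R^-1 * (r0 + 1) < 1 -> P%:R * cabs (cis n%:R^-1 - 1 : C) * (r0 + 1) < 1 ->
  gsum P n m (cutoff (rho + 1)) pi =
  rC ((n * m)%:R^-1 ^+ 2) * (n%:R * \sum_(b < n * m) \sum_(i < m) G (grid R (n * m) i b)).
Proof.
move=> n0 m0 hP hr ha; set M := (n * m)%N.
have M0 : (0 < M)%N by rewrite muln_gt0 n0.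
rewrite /gsum -mulrN -/M; congr (_ * _).
pose Gr a b : C := G (grid R M (a + m) b) - G (grid R M a b).
pose Ga a b : C := G (grid R M a (b + m)) - G (grid R M a b).
transitivity (- \sum_(a < P * M) \sum_(b < M) (n%:R * Gr a b + angcoef n (node M a) * Ga a b)).
  congr (- _); apply: eq_bigr => a _; apply: eq_bigr => b _; rewrite /gterm -/M.
  rewrite !kern_cutoff//.
    rewrite cabs_grid_angular//; apply: le_lt_trans ha.
    by rewrite ler_wpM2r ?addr_ge0// ler_wpM2r ?cabs_ge0// node_le.
  by rewrite cabs_grid_radial.
under eq_bigr do rewrite big_split/= -!mulr_sumr.
rewrite big_split/= [X in _ + X]big1 ?addr0; last first.
  move=> a _; rewrite (sum_shift_telescope (fun b => G (grid R M a b))) big1 ?mulr0// => i _.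
  rewrite (_ : grid R M a (M + i) = grid R M a i) ?subrr//.
  rewrite /grid /lam (_ : node M (M + i) = 1 + node M i) ?cisD ?cis1 ?mul1r//.
  by rewrite /node -addnS natrD mulrDl divff// pnatr_eq0 -lt0n.
rewrite -mulr_sumr -mulrN; congr (_ * _).
rewrite exchange_big/= -sumrN; apply: eq_bigr => b _.
rewrite (sum_shift_telescope (fun a => G (grid R M a b))) -sumrN; apply: eq_bigr => i _.
rewrite opprB (@G_far (grid R M (P * M + i) b)) ?subr0//; apply: le_trans hP _; rewrite ler_pM2l//.
apply: le_trans _ (cabs_grid_ge _ _ _ _); rewrite lerD2r.
by apply: node_gt => //; exact: leq_addr.
Qed.

Lemma gsum_cutoff_near P n m L : (0 < n)%N -> (0 < m)%N -> rho <= d * (P%:R - 1) ->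
  n%:R^-1 * (r0 + 1) < 1 -> P%:R * cabs (cis n%:R^-1 - 1 : C) * (r0 + 1) < 1 ->
  (forall i, 0 <= L i) -> (forall i, Lip (L i) (pi i)) ->
  cabs (gsum P n m (cutoff (rho + 1)) pi - tau pi) <=
  k.+1%:R * (\prod_(i < k.+1) (2 * L i)) * (n%:R^-1 * r0 * mint mu (fun=> 1)).
Proof.
move=> n0 m0 hP hr ha L0 hL; rewrite gsum_cutoff//; set M := (n * m)%N.
set K := k.+1%:R * _.
have M0 : (0 < M)%N by rewrite muln_gt0 n0.
have Mn0 : M%:R != 0 :> R by rewrite pnatr_eq0 -lt0n.
have nn0 : n%:R != 0 :> R by rewrite pnatr_eq0 -lt0n.
have mn0 : m%:R != 0 :> R by rewrite pnatr_eq0 -lt0n.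
have K0 : 0 <= K by rewrite mulr_ge0//; apply: prodr_ge0 => i _; rewrite mulr_ge0.
have I0 : 0 <= mint mu (fun=> 1) by apply: mint_ge0.
have tauE : tau pi = G 1.
  by apply: (sf_ext sf) => i _; apply/funext => x; rewrite /pl /pull scale1r.
have cnt : (M * m)%:R * (M%:R^-1 ^+ 2 * n%:R) = 1 :> R.
  by rewrite /M !natrM; field; rewrite mn0.
have rCn q : q%:R = rC q%:R :> C.
  elim: q => [|q ih]; first by rewrite rC0.
  by rewrite -natr1 ih -rC1 -rCD natr1.
have -> : rC (M%:R^-1 ^+ 2) * (n%:R * \sum_(b < M) \sum_(i < m) G (grid R M i b)) - tau pi =
    rC (M%:R^-1 ^+ 2 * n%:R) * \sum_(b < M) \sum_(i < m) (G (grid R M i b) - G 1).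
  under [in RHS]eq_bigr do rewrite sumrB sumr_const card_ord.
  rewrite sumrB sumr_const card_ord -mulrnA mulrBr; congr (_ - _).
    by rewrite [in RHS]rCM -rCn mulrA.
  by rewrite tauE -[G 1 *+ _]mulr_natl mulrA [X in _ = X * _]mulrC rCn -!rCM mulnC cnt rC1 mul1r.
rewrite cabsM cabs_rC ger0_norm; last by rewrite mulr_ge0// sqr_ge0.
apply: (@le_trans _ _ (M%:R^-1 ^+ 2 * n%:R *
    \sum_(b < M) \sum_(i < m) (K * (n%:R^-1 * r0 * mint mu (fun=> 1))))); last first.
  set Z := K * _; rewrite !sumr_const !card_ord -mulrnA -[Z *+ _]mulr_natl mulrA mulnC.
  by rewrite (mulrC (_ ^+ 2 * n%:R)) cnt mul1r.
apply: ler_wpM2l; first by rewrite mulr_ge0// sqr_ge0.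
apply: le_trans (cabs_sum _ _ _) _; apply: ler_sum => b _.
apply: le_trans (cabs_sum _ _ _) _; apply: ler_sum => i _.
have hgrid : cabs (grid R M i b - 1) <= n%:R^-1.
  rewrite /grid /lam (addrC 1) addrK cabsM cabs_cis mulr1 cabs_rC ger0_norm ?node_ge0//.
  rewrite /node ler_pdivrMr ?ltr0n// /M natrM mulKf// ler_nat.
  exact: ltn_ord.
have n1 : n%:R^-1 <= 1 :> R by rewrite invf_le1 ?ltr0n// ler1n.
have h2 : cabs (grid R M i b) <= 2.
  rewrite -[grid R M i b](subrK 1); apply: le_trans (cabsD _ _) _; rewrite cabs1; lra.
have h1 : cabs (1 : C) <= 2 by rewrite cabs1; lra.
have l1 : lipb (fun _ : E => 1 : C) by exact: lipb_cst.
have := kern_mass hp L0 hL l1 _ h1 h2 => /(_ (ler1n _ 2)).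
rewrite (kern_one)// => h; apply: le_trans h _; rewrite ler_wpM2l// cabs1.
by rewrite ler_wpM2r// ler_wpM2r.
Qed.

End Exact.

Lemma Usum_cutoff_near pi s rho e : allb pi -> (s <= k)%N -> bsupp rho (pi s) -> 0 < e ->
  \forall nm \near @iterated_oo, cabs (Usum nm.1 nm.2 (cutoff (rho + 1)) pi - tau pi) <= e.
Proof.
move=> hp sk hs.
have hsg : bsupp (rho + 2) (@cutoff R E (rho + 1)).
  by split; [exact: lipb_cutoff|move=> x hx; apply: cutoff0; lra].
have [P hP] := ex_radius (rho + 2); have [L [L0 hL]] := lip_consts hp.
have hP' : rho <= d * (P%:R - 1) by apply: le_trans hP; rewrite lerDl.
set K := k.+1%:R * (\prod_(i < k.+1) (2 * L i)).
move=> e0; have cinv := @inv_nat_cvg R; have ccis := @cis_dist_cvg R.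
have h1 : \forall n \near \oo, n.+3%:R^-1 * (r0 + 1) < 1.
  apply: near_lt0 => //; rewrite -[X in _ --> X](mul0r (r0 + 1)).
  by apply: cvgM => //; exact: cvg_cst.
have h2 : \forall n \near \oo, P%:R * cabs (cis n.+3%:R^-1 - 1 : C) * (r0 + 1) < 1.
  apply: near_lt0 => //; rewrite -[X in _ --> X](mul0r (r0 + 1)) -[in X in _ --> X](mulr0 P%:R).
  by apply: cvgM; [apply: cvgM => //|]; exact: cvg_cst.
have h3 : \forall n \near \oo, K * (n.+3%:R^-1 * r0 * mint mu (fun=> 1)) < e.
  apply: near_lt0 => //; have -> : 0 = K * (0 * r0 * mint mu (fun=> 1)) by rewrite !mul0r mulr0.
  apply: cvgM; first exact: cvg_cst.
  by apply: cvgM; [apply: cvgM => //|]; exact: cvg_cst.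
apply: (@near_iterated (fun n m => cabs (Usum n m (cutoff (rho + 1)) pi - tau pi) <= e)).
apply: near_shift3; near=> n => _.
have Pn : (P <= n.+3)%N.
  by do 3 apply: leqW; near: n; exact: nbhs_infty_ge.
have a1 : n.+3%:R^-1 * (r0 + 1) < 1 by near: n.
have a2 : P%:R * cabs (cis n.+3%:R^-1 - 1 : C) * (r0 + 1) < 1 by near: n.
have a3 : K * (n.+3%:R^-1 * r0 * mint mu (fun=> 1)) < e by near: n.
apply: nearW => m m0; rewrite (Usum_restrict m hsg hp hP Pn).
apply: le_trans (ltW a3).
exact: (gsum_cutoff_near hp sk hs _ m0 hP' a1 a2 L0 hL).
Unshelve. all: by end_near. Qed.

Lemma cone_cutoff pi s rho : allb pi -> (s <= k)%N -> bsupp rho (pi s) ->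
  cone (cutoff (rho + 1)) pi = tau pi.
Proof.
move=> hp sk hs; rewrite /cone.
have small e := @Usum_cutoff_near pi s rho e hp sk hs.
pose w nm : C := Usum nm.1 nm.2 (cutoff (rho + 1)) pi - tau pi.
have -> : (fun nm => Usum nm.1 nm.2 (cutoff (rho + 1)) pi) = fun nm => 1 * w nm + tau pi.
  by apply/funext => nm; rewrite mul1r /w subrK.
rewrite Lam_lin.
- by rewrite Lam_cst (Lam_small small) mulr0 add0r.
- by exists 1; exact: small.
- by exists (cabs (tau pi)); exact: nearW.
Qed.

Lemma cone_dbar pi s rho rho' sigma (V : set E) : allb pi -> (s <= k)%N ->
  bsupp rho (pi s) -> bsupp rho' sigma ->
  open V -> fsupp (pi s) `<=` V -> (forall x, V x -> sigma x = 1) ->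
  cone sigma pi = tau pi.
Proof.
move=> hp sk hs hsg oV sV h1.
pose rr := Num.max rho' (rho + 2).
have hsg' : bsupp rr sigma by apply: bsupp_le hsg; rewrite le_max lexx.
have hc' : bsupp rr (@cutoff R E (rho + 1)).
  apply: (@bsupp_le _ _ (rho + 2)); first by rewrite le_max lexx orbT.
  by split; [exact: lipb_cutoff|move=> x hx; apply: cutoff0; lra].
have hd := bsupp_lin (-1) hc' hsg'.
have -> : sigma = fun x => 1 * (-1 * cutoff (rho + 1) x + sigma x) + cutoff (rho + 1) x.
  by apply/funext => x; ring.
rewrite (cone_linl 1 hd hc' hp).
rewrite (cone_cutoff hp sk hs) (cone_holo hd hp sk) ?mulr0 ?add0r//.
apply: (@holo_near_locally_cst _ _ _ _ (~` fsupp (pi s)) 0).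
- by apply: closed_openC; exact: fsupp_closed.
- apply: (@subset_trans _ (~` (V `&` [set x | nrm x < rho + 1]))); last first.
    apply: subsetC => x hx; split; first exact: sV.
    apply: (@le_lt_trans _ _ rho); last by rewrite ltrDl.
    have := @fsupp_sub _ _ (pi s) [set x | nrm x <= rho] (@closed_nrm_le _ _ _).
    apply=> // y; apply: contraNP => /negP; rewrite -ltNge => /ltW hy.
    by apply/eqP; exact: (proj2 hs).
  apply: fsupp_sub.
    by apply: open_closedC; apply: openI => //; exact: open_nrm_lt.
  move=> x /=; apply: contraNnot => -[Vx xr]; rewrite h1// cutoff1 ?(ltW xr)//.
  by rewrite mulr1 addNr.
- by move=> x hx; exact: fsuppP.
Qed.

Lemma Kst_slot P L j l : (j <= k)%N ->
  2 * Kst P (fun i => if i == j then l else L i) =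
  2 * Kst P (fun i => if i == j then 1 else L i) * l.
Proof.
move=> jk; have jk' : (j < k.+1)%N by [].
have e : \prod_(i < k.+1) (if i == j :> nat then l else L i) =
    \prod_(i < k.+1) (if i == j :> nat then 1 else L i) * l.
  rewrite (bigD1 (Ordinal jk'))//= [in RHS](bigD1 (Ordinal jk'))//= eqxx mul1r mulrC.
  congr (_ * _); apply: eq_bigr => i; rewrite -(inj_eq val_inj)/= => /negbTE -> //.
by rewrite /Kst !big_split/= e; ring.
Qed.

Lemma cone_leibniz rho f pi j u v : (j <= k)%N -> allb pi -> bsupp rho f ->
  lipb u -> lipb v ->
  cone f (upd pi j (fun x => u x * v x)) =
  cone (fun x => f x * u x) (upd pi j v) + cone (fun x => f x * v x) (upd pi j u).
Proof.
move=> jk hp hf hu hv; have [P hP] := ex_radius rho; have [L [L0 hL]] := lip_consts hp.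
pose K := 2 * Kst P (fun i => if i == j then 1 else L i).
have nuT : (nu P setT < +oo)%E by exact: spiral_measure_fin.
apply: (@Phi_leibniz _ _ (nu P) nuT (bsupp rho) (fun f u => cone f (upd pi j u)) K) => //.
- by split; [exact: lipb_cst|].
- by move=> g [].
- by move=> g h; exact: bsuppM.
- by move=> g h [lg g0] [lh h0]; split; [exact: lipbD|move=> x hx; rewrite g0// h0// addr0].
- move=> a g h w hg hh hw.
  exact: (cone_linl a hg hh (allb_upd j hp hw)).
- move=> a g w z hg hw hz.
  exact: (cone_linr a hg hp jk hw hz).
- move=> g w c V hg hw oV sV hc.
  apply: (cone_holo hg (allb_upd j hp hw) jk).
  by rewrite upd_same; exact: holo_near_locally_cst hc.
- by rewrite mulr_ge0// Kst_ge0// => i; case: eqP.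
- move=> g w l hg hw l0 hl.
  have := cone_mass hg (allb_upd j hp hw) hP
    (L := fun i => if i == j then l else L i).
  move=> h; apply: le_trans (h _ _) _.
  + by move=> i; case: eqP.
  + by move=> i; rewrite /upd; case: eqP.
  + apply: ler_wpM2r; first exact: mint_cabs_ge0.
    by rewrite Kst_slot.
Qed.

(** Leibniz in slot [j] moves the factor [u] out of the measure of [cone] on a
    Lipschitz slot, at the cost of a boundary term. *)
Lemma cone_by_parts rho f pi j u : (j <= k)%N -> allb pi -> bsupp rho f -> lipb u ->
  cone f (upd pi j u) = tau (upd pi j (fun x => f x * u x)) -
    cone (fun x => cutoff (rho + 1) x * u x) (upd pi j f).
Proof.
move=> jk hp hf hu; have lf := proj1 hf.
have hsg : bsupp (rho + 2) (@cutoff R E (rho + 1)).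
  by split; [exact: lipb_cutoff|move=> x hx; apply: cutoff0; lra].
have hfu : bsupp rho (fun x => f x * u x) by exact: bsuppM.
have := cone_leibniz jk hp hsg lf hu.
rewrite (cone_cutoff (s := j))//; last 2 first.
- by apply: allb_upd => //; exact: lipbM.
- by rewrite upd_same.
move=> ->; rewrite (_ : (fun x => cutoff (rho + 1) x * f x) = f) ?addrK//.
apply/funext => x; have [xr|xr] := leP (nrm x) (rho + 1); first by rewrite cutoff1// mul1r.
by rewrite (proj2 hf) ?mulr0//; lra.
Qed.

Section Bounds.
Variables (rho Lf B : R) (L Bp : nat -> R) (P : nat).
Hypotheses (L0 : forall i, 0 <= L i) (Lf0 : 0 <= Lf).
Hypothesis hP : rho + 2 <= d * (P%:R - 1).

Lemma cone_slot_le f pi j u : (j <= k)%N -> allb pi -> (forall i, i != j -> Lip (L i) (pi i)) ->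
  bsupp rho f -> Lip Lf f -> lipb u ->
  cabs (cone f (upd pi j u)) <=
   (\prod_(i < k.+1 | i != j :> nat) L i) * mint mu (fun x => cabs (f x * u x)) +
   2 * Kst P (fun i => if i == j then Lf else L i) *
     mint (nu P) (fun x => cabs (cutoff (rho + 1) x * u x)).
Proof.
move=> jk hp hL hf hLf hu; have lf := proj1 hf.
rewrite (cone_by_parts jk hp hf hu); apply: le_trans (cabsD _ _) _; rewrite cabsN; apply: lerD.
  have lfu : lipb (fun x => f x * u x) by exact: lipbM.
  have := sf_mass sf jk (allb_upd j hp lfu) L0; rewrite upd_same; apply.
  by move=> i ij; rewrite upd_other//; exact: hL.
have hsg : bsupp (rho + 2) (@cutoff R E (rho + 1)).
  by split; [exact: lipb_cutoff|move=> x hx; apply: cutoff0; lra].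
apply: (cone_mass (bsuppM hsg hu) (allb_upd j hp lf) hP).
  by move=> i; case: eqP.
by move=> i; rewrite /upd; case: eqVneq => // /hL.
Qed.

Variables (f_ : nat -> E -> C) (f : E -> C) (pi_ : nat -> fam) (pi : fam).
Hypotheses (hf_ : forall n, bsupp rho (f_ n)) (hf : bsupp rho f).
Hypotheses (hp_ : forall n, allb (pi_ n)) (hp : allb pi).
Hypotheses (hLf : Lip Lf f).
Hypotheses (hL_ : forall n i, Lip (L i) (pi_ n i)) (hL : forall i, Lip (L i) (pi i)).
Hypotheses (bf_ : forall n, bnd B (f_ n)) (bf : bnd B f).
Hypotheses (bp_ : forall n i, bnd (Bp i) (pi_ n i)) (bp : forall i, bnd (Bp i) (pi i)).
Hypothesis cf : forall x, f_ n x @[n --> \oo] --> f x.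
Hypothesis cp : forall i x, pi_ n i x @[n --> \oo] --> pi i x.

Lemma mint_diff_cvg (M : R) (m : {measure set (Bor E) -> \bar R}) (g_ : nat -> E -> C) g h :
  (m setT < +oo)%E -> (forall n, lipb (g_ n)) -> lipb g -> lipb h ->
  (forall n, bnd M (g_ n)) -> bnd M g ->
  (forall x, g_ n x @[n --> \oo] --> g x) ->
  mint m (fun x => cabs (h x * (g_ n x - g x))) @[n --> \oo] --> (0 : R).
Proof.
move=> mT lg_ lg lh bg_ bg hg; have [_ [Bh bh]] := lh.
rewrite -(@mint0 _ _ m); apply: (@mint_cvg _ _ m mT _ _ (Bh * (M + M))).
- by move=> n; apply: cbnd_cabs; apply: lipbM => //; exact: lipbB.
- exact: cbnd_cst.
- move=> n x; rewrite ger0_norm ?cabs_ge0// cabsM; apply: ler_pM; rewrite ?cabs_ge0//.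
  by apply: le_trans (cabsD _ _) _; rewrite cabsN; apply: lerD; [exact: bg_|exact: bg].
- move=> x; rewrite -(mulr0 (cabs (h x))).
  under eq_fun do rewrite cabsM.
  by apply: cvgM; [exact: cvg_cst|exact: cabs_sub_cvg].
Qed.

Lemma cone_slots_cvg : cone f (pi_ n) @[n --> \oo] --> cone f pi.
Proof.
have lf := proj1 hf.
apply: cvg_of_cabs.
pose c j n := cabs (cone f (upd (mix (pi_ n) pi j) j (fun x => pi_ n j x - pi j x))).
apply: (@cvg_le0 _ _ (fun n => \sum_(j < k.+1) c j n)).
- by move=> n; exact: cabs_ge0.
- move=> n; rewrite (@telescope _ _ (cone f) k (pi_ n) pi _ _ (hp_ n) hp).
  + exact: cabs_sum.
  + by move=> p q; exact: (cone_ext).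
  + move=> s j u v jk hs hu hv.
    have := cone_linr (-1) hf hs jk hv hu.
    rewrite mulN1r addrC => <-; congr (cone f (upd s j _)).
    by apply/funext => x; rewrite mulN1r addrC.
apply: cvg_sum0 => j jk.
set K1 := \prod_(i < k.+1 | i != j :> nat) L i.
set K2 := 2 * Kst P (fun i => if i == j then Lf else L i).
pose v n := K1 * mint mu (fun x => cabs (f x * (pi_ n j x - pi j x))) +
  K2 * mint (nu P) (fun x => cabs (cutoff (rho + 1) x * (pi_ n j x - pi j x))).
apply: (@cvg_le0 _ _ v).
- by move=> n; exact: cabs_ge0.
- move=> n; apply: cone_slot_le => //.
  + by apply: allb_mix.
  + by move=> i _; rewrite /mix; case: ifP.
  + by apply: lipbB; [exact: hp_|exact: hp].
have lj n : lipb (pi_ n j) by exact: hp_.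
have lj' : lipb (pi j) by exact: hp.
have -> : 0 = K1 * 0 + K2 * 0 :> R by rewrite !mulr0 addr0.
apply: cvgD; (apply: cvgM; first exact: cvg_cst).
  exact: (@mint_diff_cvg (Bp j) mu (fun n => pi_ n j) (pi j) f muT lj lj' lf (fun n => bp_ n j) (bp j) (@cp j)).
exact: (@mint_diff_cvg (Bp j) (nu P) (fun n => pi_ n j) (pi j) _ (@spiral_measure_fin _ _ _ muT P)
  lj lj' (lipb_cutoff E (rho + 1)) (fun n => bp_ n j) (bp j) (@cp j)).
Qed.

Lemma cone_cvg : cone (f_ n) (pi_ n) @[n --> \oo] --> cone f pi.
Proof.
have lf := proj1 hf.
rewrite -[X in _ --> X](add0r (cone f pi)).
have -> : (fun n => cone (f_ n) (pi_ n)) =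
    fun n => cone (fun x => -1 * f x + f_ n x) (pi_ n) + cone f (pi_ n).
  apply/funext => n.
  by rewrite (cone_linl (-1) hf (hf_ n) (hp_ n)) mulN1r addrAC addNr add0r.
have h1 : cone (fun x => -1 * f x + f_ n x) (pi_ n) @[n --> \oo] --> (0 : C).
  apply: cvg_of_cabs.
  apply: (@cvg_le0 _ _ (fun n => 2 * Kst P L * mint (nu P) (fun x => cabs (1 * (f_ n x - f x))))).
  - by move=> n; exact: cabs_ge0.
  - move=> n; rewrite subr0.
    have hP' : rho <= d * (P%:R - 1) by apply: le_trans hP; rewrite lerDl.
    apply: le_trans (cone_mass (bsupp_lin (-1) hf (hf_ n)) (hp_ n) hP' L0 (hL_ n)) _.
    apply: eq_imp_le; congr (_ * mint _ _).
    by apply/funext => x; rewrite mul1r mulN1r addrC.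
  rewrite -(mulr0 (2 * Kst P L)); apply: cvgM; first exact: cvg_cst.
  exact: (@mint_diff_cvg B (nu P) f_ f (fun=> 1) (@spiral_measure_fin _ _ _ muT P)
    (fun n => proj1 (hf_ n)) lf (lipb_cst E 1) bf_ bf (@cf)).
exact: (@cvgD _ C _ _ _ _ _ _ _ h1 cone_slots_cvg).
Qed.
End Bounds.

Lemma cone_agree rho f (V : set E) p q : bsupp rho f -> allb p -> allb q -> open V ->
  fsupp f `<=` V -> (forall i x, V x -> p i x = q i x) -> cone f p = cone f q.
Proof.
move=> hf hp hq oV fV pq; apply/eqP; rewrite -subr_eq0; apply/eqP.
rewrite (@telescope _ _ (cone f) k p q _ _ hp hq).
- apply: big1 => j _; have jk : (j <= k)%N by rewrite -ltnS.
  have lpq : lipb (fun x => p j x - q j x) by apply: lipbB; [exact: hp|exact: hq].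
  apply: (cone_holo hf (allb_upd j (allb_mix j hp hq) lpq) jk).
  rewrite upd_same; apply: (holo_near_locally_cst (c := 0) oV fV) => x Vx.
  by rewrite pq// subrr.
- by move=> p' q'; exact: (cone_ext).
- move=> s j u v jk hs hu hv.
  have := cone_linr (-1) hf hs jk hv hu.
  rewrite mulN1r addrC => <-; congr (cone f (upd s j _)).
  by apply/funext => x; rewrite mulN1r addrC.
Qed.

Definition qcone (f : E -> C) (s : seq (E -> C)) : C := cone f (trunc (radius f + 1) s).

Lemma qconeE f s N : form f s -> 0 < N -> fsupp f `<=` [set x | nrm x < N] ->
  qcone f s = cone f (trunc N s).
Proof.
move=> hs N0 fN; have [hf _] := hs; have [r1 hr] := radiusP hf.
have R0 : 0 < radius f + 1 by rewrite addr_gt0.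
have fR : fsupp f `<=` [set x | nrm x < radius f + 1].
  by apply: bsupp_fsupp hr; rewrite ltrDl.
apply: (@cone_agree _ _ ([set x | nrm x < N] `&` [set x | nrm x < radius f + 1]) _ _ hr).
- exact: allb_trunc hs.
- exact: allb_trunc hs.
- by apply: openI; exact: open_nrm_lt.
- by move=> x fx; split; [exact: fN|exact: fR].
- by move=> i x [/= h1 h2]; rewrite /trunc !cutr_id// ltW.
Qed.

Lemma qconeE_bsupp rho N f s : form f s -> 0 < rho -> rho < N -> bsupp rho f ->
  qcone f s = cone f (trunc N s).
Proof.
move=> hs rho0 rN hf; apply: qconeE => //; first exact: lt_trans rN.
exact: bsupp_fsupp hf.
Qed.

Lemma qcone_multilinear : qloc_multilinear k.+1 qcone.
Proof.
split.
- move=> a f g s hf hg.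
  have [rf0 hrf] := radiusP (proj1 hf); have [rg0 hrg] := radiusP (proj1 hg).
  pose rho := Num.max (radius f) (radius g).
  have rho0 : 0 < rho by rewrite lt_max rf0.
  have bf : bsupp rho f by apply: bsupp_le hrf; rewrite le_max lexx.
  have bg : bsupp rho g by apply: bsupp_le hrg; rewrite le_max lexx orbT.
  have bfg := bsupp_lin a bf bg.
  have rN : rho < rho + 1 by rewrite ltrDl.
  have N0 : 0 < rho + 1 by exact: lt_trans rN.
  have hfg : form (fun x => a * f x + g x) s.
    have [_ hs] := hf; split => //; split; first exact: lipb_lipf (proj1 bfg).
    exists (rho + 1) => x /(bsupp_fsupp rN bfg) h; exact/ball0_nrm.
  rewrite (qconeE_bsupp hfg rho0 rN bfg) (qconeE_bsupp hf rho0 rN bf) (qconeE_bsupp hg rho0 rN bg).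
  exact: (cone_linl a bf bg (allb_trunc N0 hf)).
- move=> a f s j p q jk hp hq; have [r1 hr] := radiusP (proj1 hp).
  have jk' : (j <= k)%N by rewrite -ltnS.
  have N0 : 0 < radius f + 1 by rewrite addr_gt0.
  have lp : lipb (cutr (radius f + 1) p).
    by apply: lipb_cutr => //; have := qloc_ent j hp; rewrite ent_set_nth eqxx.
  have lq : lipb (cutr (radius f + 1) q).
    by apply: lipb_cutr => //; have := qloc_ent j hq; rewrite ent_set_nth eqxx.
  rewrite /qcone !trunc_set_nth; set b := trunc _ s; set p' := cutr _ p in lp *.
  have upd2 u : upd b j u = upd (upd b j p') j u by rewrite upd_upd.
  rewrite (upd2 p') (upd2 (cutr _ q)) (upd2 (cutr _ (fun x => _))).
  have hb : allb (upd b j p') by rewrite /b /p' -trunc_set_nth; exact: allb_trunc hp.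
  exact: (cone_linr a hr hb jk' lp lq).
Qed.

Lemma qcone_holo f s j : form f s -> (j <= k)%N -> holo_near (ent s j) (fsupp f) ->
  qcone f s = 0.
Proof.
move=> hs jk hol; have [r1 hr] := radiusP (proj1 hs).
have N0 : 0 < radius f + 1 by rewrite addr_gt0.
apply: (cone_holo hr (allb_trunc N0 hs) jk).
apply: holo_near_cutr => //; apply: bsupp_fsupp hr; by rewrite ltrDl.
Qed.

Lemma qcone_local : qloc_local k.+1 qcone.
Proof.
move=> f s hs [j [js [V [c [oV [fV hc]]]]]].
have [_ [sk _]] := hs; apply: (qcone_holo hs (j := j)); first by rewrite -ltnS -sk.
exact: holo_near_locally_cst hc.
Qed.

Lemma qcone_bidim : qloc_bidim 0 k.+1 k.+1 qcone.
Proof.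
move=> f s hs; have [_ [sk _]] := hs; case.
  rewrite -has_count => /hasP[g /(nthP (fun=> 0))[j js <-] /asboolP hol].
  by apply: (qcone_holo hs (j := j)) => //; rewrite -ltnS -sk.
by move=> h; have := leq_trans h (count_size _ _); rewrite sk ltnn.
Qed.

Hypothesis mu_radon : finite_radon mu.

Lemma qcone_mass : qloc_mass k.+1 qcone.
Proof.
move=> r rr0; have [P hP] := ex_radius r.
pose c := 2 * Kst P (fun=> 2).
have c0 : 0 <= c by rewrite mulr_ge0// Kst_ge0.
exists (mscale (NngNum c0) (spiral_measure muT P)); split.
  by apply: finite_radon_mscale; exact: spiral_measure_radon.
move=> f s hs fr L hL; have [hf [sk _]] := hs.
have [rho rho0 [lf _]] := qloc_fun_bsupp hf.
have fr' : fsupp f `<=` [set x | nrm x < r] by move=> x /fr /ball0_nrm.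
have f0 x : r <= nrm x -> f x = 0.
  by move=> rx; apply: fsuppP => /fr' /=; rewrite ltNge rx.
have br : bsupp r f by [].
pose l i : R := if (i < k.+1)%N then cabs (L i) else 0.
have l0 i : 0 <= l i by rewrite /l; case: ifP => // _; exact: cabs_ge0.
have hl i : Lip (2 * l i) (trunc r s i).
  have qi := qloc_ent i hs.
  apply: Lip_cutr_sharp => // x y xr yr; rewrite /l; case: ltnP => ik.
    by apply: (lipschitz_on_nrm (hL _ ik)); exact/ball0_nrm.
  by rewrite /ent nth_default ?sk// subrr cabs0 mul0r.
rewrite (qconeE hs rr0 fr').
have cf : cbnd (fun x => cabs (f x)) by exact: cbnd_cabs.
have mf : measurable_fun [set: Bor E] (fun x : Bor E => (cabs (f (x : E)))%:E).
  by apply/measurable_EFinP; apply: continuous_Bor; case: cf.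
have mB : measurable (ball (0 : E) (rC r) : set (Bor E)).
  by apply: open_Bor; apply: ball_open; rewrite -rC0 rC_lt.
rewrite ge0_integral_mscale//=; last 2 first.
- exact: measurable_funS mf.
- by move=> x _; rewrite lee_fin cabs_ge0.
have -> : (\int[spiral_measure muT P]_(x in (ball (0%R : E) (rC r) : set (Bor E))) (cabs (f x))%:E =
    (mint (spiral_measure muT P) (fun x => cabs (f x)))%:E)%E.
  rewrite -(mintE (@spiral_measure_fin _ _ _ muT P) cf) integral_mkcond [RHS]integral_mkcond.
  apply: eq_integral => x _; rewrite /patch mem_setT; case: ifPn => // /negP hx.
  rewrite f0 ?cabs0// leNgt; apply/negP => xr; apply: hx; rewrite inE; exact/ball0_nrm.
rewrite -!EFinM lee_fin.
have := cone_mass br (allb_trunc rr0 hs) hP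
  (L := fun i => 2 * l i) _ hl.
move=> h; apply: le_trans (h _) _; first by move=> i; rewrite mulr_ge0.
rewrite mulrA ler_wpM2r//; first exact: mint_cabs_ge0.
have -> : \prod_(j < k.+1) cabs (L j) = \prod_(j < k.+1) l j.
  by apply: eq_bigr => i _; rewrite /l ltn_ord.
rewrite /c /Kst (eq_bigr (fun i : 'I_k.+1 => ((P%:R + 2) * 2) * l i)); last by move=> i _; rewrite mulrA.
by rewrite big_split/= le_eqVlt; apply/orP; left; apply/eqP; ring.
Qed.

Lemma qcone_continuous : qloc_continuous k.+1 qcone.
Proof.
move=> f s fs ps hf hfs cf cp [r hr] [Lc hLc] hps.
have [rf0 hrf] := radiusP (proj1 hf).
pose rho := Num.max (Num.max r 0) (radius f).
have rho0 : 0 < rho by rewrite /rho lt_max rf0 orbT.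
have bf : bsupp rho f by apply: bsupp_le hrf; rewrite le_max lexx orbT.
have bfs n : bsupp rho (fs n).
  have [rho' _ [lf _]] := qloc_fun_bsupp (proj1 (hfs n)); split => // x.
  rewrite /rho !ge_max => /andP[/andP[rx _] _]; apply: fsuppP => /hr /ball0_nrm.
  by rewrite ltNge rx.
pose N := rho + 1; have rN : rho < N by rewrite ltrDl.
have N0 : 0 < N by exact: lt_trans rN.
have NN : N < N + 1 by rewrite ltrDl.
rewrite (qconeE_bsupp hf rho0 rN bf).
rewrite (_ : (fun n => _) = fun n => cone (fs n) (trunc N (ps n))); last first.
  apply/funext => n.
  exact: (qconeE_bsupp (hfs n) rho0 rN (bfs n)).
have [Lq hLq] := hps (N + 1).
have sz n : size (ps n) = k.+1 by have [_ []] := hfs n.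
have sz' : size s = k.+1 by have [_ []] := hf.
have bps n i : Lip_ball (cabs Lq) (N + 1) (ent (ps n) i).
  move=> x y xN yN; have [ik|ik] := ltnP i k.+1.
    by apply: (lipschitz_on_nrm (hLq n i ik)); exact/ball0_nrm.
  by rewrite /ent nth_default ?sz// subrr cabs0 mulr_ge0 ?cabs_ge0 ?nrm_ge0.
have /choice[Ls hLs] : forall i, exists L, 0 <= L /\ Lip_ball L (N + 1) (ent s i).
  by move=> i; have [L L0 hL] := qloc_lip_ball (N + 1) (qloc_ent i hf); exists L.
have cent i x : ent (ps n) i x @[n --> \oo] --> ent s i x.
  have [ik|ik] := ltnP i k.+1; first exact: cp.
  rewrite (_ : (fun n => _) = fun=> ent s i x); first exact: cvg_cst.
  by apply/funext => n; rewrite /ent !nth_default ?sz ?sz'.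
have /choice[B0 hB0] : forall i, exists M, 0 <= M /\ forall n, cabs (ent (ps n) i 0) <= M.
  by move=> i; have [M M0 hM] := cvg_cabs_bounded (cent i 0); exists M.
have [M1 M10 hM1] := cvg_cabs_bounded (cf 0).
have [/lipfP[Lf Lf0 hLf] _] := proj1 hf.
have [P hP] := ex_radius (rho + 2).
have Lc0 := cabs_ge0 Lc; have Lq0 := cabs_ge0 Lq.
pose L i := 2 * cabs Lq + 2 * Ls i.
have Ls0 i : 0 <= Ls i by have [] := hLs i.
have L0 i : 0 <= L i by rewrite addr_ge0// mulr_ge0.
pose B := (M1 + cabs Lc * rho) + (cabs (f 0) + Lf * rho).
pose Bp i := (B0 i + cabs Lq * N) + (cabs (ent s i 0) + Ls i * N).
apply: (cone_cvg L0 Lf0 hP bfs bf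
   (fun n => allb_trunc N0 (hfs n)) (allb_trunc N0 hf) hLf (B := B) (Bp := Bp)).
- move=> n i; apply: (Lip_le _ (Lip_cutr N0 NN Lq0 (bps n i))).
  by rewrite lerDl mulr_ge0.
- move=> i; apply: (Lip_le _ (Lip_cutr N0 NN (Ls0 i) (proj2 (hLs i)))).
  by rewrite lerDr mulr_ge0.
- move=> n x.
  apply: le_trans (bsupp_bnd (ltW rho0) Lc0 (lipschitz_Lip (hLc n)) (bfs n) x) _.
  apply: (@le_trans _ _ (M1 + cabs Lc * rho)); first by rewrite lerD2r hM1.
  by rewrite lerDl addr_ge0 ?cabs_ge0// mulr_ge0// ltW.
- move=> x; apply: le_trans (bsupp_bnd (ltW rho0) Lf0 hLf bf x) _.
  by rewrite lerDr addr_ge0// mulr_ge0// ltW.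
- move=> n i x; apply: le_trans (bnd_cutr N0 NN Lq0 (bps n i) x) _.
  apply: (@le_trans _ _ (B0 i + cabs Lq * N)); first by rewrite lerD2r (proj2 (hB0 i)).
  by rewrite lerDl addr_ge0 ?cabs_ge0// mulr_ge0// ltW.
- move=> i x; apply: le_trans (bnd_cutr N0 NN (Ls0 i) (proj2 (hLs i)) x) _.
  by rewrite lerDr addr_ge0 ?(proj1 (hB0 i))// mulr_ge0// ltW.
- exact: cf.
- by move=> i x; exact: cent.
Qed.
End Cone.

Section Truncation.
Variables (R : realType) (E : normedModType (Cplx R)).
Local Notation C := (Cplx R).
Variables (k : nat) (T : (E -> C) -> seq (E -> C) -> C).
Hypotheses (Tlin : AK_multilinear k T) (Tloc : AK_local k T).

Lemma AK_slot_eq f s j p q (V : set E) : (j < k)%N ->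
  AK_form k f (set_nth (fun _ => 0) s j p) -> AK_form k f (set_nth (fun _ => 0) s j q) ->
  open V -> fsupp f `<=` V -> (forall x, V x -> p x = q x) ->
  T f (set_nth (fun _ => 0) s j p) = T f (set_nth (fun _ => 0) s j q).
Proof.
move=> jk hp hq oV fV pq.
have := (proj2 Tlin) (-1) f s j q p jk hq hp.
rewrite Tloc.
- by move=> /esym/eqP; rewrite mulN1r addrC subr_eq0 => /eqP.
- have [lf [sz hs]] := hp; split; [exact: lf|split; first by rewrite -sz !size_set_nth].
  move=> i ik; have := hs i ik; have [_ [_ /(_ i ik)]] := hq.
  rewrite !ent_set_nth; case: eqP => [_|_ _]; last exact.
  move=> /lipfP[L1 L10 h1] /lipfP[L2 L20 h2]; apply/lipfP; exists (cabs (-1) * L1 + L2); first by rewrite addr_ge0// mulr_ge0// cabs_ge0.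
  by apply: LipD => //; exact: LipZ.
- have [_ [sz _]] := hp; exists j; rewrite size_set_nth -(size_set_nth (fun _ => 0) s j p) sz; split => //.
  exists V, 0; split => //; split => // x Vx.
  by rewrite ent_set_nth eqxx pq// mulN1r addNr.
Qed.

Lemma AK_trunc N f s : 0 < N -> fsupp f `<=` [set x | nrm x < N] -> AK_form k f s ->
  T f (mkseq (trunc N s) k) = T f s.
Proof.
move=> N0 fN [lf [sz hs]].
pose sm m := mkseq (fun i => if (i < m)%N then trunc N s i else ent s i) k.
have lip_trunc i : (i < k)%N -> lipf (trunc N s i).
  by move=> ik; apply: lipb_lipf; apply: lipb_cutr => //; apply: lipf_qloc_lip; exact: hs.
have hform m : AK_form k f (sm m).
  split; [exact: lf|split; first by rewrite size_mkseq].
  move=> i ik; rewrite /ent (nth_mkseq _ _ ik); case: ifP => _; [exact: lip_trunc|exact: hs].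
have setE m : (m < k)%N -> sm m.+1 = set_nth (fun _ => 0) (sm m) m (trunc N s m) /\
    sm m = set_nth (fun _ => 0) (sm m) m (ent s m).
  move=> mk; split; apply: (@eq_from_nth _ (fun _ => 0)); rewrite ?size_set_nth ?size_mkseq ?(maxn_idPr mk)//.
    move=> i ik; rewrite nth_set_nth /= !nth_mkseq// ltnS leq_eqVlt.
    by case: eqVneq => [->|].
  move=> i ik; rewrite nth_set_nth /= !nth_mkseq//.
  by case: eqVneq => [->|]//; rewrite ltnn.
have step m : (m <= k)%N -> T f (sm m) = T f (sm 0).
  elim: m => // m ih mk; rewrite -(ih (ltnW mk)).
  have [e1 e2] := setE m mk; rewrite e1 [in RHS]e2.
  apply: (@AK_slot_eq _ _ _ _ _ [set x | nrm x < N]).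
  - exact: mk.
  - by rewrite -e1; exact: hform.
  - by rewrite -e2; exact: hform.
  - exact: open_nrm_lt.
  - exact: fN.
  - by move=> x /ltW xN; rewrite /trunc cutr_id.
have e0 : sm 0 = s.
  apply: (@eq_from_nth _ (fun _ => 0)); rewrite size_mkseq ?sz// => i ik.
  by rewrite nth_mkseq.
rewrite -{2}e0 -(step k)//; congr (T f _); apply/eq_in_map => i.
by rewrite mem_iota add0n => /andP[_ ->].
Qed.
End Truncation.

Theorem theorem7p5 (R : realType) (E : completeNormedModType (Cplx R)) (k : nat)
  (T : (E -> Cplx R) -> seq (E -> Cplx R) -> Cplx R) :
  normal_current k T ->
  AK_bidim 0 k k T ->
  dbar_zero_0k k T ->
  supp_bounded_away_from_0 k T ->
  exists U : (E -> Cplx R) -> seq (E -> Cplx R) -> Cplx R,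
    [/\ qloc_current k.+1 U, qloc_bidim 0 k.+1 k.+1 U & dbar_qloc_eq k U T].
Proof.
move=> [[Tlin _ Tloc _] _] Thol Tclosed [mu [[Tmass _] [[r hr] [d [d0 hd]]]]].
have mu_radon : finite_radon mu by case: Tmass.
have muT : (mu setT < +oo)%E by case: mu_radon.
pose r0 := Num.max r 0.
have r00 : 0 <= r0 by rewrite le_max lexx orbT.
have mu_annulus : mu (~` [set x : Bor E | d <= nrm (x : E) <= r0]) = 0%E.
  apply: radon_null_open => //.
    rewrite (_ : [set x | _] = [set x : E | d <= nrm x] `&` [set x : E | nrm x <= r0]).
      apply: closed_openC; apply: closedI; [exact: closed_nrm_ge|exact: closed_nrm_le].
    by apply/seteqP; split => x /= => [/andP[]|[-> ->]].
  move=> x hx; have : ~ msupp mu x.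
    move=> mx; apply: hx => /=; apply/andP; split.
      by rewrite -(@rC_le R) -nrmE; exact: hd.
    by rewrite le_max ltW//; apply/ball0_nrm; exact: hr.
  move=> /existsNP[e /not_implyP[e0 he]]; exists e => //.
  by apply/eqP; rewrite -measure_le0 leNgt; apply/negP.
have sf := slot_is_functional muT Tlin Tloc Tmass Thol Tclosed.
have [Lam [Lam_lin [Lam_le Lam_cst]]] := complex_ultralimit R iterated_oo_filter.
exists (qcone k (slot T k) r0 Lam); split; first split.
- exact: (qcone_multilinear muT sf d0 r00 mu_annulus Lam_lin Lam_le).
- exact: (qcone_continuous muT sf d0 r00 mu_annulus Lam_lin Lam_le Lam_cst).
- exact: (qcone_local muT sf d0 r00 mu_annulus Lam_lin Lam_le).
- exact: (qcone_mass muT sf d0 r00 mu_annulus Lam_lin Lam_le mu_radon).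
- exact: (qcone_bidim muT sf d0 r00 mu_annulus Lam_lin Lam_le).
move=> f s hf hfs sigma hsg [V [oV [fV h1]]].
have [a0 ha] := radiusP hf; have [b0 hb] := radiusP hsg.
pose rho := Num.max (radius f) (radius sigma).
have rho0 : 0 < rho by rewrite lt_max a0.
have bf : bsupp rho f by apply: bsupp_le ha; rewrite le_max lexx.
have bs : bsupp rho sigma by apply: bsupp_le hb; rewrite le_max lexx orbT.
pose N := rho + 1; have rN : rho < N by rewrite ltrDl.
have N0 : 0 < N by exact: lt_trans rN.
have [lf [sz hs]] := hfs.
have form : qloc_form k.+1 sigma (f :: s).
  split=> //=; rewrite sz; split => // -[|j] jk; first exact: lipf_qloc_lip (proj1 hf).
  by apply: lipf_qloc_lip; exact: hs.
rewrite (qconeE_bsupp muT sf d0 r00 mu_annulus Lam_lin Lam_le form rho0 rN bs).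
have f0 : trunc N (f :: s) 0%N = f by apply: cutr_bsupp N0 (ltW rN) (proj2 bf).
rewrite (cone_dbar muT sf d0 r00 mu_annulus Lam_lin Lam_le Lam_cst (s := 0)
  (rho := rho) (allb_trunc N0 form) _ _ bs oV)// ?f0//.
rewrite /slot f0; apply: (AK_trunc Tlin Tloc N0 (bsupp_fsupp rN bf) hfs).
Qed.
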